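(* Let $\mathcal{A}$ be a unital operator algebra such that $\mathrm{C}^*_e(\mathcal{A})$ is residually finite-dimensional. Let $\pi$ be a strongly peaking $*$-representation for $\mathrm{C}^*_e(\mathcal{A})$. Then, $\pi$ is a finite-dimensional boundary representation for $\mathcal{A}$.
   Context: A unital operator algebra is a subalgebra of some $B(\mathcal{H})$ containing the identity. $\mathrm{C}^*$-envelope: $\mathrm{C}^*_e(\mathcal{A})$ is the unital $\mathrm{C}^*$-algebra $\mathfrak{E}$, with a unital completely isometric map $u:\mathcal{A}\to\mathfrak{E}$ such that $\mathfrak{E}=\mathrm{C}^*(u(\mathcal{A}))$, having the universal property that for every unital $\mathrm{C}^*$-algebra $\mathfrak{A}$ and unital completely isometric linear map $\iota:\mathcal{A}\to\mathfrak{A}$ with $\mathfrak{A}=\mathrm{C}^*(\iota(\mathcal{A}))$ there is a surjective $*$-homomorphism $q:\mathfrak{A}\to\mathfrak{E}$ with $q\circ\iota=u$. The map $u$ is then a homomorphism, and $\mathcal{A}$ is identified with $u(\mathcal{A})\subset \mathrm{C}^*_e(\mathcal{A})$. A $\mathrm{C}^*$-algebra is residually finite-dimensional (RFD) if it admits a separating set of finite-dimensional $*$-representations, i.e. $*$-representations on finite-dimensional Hilbert spaces whose direct sum is injective. Strongly peaking: let $\mathfrak{A}$ be a $\mathrm{C}^*$-algebra, $\mathcal{S}\subset\mathfrak{A}$ a subset, $\pi$ an irreducible $*$-representation of $\mathfrak{A}$. Then $\pi$ is a strongly peaking representation for $\mathcal{S}$ if there are $n\in\mathbb{N}$ and $T\in\mathbb{M}_n(\mathcal{S})$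 with $\|\pi^{(n)}(T)\|>\sup_\sigma\|\sigma^{(n)}(T)\|$, the supremum being over all irreducible $*$-representations $\sigma$ of $\mathfrak{A}$ not unitarily equivalent to $\pi$; here $\sigma^{(n)}$ is the entrywise ampliation of $\sigma$ to $\mathbb{M}_n(\mathfrak{A})$. In the claim, $\mathcal{S}=\mathfrak{A}=\mathrm{C}^*_e(\mathcal{A})$. Boundary representation: an irreducible $*$-representation $\pi$ of $\mathrm{C}^*_e(\mathcal{A})$ is a boundary representation for $\mathcal{A}$ if the only unital completely positive map on $\mathrm{C}^*_e(\mathcal{A})$ extending $\pi|_{\mathcal{A}}$ is $\pi$ itself. *)

(* Defs.v *)
From HB Require Import structures.
From mathcomp Require Import all_boot all_order all_algebra.
From mathcomp Require Import all_classical all_reals all_analysis.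
From mathcomp Require Import complex.

Set Implicit Arguments.
Unset Strict Implicit.
Unset Printing Implicit Defensive.

Import Order.TTheory GRing.Theory Num.Theory.
Import numFieldNormedType.Exports.

Local Open Scope classical_set_scope.
Local Open Scope ring_scope.
Local Open Scope complex_scope.

HB.mixin Record isHilbert (R : realType) H of CompleteNormedModule R[i] H := {
  inner : H -> H -> R[i];
  inner_linear : forall (a : R[i]) (x y z : H),
    inner (a *: x + y) z = a * inner x z + inner y z;
  inner_conj : forall x y : H, inner y x = (inner x y)^*;
  inner_norm : forall x : H, `|x| ^+ 2 = inner x x
}.

#[short(type="hilbertType")]
HB.structure Definition Hilbert (R : realType) :=
  {H of CompleteNormedModule R[i] H & isHilbert R H}.

(* The norm of a [completeNormedModType R[i]] takes its values in [R[i]];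
   [hnorm] is the same norm with values in [R]. *)
Definition hnorm (R : realType) (H : hilbertType R) (x : H) : R :=
  complex.Re `|x|.

Definition finite_dim (R : realType) (H : hilbertType R) : Prop :=
  exists (n : nat) (e : 'I_n -> H),
    forall x, exists c : 'I_n -> R[i], x = \sum_i c i *: e i.

Definition bounded_op (R : realType) (H : hilbertType R) : set (H -> H) :=
  [set T | linear T /\ exists M : R, forall x, hnorm (T x) <= M * hnorm x].

Definition opnorm (R : realType) (H : hilbertType R) (T : H -> H) : R :=
  sup [set hnorm (T x) | x in [set x | hnorm x <= 1]].

Definition adjoint_of (R : realType) (H : hilbertType R) (T S : H -> H) :=
  forall x y, inner (T x) y = inner x (S y).

Definition mx_over (X : Type) (S : set X) (n : nat) : set 'M[X]_n :=
  [set T | forall i j, S (T i j)].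

Definition mx_apply (R : realType) (H : hilbertType R) (n : nat)
    (T : 'M[H -> H]_n) (h : 'I_n -> H) : 'I_n -> H :=
  fun i => \sum_j T i j (h j).

Definition l2norm (R : realType) (H : hilbertType R) (n : nat)
    (h : 'I_n -> H) : R :=
  Num.sqrt (\sum_i hnorm (h i) ^+ 2).

Definition mx_opnorm (R : realType) (H : hilbertType R) (n : nat)
    (T : 'M[H -> H]_n) : R :=
  sup [set l2norm (mx_apply T h) | h in [set h | l2norm h <= 1]].

Definition mx_positive (R : realType) (H : hilbertType R) (n : nat)
    (T : 'M[H -> H]_n) : Prop :=
  forall h : 'I_n -> H, 0 <= \sum_i inner (mx_apply T h i) (h i).

(* Operator algebras and unital C*-algebras are sets of bounded operators on a
   Hilbert space, containing its identity; by the Gelfand-Naimark theorem this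
   is no restriction for C*-algebras.  The norm and the positive cone of M_n(A)
   are those of B(H^n).  A map defined on such a set is a function on
   all operators whose values outside of the set are irrelevant. *)

Definition unital_operator_algebra (R : realType) (H : hilbertType R)
    (A : set (H -> H)) : Prop :=
  [/\ A `<=` @bounded_op R H,
      A idfun,
      forall (a : R[i]) S T, A S -> A T -> A (a *: S + T) &
      forall S T, A S -> A T -> A (S \o T)].

Definition unital_cstar_algebra (R : realType) (H : hilbertType R)
    (A : set (H -> H)) : Prop :=
  [/\ unital_operator_algebra A,
      forall T, A T -> exists2 S, A S & adjoint_of T S &
      forall T, bounded_op T ->
        (forall e : R, 0 < e -> exists2 S, A S & opnorm (T - S) < e) -> A T].

Definition cstar_generated (R : realType) (H : hilbertType R)
    (S : set (H -> H)) : set (H -> H) :=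
  smallest (@unital_cstar_algebra R H) S.

Definition linear_on (R : realType) (H K : hilbertType R) (A : set (H -> H))
    (f : (H -> H) -> (K -> K)) : Prop :=
  forall (a : R[i]) S T, A S -> A T -> f (a *: S + T) = a *: f S + f T.

Definition unital_complete_isometry (R : realType) (H K : hilbertType R)
    (A : set (H -> H)) (f : (H -> H) -> (K -> K)) : Prop :=
  [/\ f @` A `<=` @bounded_op R K, linear_on A f, f idfun = idfun &
      forall (n : nat) (T : 'M[H -> H]_n), mx_over A T ->
        mx_opnorm (map_mx f T) = mx_opnorm T].

Definition star_hom (R : realType) (H K : hilbertType R) (A : set (H -> H))
    (f : (H -> H) -> (K -> K)) : Prop :=
  [/\ linear_on A f,
      forall S T, A S -> A T -> f (S \o T) = f S \o f T &
      forall S T, A S -> A T -> adjoint_of T S -> adjoint_of (f T) (f S)].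

Definition ucp (R : realType) (H K : hilbertType R) (A : set (H -> H))
    (f : (H -> H) -> (K -> K)) : Prop :=
  [/\ f @` A `<=` @bounded_op R K, linear_on A f, f idfun = idfun &
      forall (n : nat) (T : 'M[H -> H]_n), mx_over A T ->
        mx_positive T -> mx_positive (map_mx f T)].

Definition cstar_envelope (R : realType) (H K : hilbertType R)
    (A : set (H -> H)) (E : set (K -> K)) (u : (H -> H) -> (K -> K)) : Prop :=
  [/\ unital_cstar_algebra E,
      unital_complete_isometry A u,
      E = cstar_generated (u @` A) &
      forall (L : hilbertType R) (B : set (L -> L)) (i : (H -> H) -> (L -> L)),
        unital_cstar_algebra B ->
        unital_complete_isometry A i ->
        B = cstar_generated (i @` A) ->
        exists q : (L -> L) -> (K -> K),
          [/\ star_hom B q, q @` B = E & forall T, A T -> q (i T) = u T]].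

Definition star_rep (R : realType) (H K : hilbertType R) (A : set (H -> H))
    (p : (H -> H) -> (K -> K)) : Prop :=
  star_hom A p /\ p @` A `<=` @bounded_op R K.

Definition rfd (R : realType) (H : hilbertType R) (A : set (H -> H)) : Prop :=
  exists (I : Type) (K : I -> hilbertType R)
      (p : forall i, (H -> H) -> (K i -> K i)),
    (forall i, star_rep A (p i) /\ finite_dim (K i)) /\
    (forall T, A T -> (forall i, p i T = 0) -> T = 0).

Definition closed_subspace (R : realType) (H : hilbertType R) (M : set H) :=
  [/\ M 0, forall (a : R[i]) x y, M x -> M y -> M (a *: x + y) & closed M].

(* The nonvanishing clause excludes the zero representation on a space of
   dimension at most one. *)
Definition irreducible_rep (R : realType) (H K : hilbertType R)
    (A : set (H -> H)) (p : (H -> H) -> (K -> K)) : Prop :=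
  [/\ star_rep A p,
      exists2 T, A T & p T <> 0 &
      forall M : set K, closed_subspace M ->
        (forall T x, A T -> M x -> M (p T x)) -> M = [set 0] \/ M = setT].

Definition unitarily_equivalent (R : realType) (H K L : hilbertType R)
    (A : set (H -> H)) (p : (H -> H) -> (K -> K)) (s : (H -> H) -> (L -> L)) :=
  exists U : {linear K -> L},
    [/\ forall x y, inner (U x) (U y) = inner x y,
        forall z, exists x, U x = z &
        forall T, A T -> forall x, U (p T x) = s T (U x)].

Definition strongly_peaking (R : realType) (H K : hilbertType R)
    (A S : set (H -> H)) (p : (H -> H) -> (K -> K)) : Prop :=
  irreducible_rep A p /\
  exists n : nat, (0 < n)%N /\ exists2 T : 'M[H -> H]_n, mx_over S T &
    (ereal_sup [set r : \bar R |
       exists (L : hilbertType R) (s : (H -> H) -> (L -> L)),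
         [/\ irreducible_rep A s, ~ unitarily_equivalent A p s &
             r = (mx_opnorm (map_mx s T))%:E]]
     < (mx_opnorm (map_mx p T))%:E)%E.

Definition boundary_rep (R : realType) (H K : hilbertType R)
    (E S : set (H -> H)) (p : (H -> H) -> (K -> K)) : Prop :=
  irreducible_rep E p /\
  forall f : (H -> H) -> (K -> K), ucp E f ->
    (forall T, S T -> f T = p T) -> forall T, E T -> f T = p T.

(* Main.v *)
Require Import Defs.
From HB Require Import structures.
From mathcomp Require Import all_boot all_order all_algebra.
From mathcomp Require Import all_classical all_reals all_analysis.
From mathcomp Require Import complex ring lra.

(** The representation [p] is finite-dimensional because strong peaking isolates
    it.  Let [F] be the set of finite-dimensional irreducible representations of
    [E] that are not unitarily equivalent to [p].  If [F] separated the points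
    of [E], it would compute the norm of every matrix over [E]
    ([separating_bnd]), and [p] could not peak.  So some nonzero element is
    killed by all of [F] ([other_not_separating]).  Residual
    finite-dimensionality gives a finite-dimensional irreducible representation
    that does not kill it, which must be equivalent to [p].  Moreover [p] is
    injective on the common kernel of [F], an ideal, and maps it onto all
    operators of [L] by Burnside's theorem ([peak_lift]).  Hence [E] is the
    direct sum of a copy of the full matrix algebra B(L), with unit [z]
    ([peak_unit]), and of an algebra that acts faithfully on the kernel of [z].

    Let [f] be a unital completely positive map that agrees with [p] on the
    image of [A].  The map [phi] on [E] replaces the B(L)-component of [x] by
    [f x] and keeps the other component; it is unital and positive, and it fixes
    the image of [A].  There are two cases ([ucp_dichotomy]).

    If the decreasing sequence [phi^k z] tends to [0] in norm, then for every
    matrix [a] over the image of [A] the Kadison-Schwarz inequality gives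
    [a^* a <= |a|^2 phi^k(z) + c^2], where [c] is the norm of [a] on the
    kernel of [z].  So restriction to this kernel is completely isometric on
    [A] ([peak_norm_bound]).  The universal property of the envelope then
    provides a left inverse of the restriction, although the restriction kills
    [z]: a contradiction.

    Otherwise, limits along an ultrafilter of Cesaro means of vector states give
    a [phi]-invariant state [psi] with [psi z > 0] ([inv_state_exists]).
    Invariance forces equality in the Kadison-Schwarz inequality under [psi], so
    that [phi] is multiplicative at the elements of [A] modulo the left kernel
    of [psi] ([fixed_good]).  The elements with this property form a C*-algebra
    ([good_algebra_cstar]), hence all of [E].  Then the products
    [(phi x - x) w] lie in the left kernel; as the summand B(L) is simple and
    charged by [psi], they vanish, and [f = p] ([inv_state_rigid]).

    The analytic tool throughout is [separating_psd]: a self-adjoint matrix over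
    a C*-algebra is positive as soon as its images under a separating family of
    representations are. *)

Set Implicit Arguments.
Unset Strict Implicit.
Unset Printing Implicit Defensive.

Import Order.TTheory GRing.Theory Num.Theory.
Import numFieldNormedType.Exports.

Local Open Scope classical_set_scope.
Local Open Scope ring_scope.
Local Open Scope complex_scope.

(** * Closed subspaces as Hilbert spaces *)

(** The proof of closedness is a parameter of the type because the linear and
    complete structures attached to it depend on it. *)
Definition subspace_carrier (R : realType) (H : hilbertType R) (M : set H)
  of closed_subspace M := {x : H | x \in M}.

Section SubHilbert.
Context (R : realType) (H : hilbertType R) (M : set H) (hM : closed_subspace M).
Local Notation S := (subspace_carrier hM).

HB.instance Definition _ := SubChoice.copy S {x : H | x \in M}.

Lemma subspace_submod_closed : submod_closed (mem M : {pred H}).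
Proof.
case: hM => M0 MD _; split; first exact/mem_set.
by move=> a x y /set_mem Mx /set_mem My; exact/mem_set/MD.
Qed.

HB.instance Definition _ :=
  GRing.isSubmodClosed.Build R[i] H (mem M : {pred H}) subspace_submod_closed.

HB.instance Definition _ := [SubChoice_isSubLmodule of S by <:].

Definition sub_norm (x : S) : R[i] := `|val x|.

Lemma sub_normD x y : sub_norm (x + y) <= sub_norm x + sub_norm y.
Proof. exact: ler_normD. Qed.

Lemma sub_normZ (l : R[i]) x : sub_norm (l *: x) = `|l| * sub_norm x.
Proof. exact: normrZ. Qed.

Lemma sub_norm0_eq0 x : sub_norm x = 0 -> x = 0.
Proof. by move/normr0_eq0 => x0; apply/val_inj. Qed.

HB.instance Definition _ :=
  Lmodule_isNormed.Build R[i] S sub_normD sub_normZ sub_norm0_eq0.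

Lemma sub_complete (F : set_system S) : ProperFilter F -> cauchy F -> cvg F.
Proof.
move=> FF /cauchy_ballP Fc.
have /cauchy_cvg/cvg_ex[l Fl] : cauchy ((val : S -> H) @ F).
  apply/cauchy_ballP => e e0; have := Fc e e0.
  case=> -[A B] /= [FA FB] AB.
  exists (val @` A, val @` B); first by split => /=; rewrite /nbhs/=;
    [apply: filterS FA|apply: filterS FB] => x Ax; exists x.
  move=> [_ _] /= [[x Ax <-] [y By <-]]; have := AB (x, y) (conj Ax By).
  by rewrite -!ball_normE.
have Ml : M l.
  case: hM => _ _ clM; apply: (closed_cvg M clM _ _ Fl).
  by apply: filterE => x; apply: set_mem; exact: valP.
apply/cvg_ex; exists (exist _ l (mem_set Ml) : S).
apply/cvgrPdist_lt => e e0; move/cvgrPdist_lt : Fl => /(_ e e0).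
by rewrite !near_simpl.
Qed.

HB.instance Definition _ := Uniform_isComplete.Build S sub_complete.

Definition sub_inner (x y : S) : R[i] := inner (val x) (val y).

Lemma sub_inner_linear (a : R[i]) (x y z : S) :
  sub_inner (a *: x + y) z = a * sub_inner x z + sub_inner y z.
Proof. exact: inner_linear. Qed.

Lemma sub_inner_conj (x y : S) : sub_inner y x = (sub_inner x y)^*.
Proof. exact: inner_conj. Qed.

Lemma sub_inner_norm (x : S) : `|x| ^+ 2 = sub_inner x x.
Proof. exact: inner_norm. Qed.

HB.instance Definition _ :=
  isHilbert.Build R S sub_inner_linear sub_inner_conj sub_inner_norm.

Definition subspace_hilbert : hilbertType R := S.

End SubHilbert.

(** The interface to the subtype: a Hilbert space with an isometry onto the
    subspace. *)
Lemma closed_subspace_hilbert (R : realType) (H : hilbertType R) (M : set H) :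
  closed_subspace M ->
  exists (S : hilbertType R) (v : S -> H), [/\ linear v,
    forall x y, inner (v x) (v y) = inner x y & range v = M].
Proof.
move=> hM; exists (subspace_hilbert hM), (fun x => val x); split=> //.
apply/seteqP; split=> [_ [x _ <-]|x Mx]; first exact: set_mem (valP x).
by exists (exist _ x (mem_set Mx)).
Qed.
(** * The real inner product *)

Lemma quadratic_ge0_discr (R : realFieldType) (a b c : R) : 0 <= c ->
  (forall t : R, 0 <= a + 2 * t * b + t ^+ 2 * c) -> b ^+ 2 <= a * c.
Proof.
rewrite le_eqVlt => /orP[/eqP <-|c0] q.
  have [->|b0] := eqVneq b 0; first by rewrite expr0n mulr0.
  have := q (- (a + 1) / (2 * b)).
  have -> : 2 * (- (a + 1) / (2 * b)) * b = - a - 1 by field.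
  by rewrite mulr0 addr0 mulr0 addrA subrr sub0r oppr_ge0 ler10.
have := q (- b / c).
have -> : a + 2 * (- b / c) * b + (- b / c) ^+ 2 * c = (a * c - b ^+ 2) / c.
  by field; rewrite gt_eqF.
by rewrite pmulr_lge0 ?invr_gt0// subr_ge0.
Qed.

(** Positivity, adjoints and bounds of operators only involve the real part of the
    inner product, and it takes values in a totally ordered field. *)
Definition rip (R : realType) (H : hilbertType R) (x y : H) : R :=
  complex.Re (inner x y).

Section RealInner.
Context (R : realType) (H : hilbertType R).
Implicit Types (x y z : H) (r : R) (T S : H -> H).

Lemma inner_sym x y : inner y x = (inner x y)^*.
Proof. exact: inner_conj. Qed.

Lemma innerDl x y z : inner (x + y) z = inner x z + inner y z.
Proof. by rewrite -[x]scale1r inner_linear scale1r mul1r. Qed.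

Lemma inner0l z : inner 0 z = 0.
Proof. by apply: (addrI (inner (0 : H) z)); rewrite -innerDl !addr0. Qed.

Lemma innerZl (a : R[i]) x z : inner (a *: x) z = a * inner x z.
Proof. by rewrite -[a *: x]addr0 inner_linear inner0l addr0. Qed.

Lemma innerZr (a : R[i]) x z : inner x (a *: z) = a^* * inner x z.
Proof. by rewrite inner_sym innerZl rmorphM /= -inner_sym. Qed.

Lemma innerDr x y z : inner x (y + z) = inner x y + inner x z.
Proof. by rewrite inner_sym innerDl rmorphD /= -!inner_sym. Qed.

Lemma rip_sym x y : rip y x = rip x y.
Proof. by rewrite /rip inner_sym; case: (inner x y). Qed.

Lemma ripDl x y z : rip (x + y) z = rip x z + rip y z.
Proof. by rewrite /rip innerDl; case: inner => ? ?; case: inner. Qed.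

Lemma ripZl r x z : rip (r%:C *: x) z = r * rip x z.
Proof. by rewrite /rip innerZl; case: inner => ? ? /=; rewrite mul0r subr0. Qed.

Lemma ripDr x y z : rip x (y + z) = rip x y + rip x z.
Proof. by rewrite rip_sym ripDl !(rip_sym x). Qed.

Lemma ripZr r x z : rip x (r%:C *: z) = r * rip x z.
Proof. by rewrite rip_sym ripZl rip_sym. Qed.

Lemma rip0l x : rip 0 x = 0. Proof. by rewrite /rip inner0l. Qed.
Lemma rip0r x : rip x 0 = 0. Proof. by rewrite rip_sym rip0l. Qed.

Lemma ripNl x z : rip (- x) z = - rip x z.
Proof. by apply/eqP; rewrite -addr_eq0 -ripDl addNr rip0l. Qed.

Lemma ripNr x z : rip x (- z) = - rip x z.
Proof. by rewrite rip_sym ripNl rip_sym. Qed.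

Lemma ripBl x y z : rip (x - y) z = rip x z - rip y z.
Proof. by rewrite ripDl ripNl. Qed.

Lemma ripBr x y z : rip x (y - z) = rip x y - rip x z.
Proof. by rewrite ripDr ripNr. Qed.

(** The real part determines the inner product. *)
Lemma Im_inner x y : complex.Im (inner x y) = rip x ('i *: y).
Proof.
by rewrite /rip innerZr; case: inner => a b /=; rewrite mul0r sub0r mulN1r opprK.
Qed.

Lemma hnormE x : `|x| = (hnorm x)%:C.
Proof. by rewrite /hnorm RRe_real // realE normr_ge0. Qed.

Lemma inner_selfE x : inner x x = (rip x x)%:C.
Proof.
rewrite /rip -inner_norm hnormE -rmorphXn /=.
by rewrite -[(_ ^+ 2)%:C]/((_ ^+ 2)%:C) /=.
Qed.

Lemma hnorm_sq x : hnorm x ^+ 2 = rip x x.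
Proof.
have := inner_norm x; rewrite hnormE inner_selfE -rmorphXn /=.
exact: complexI.
Qed.

Lemma hnorm_ge0 x : 0 <= hnorm x.
Proof. by rewrite -lecR -hnormE normr_ge0. Qed.

Lemma rip_ge0 x : 0 <= rip x x.
Proof. by rewrite -hnorm_sq sqr_ge0. Qed.

Lemma hnorm_eq0 x : hnorm x = 0 -> x = 0.
Proof. by move=> x0; apply/normr0_eq0; rewrite hnormE x0. Qed.

Lemma rip_eq0 x : rip x x = 0 -> x = 0.
Proof. by rewrite -hnorm_sq => /eqP; rewrite sqrf_eq0 => /eqP/hnorm_eq0. Qed.

Lemma rip_inj x y : (forall z, rip x z = rip y z) -> x = y.
Proof.
by move=> h; apply/eqP; rewrite -subr_eq0; apply/eqP/rip_eq0; rewrite ripBl h subrr.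
Qed.

Lemma hnormZ r x : hnorm (r%:C *: x) = `|r| * hnorm x.
Proof.
apply/eqP; rewrite -(@eqrXn2 _ 2) // ?mulr_ge0 ?hnorm_ge0 //; apply/eqP.
by rewrite exprMn !hnorm_sq ripZl ripZr mulrA -expr2 real_normK ?num_real.
Qed.

Lemma hnormD x y : hnorm (x + y) <= hnorm x + hnorm y.
Proof. by rewrite -lecR rmorphD /= -!hnormE; exact: ler_normD. Qed.

Lemma hnorm0 : hnorm (0 : H) = 0.
Proof. by rewrite /hnorm normr0. Qed.

Lemma hnormN x : hnorm (- x) = hnorm x.
Proof. by rewrite /hnorm normrN. Qed.

Lemma adjoint_rip T S x y : adjoint_of T S -> rip (T x) y = rip x (S y).
Proof. by rewrite /rip => ->. Qed.

Lemma adjoint_sym T S : adjoint_of T S -> adjoint_of S T.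
Proof. by move=> h x y; rewrite inner_sym -h -inner_sym. Qed.

Lemma adjoint_uniq T S S' : adjoint_of T S -> adjoint_of T S' -> S = S'.
Proof.
move=> h h'; apply/funext => y; apply: rip_inj => z.
by rewrite rip_sym -(adjoint_rip _ _ h) (adjoint_rip _ _ h') rip_sym.
Qed.

End RealInner.
(** * Column vectors and matrices of operators *)

Section LinearFun.
Context (K : pzRingType) (U V : lmodType K) (T : U -> V) (lT : linear T).

Lemma lin0 : T 0 = 0.
Proof. by apply: (addrI (T 0)); rewrite -[X in X + _]scale1r -lT scale1r !addr0. Qed.

Lemma linD x y : T (x + y) = T x + T y.
Proof. by have := lT 1 x y; rewrite !scale1r. Qed.

Lemma linZ a x : T (a *: x) = a *: T x.
Proof. by have := lT a x 0; rewrite lin0 !addr0. Qed.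

Lemma linN x : T (- x) = - T x.
Proof. by rewrite -scaleN1r linZ scaleN1r. Qed.

Lemma linB x y : T (x - y) = T x - T y.
Proof. by rewrite linD linN. Qed.

Lemma lin_sum (I : Type) (r : seq I) (P : pred I) (F : I -> U) :
  T (\sum_(i <- r | P i) F i) = \sum_(i <- r | P i) T (F i).
Proof. by elim/big_rec2 : _ => [|i y1 y2 _ <-]; rewrite ?lin0 // linD. Qed.

End LinearFun.

Lemma sum_le_const (R : numDomainType) n (F : 'I_n -> R) c :
  (forall i, F i <= c) -> \sum_i F i <= n%:R * c.
Proof.
move=> Fc; apply: (@le_trans _ _ (\sum_(i < n) c)); first exact: ler_sum.
by rewrite sumr_const card_ord mulr_natl.
Qed.

Section L2.
Context (R : realType) (H : hilbertType R).
Implicit Types (r : R) (n : nat).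

Definition vip n (g h : 'I_n -> H) : R := \sum_i rip (g i) (h i).

Lemma vip_sym n (g h : 'I_n -> H) : vip h g = vip g h.
Proof. by apply: eq_bigr => i _; exact: rip_sym. Qed.

Lemma vipDl n (g g' h : 'I_n -> H) : vip (g + g') h = vip g h + vip g' h.
Proof. by rewrite /vip -big_split /=; apply: eq_bigr => i _; exact: ripDl. Qed.

Lemma vipZl n r (g h : 'I_n -> H) : vip (r%:C *: g) h = r * vip g h.
Proof. by rewrite /vip mulr_sumr; apply: eq_bigr => i _; exact: ripZl. Qed.

Lemma vipNl n (g h : 'I_n -> H) : vip (- g) h = - vip g h.
Proof. by rewrite /vip -sumrN; apply: eq_bigr => i _; exact: ripNl. Qed.

Lemma vipBl n (g g' h : 'I_n -> H) : vip (g - g') h = vip g h - vip g' h.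
Proof. by rewrite vipDl vipNl. Qed.

Lemma vipDr n (g h h' : 'I_n -> H) : vip g (h + h') = vip g h + vip g h'.
Proof. by rewrite vip_sym vipDl !(vip_sym g). Qed.

Lemma vipZr n r (g h : 'I_n -> H) : vip g (r%:C *: h) = r * vip g h.
Proof. by rewrite vip_sym vipZl vip_sym. Qed.

Lemma vipBr n (g h h' : 'I_n -> H) : vip g (h - h') = vip g h - vip g h'.
Proof. by rewrite vip_sym vipBl !(vip_sym g). Qed.

Lemma vip_ge0 n (h : 'I_n -> H) : 0 <= vip h h.
Proof. by apply: sumr_ge0 => i _; exact: rip_ge0. Qed.

Lemma vip_eq0 n (h : 'I_n -> H) : vip h h = 0 -> h = 0.
Proof.
rewrite /vip => /eqP; rewrite psumr_eq0 => [|i _]; last exact: rip_ge0.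
by move/allP => h0; apply/funext => i; apply/rip_eq0/eqP/h0; rewrite mem_index_enum.
Qed.

Lemma vip_inj n (g h : 'I_n -> H) : (forall k, vip g k = vip h k) -> g = h.
Proof.
by move=> e; apply/eqP; rewrite -subr_eq0; apply/eqP/vip_eq0; rewrite vipBl e subrr.
Qed.

Lemma l2norm_sq n (h : 'I_n -> H) : l2norm h ^+ 2 = vip h h.
Proof.
rewrite /l2norm sqr_sqrtr; last by apply: sumr_ge0 => i _; exact: sqr_ge0.
by apply: eq_bigr => i _; exact: hnorm_sq.
Qed.

Lemma l2norm_ge0 n (h : 'I_n -> H) : 0 <= l2norm h.
Proof. exact: sqrtr_ge0. Qed.

Lemma l2norm_le n (h g : 'I_n -> H) (c : R) : 0 <= c ->
  (l2norm h <= c * l2norm g) = (vip h h <= c ^+ 2 * vip g g).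
Proof.
by move=> c0; rewrite -!l2norm_sq -exprMn ler_pXn2r // nnegrE ?mulr_ge0 // l2norm_ge0.
Qed.

Lemma vip_CS n (g h : 'I_n -> H) : vip g h ^+ 2 <= vip g g * vip h h.
Proof.
apply: quadratic_ge0_discr => [|t]; first exact: vip_ge0.
have := vip_ge0 (g + t%:C *: h); rewrite vipDl !vipDr !vipZl !vipZr (vip_sym h g).
by congr (_ <= _); ring.
Qed.

Lemma vip_norm_le n (g h : 'I_n -> H) : `|vip g h| <= l2norm g * l2norm h.
Proof.
rewrite -(@ler_pXn2r _ 2) // ?nnegrE ?mulr_ge0 ?l2norm_ge0 //.
by rewrite real_normK ?num_real // exprMn !l2norm_sq vip_CS.
Qed.

Lemma vip_le n (g h : 'I_n -> H) : vip g h <= l2norm g * l2norm h.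
Proof. exact: le_trans (ler_norm _) (vip_norm_le g h). Qed.

Lemma l2normD n (g h : 'I_n -> H) : l2norm (g + h) <= l2norm g + l2norm h.
Proof.
rewrite -(@ler_pXn2r _ 2) // ?nnegrE ?addr_ge0 ?l2norm_ge0 //.
rewrite sqrrD !l2norm_sq vipDl !vipDr (vip_sym g h).
have := vip_le g h; rewrite -mulr_natr; lra.
Qed.

Lemma l2normZ n r (h : 'I_n -> H) : l2norm (r%:C *: h) = `|r| * l2norm h.
Proof.
apply/eqP; rewrite -(@eqrXn2 _ 2) // ?mulr_ge0 ?l2norm_ge0 //.
by rewrite exprMn !l2norm_sq vipZl vipZr mulrA -expr2 real_normK ?num_real.
Qed.

Lemma l2normN n (h : 'I_n -> H) : l2norm (- h) = l2norm h.
Proof. by rewrite /l2norm; congr Num.sqrt; apply: eq_bigr => i _; rewrite hnormN. Qed.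

Lemma l2norm0 n : l2norm (0 : 'I_n -> H) = 0.
Proof. by rewrite /l2norm big1 ?sqrtr0 // => i _; rewrite hnorm0 expr0n. Qed.

Lemma l2norm_eq0 n (h : 'I_n -> H) : l2norm h = 0 -> h = 0.
Proof. by move=> h0; apply: vip_eq0; rewrite -l2norm_sq h0 expr0n. Qed.

Lemma hnorm_le_l2 n (h : 'I_n -> H) i : hnorm (h i) <= l2norm h.
Proof.
rewrite -(@ler_pXn2r _ 2) // ?nnegrE ?hnorm_ge0 ?l2norm_ge0 // l2norm_sq hnorm_sq.
by rewrite /vip (bigD1 i) //= lerDl sumr_ge0 // => j _; exact: rip_ge0.
Qed.

Lemma l2norm_le_sum n (h : 'I_n -> H) : l2norm h <= \sum_i hnorm (h i).
Proof.
have s0 : 0 <= \sum_i hnorm (h i) by apply: sumr_ge0 => i _; exact: hnorm_ge0.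
rewrite -(@ler_pXn2r _ 2) // ?nnegrE ?l2norm_ge0 // l2norm_sq /vip expr2 mulr_suml.
apply: ler_sum => i _; rewrite -hnorm_sq expr2 ler_wpM2l ?hnorm_ge0 //.
by rewrite (bigD1 i) //= lerDl sumr_ge0 // => j _; exact: hnorm_ge0.
Qed.

Lemma l2norm_const (x : H) : l2norm (fun _ : 'I_1 => x) = hnorm x.
Proof. by rewrite /l2norm big_ord1 sqrtr_sqr ger0_norm // hnorm_ge0. Qed.

Lemma rip_norm_le (x y : H) : `|rip x y| <= hnorm x * hnorm y.
Proof.
have := vip_norm_le (fun _ : 'I_1 => x) (fun=> y).
by rewrite /vip big_ord1 !l2norm_const.
Qed.

Lemma sup_image_ge0 (X : Type) (D : set X) (F : X -> R) :
  (forall x, 0 <= F x) -> 0 <= sup (F @` D).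
Proof.
move=> F0; have [sA|/sup_out ->//] := pselect (has_sup (F @` D)).
have [[y [x Dx xy]] ub] := sA.
by apply: (le_trans (F0 x)); apply: ub_le_sup => //; exists x.
Qed.

Definition deltav n (i : 'I_n) (x : H) : 'I_n -> H := fun j => if j == i then x else 0.

Lemma l2norm_delta n (i : 'I_n) (x : H) : l2norm (deltav i x) = hnorm x.
Proof.
apply/eqP; rewrite -(@eqrXn2 _ 2) ?l2norm_ge0 ?hnorm_ge0 // l2norm_sq hnorm_sq.
rewrite /vip (bigD1 i) //= /deltav eqxx big1 ?addr0 // => j /negPf ->.
by rewrite rip0l.
Qed.

(** [mx_opnorm T <= c] without reference to a supremum, which is [0] for an
    unbounded set. *)
Definition bnd n (c : R) (T : 'M[H -> H]_n) :=
  forall h, l2norm (mx_apply T h) <= c * l2norm h.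

Definition lin_mx n (T : 'M[H -> H]_n) := forall i j, linear (T i j).

Definition mxc n (S T : 'M[H -> H]_n) : 'M[H -> H]_n :=
  \matrix_(i, j) \sum_k (S i k \o T k j).

Definition mx1 n : 'M[H -> H]_n := \matrix_(i, j) if i == j then idfun else 0.

Lemma mx_applyD n (S T : 'M[H -> H]_n) h :
  mx_apply (S + T) h = mx_apply S h + mx_apply T h.
Proof.
by apply/funext => i; rewrite /mx_apply -[RHS]big_split /=; apply: eq_bigr => j _; rewrite mxE.
Qed.

(** The entries form a module, not a ring. *)
Definition mxZ n (a : R[i]) (T : 'M[H -> H]_n) : 'M[H -> H]_n :=
  map_mx (fun f => a *: f) T.

Lemma mx_applyZ n a (T : 'M[H -> H]_n) h :
  mx_apply (mxZ a T) h = a *: mx_apply T h.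
Proof.
apply/funext => i; rewrite /mx_apply -[RHS]/(a *: \sum_j _) scaler_sumr.
by apply: eq_bigr => j _; rewrite mxE.
Qed.

Lemma mx_applyN n (T : 'M[H -> H]_n) h : mx_apply (- T) h = - mx_apply T h.
Proof. by apply/funext => i; rewrite /mx_apply -[RHS]sumrN; apply: eq_bigr => j _; rewrite mxE. Qed.

Lemma mx_applyB n (S T : 'M[H -> H]_n) h :
  mx_apply (S - T) h = mx_apply S h - mx_apply T h.
Proof. by rewrite mx_applyD mx_applyN. Qed.

Lemma mx_apply0 n h : mx_apply (0 : 'M[H -> H]_n) h = 0.
Proof. by apply/funext => i; rewrite /mx_apply big1 // => j _; rewrite mxE. Qed.

Lemma mx_apply1 n h : mx_apply (mx1 n) h = h.
Proof.
apply/funext => i; rewrite /mx_apply (bigD1 i) //= mxE eqxx big1 ?addr0 // => j ji.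
by rewrite mxE eq_sym (negPf ji).
Qed.

Lemma sum_funE (I : Type) (r : seq I) (P : pred I) (F : I -> H -> H) x :
  (\sum_(i <- r | P i) F i) x = \sum_(i <- r | P i) F i x.
Proof. by elim/big_rec2 : _ => // i y z _ <-. Qed.

Lemma mx_apply_mxc n (S T : 'M[H -> H]_n) h : lin_mx S ->
  mx_apply (mxc S T) h = mx_apply S (mx_apply T h).
Proof.
move=> lS; apply/funext => i; rewrite /mx_apply.
under eq_bigr do rewrite mxE sum_funE.
by rewrite exchange_big; apply: eq_bigr => k _ /=; rewrite (lin_sum (lS i k)).
Qed.

Lemma mx_apply_lin n (T : 'M[H -> H]_n) : lin_mx T -> linear (mx_apply T).
Proof.
move=> lT a g h; apply/funext => i; rewrite /mx_apply.
rewrite -[RHS]/(a *: (\sum_j _) + \sum_j _) scaler_sumr -big_split /=.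
by apply: eq_bigr => j _; exact: lT.
Qed.

Lemma mx_apply_delta n (T : 'M[H -> H]_n) i j x : lin_mx T ->
  mx_apply T (deltav j x) i = T i j x.
Proof.
move=> lT; rewrite /mx_apply (bigD1 j) //= /deltav eqxx big1 ?addr0 // => k /negPf ->.
exact: lin0 (lT i k).
Qed.

Lemma mx_apply_inj n (S T : 'M[H -> H]_n) : lin_mx S -> lin_mx T ->
  (forall h, mx_apply S h = mx_apply T h) -> S = T.
Proof.
move=> lS lT e; apply/matrixP => i j; apply/funext => x.
by rewrite -(mx_apply_delta _ _ _ lS) e mx_apply_delta.
Qed.

Lemma bnd_ge n c c' (T : 'M[H -> H]_n) : c <= c' -> bnd c T -> bnd c' T.
Proof. by move=> cc b h; rewrite (le_trans (b h)) // ler_wpM2r // l2norm_ge0. Qed.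

Lemma bndD n c d (S T : 'M[H -> H]_n) : bnd c S -> bnd d T -> bnd (c + d) (S + T).
Proof.
by move=> bS bT h; rewrite mx_applyD mulrDl (le_trans (l2normD _ _)) // lerD.
Qed.

Lemma bndN n c (T : 'M[H -> H]_n) : bnd c T -> bnd c (- T).
Proof. by move=> b h; rewrite mx_applyN l2normN. Qed.

Lemma bnd_entry n c (T : 'M[H -> H]_n) i j x : lin_mx T -> bnd c T ->
  hnorm (T i j x) <= c * hnorm x.
Proof.
move=> lT b; rewrite -(mx_apply_delta i j x lT) (le_trans (hnorm_le_l2 _ _)) //.
by rewrite (le_trans (b _)) // l2norm_delta.
Qed.

Lemma bnd_entries n (c : R) (T : 'M[H -> H]_n) : 0 <= c ->
  (forall i j x, hnorm (T i j x) <= c * hnorm x) -> bnd (n%:R * n%:R * c) T.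
Proof.
move=> c0 b h; rewrite (le_trans (l2norm_le_sum _)) //.
have e i : hnorm (mx_apply T h i) <= n%:R * c * l2norm h.
  rewrite /mx_apply; apply: (@le_trans _ _ (\sum_(j < n) hnorm (T i j (h j)))).
    elim/big_rec2 : _ => [|j y z _ le]; first by rewrite hnorm0.
    by rewrite (le_trans (hnormD _ _)) // lerD2l.
  rewrite -mulrA; apply: sum_le_const => j.
  by rewrite (le_trans (b _ _ _)) // ler_wpM2l // hnorm_le_l2.
by rewrite -!mulrA; apply: sum_le_const => i; rewrite mulrA.
Qed.

Lemma mx_opnorm_le n c (T : 'M[H -> H]_n) : bnd c T -> 0 <= c -> mx_opnorm T <= c.
Proof.
move=> b c0; apply: ge_sup.
  by exists (l2norm (mx_apply T 0)); exists 0 => //=; rewrite l2norm0.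
move=> _ [h /= h1 <-]; rewrite (le_trans (b h)) //.
by rewrite -[leRHS]mulr1 ler_wpM2l.
Qed.

Lemma bnd_mx_opnorm n c (T : 'M[H -> H]_n) : lin_mx T -> bnd c T ->
  bnd (mx_opnorm T) T.
Proof.
move=> lT b h; have [h0|h0] := eqVneq (l2norm h) 0.
  by rewrite (l2norm_eq0 h0) (lin0 (mx_apply_lin lT)) l2norm0 mulr0.
have {}h0 : 0 < l2norm h by rewrite lt_neqAle eq_sym h0 l2norm_ge0.
set g := ((l2norm h)^-1)%:C *: h.
have g1 : l2norm g = 1.
  by rewrite l2normZ ger0_norm ?invr_ge0 ?(ltW h0) // mulVf // gt_eqF.
have : l2norm (mx_apply T g) <= mx_opnorm T.
  apply: ub_le_sup; last by exists g => //=; rewrite g1.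
  exists `|c| => _ [k /= k1 <-]; rewrite (le_trans (b k)) //.
  rewrite (@le_trans _ _ (`|c| * l2norm k)) ?ler_wpM2r ?l2norm_ge0 ?ler_norm //.
  by rewrite -[leRHS]mulr1 ler_wpM2l.
rewrite (linZ (mx_apply_lin lT)) l2normZ ger0_norm ?invr_ge0 ?(ltW h0) //.
by rewrite mulrC ler_pdivrMr.
Qed.

Lemma mx_opnorm_ge0 n (T : 'M[H -> H]_n) : 0 <= mx_opnorm T.
Proof. by apply: sup_image_ge0 => h; exact: l2norm_ge0. Qed.

Lemma opnorm_ge0 (T : H -> H) : 0 <= opnorm T.
Proof. by apply: sup_image_ge0 => h; exact: hnorm_ge0. Qed.

Lemma opnorm_bound (T : H -> H) : bounded_op T ->
  forall x, hnorm (T x) <= opnorm T * hnorm x.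
Proof.
move=> [lT [M b]] x; have [x0|x0] := eqVneq (hnorm x) 0.
  by rewrite (hnorm_eq0 x0) (lin0 lT) hnorm0 mulr0.
have {}x0 : 0 < hnorm x by rewrite lt_neqAle eq_sym x0 hnorm_ge0.
set g := ((hnorm x)^-1)%:C *: x.
have g1 : hnorm g = 1.
  by rewrite hnormZ ger0_norm ?invr_ge0 ?(ltW x0) // mulVf // gt_eqF.
have : hnorm (T g) <= opnorm T.
  apply: ub_le_sup; last by exists g => //=; rewrite g1.
  exists `|M| => _ [k /= k1 <-]; rewrite (le_trans (b k)) //.
  rewrite (@le_trans _ _ (`|M| * hnorm k)) ?ler_wpM2r ?hnorm_ge0 ?ler_norm //.
  by rewrite -[leRHS]mulr1 ler_wpM2l.
rewrite (linZ lT) hnormZ ger0_norm ?invr_ge0 ?(ltW x0) //.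
by rewrite mulrC ler_pdivrMr.
Qed.

Lemma opnorm_le (T : H -> H) c : 0 <= c ->
  (forall x, hnorm (T x) <= c * hnorm x) -> opnorm T <= c.
Proof.
move=> c0 b; apply: ge_sup; first by exists (hnorm (T 0)); exists 0 => //=; rewrite hnorm0.
move=> _ [x /= x1 <-]; rewrite (le_trans (b x)) //.
by rewrite -[leRHS]mulr1 ler_wpM2l.
Qed.

End L2.
(** * C*-algebras of operators and matrices over them *)

Section Completeness.
Context (R : realType) (H : hilbertType R).

Lemma hilbert_complete (u : nat -> H) :
  (forall e : R, 0 < e -> exists N, forall m n, (N <= m)%N -> (N <= n)%N ->
     hnorm (u m - u n) <= e) ->
  exists l, forall e : R, 0 < e -> exists N, forall n, (N <= n)%N ->
     hnorm (u n - l) <= e.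
Proof.
move=> uc.
have /cauchy_cvg/cvg_ex[l ul] : cauchy (u @ \oo).
  apply/cauchy_ballP => e e0.
  have eE : e = (complex.Re e)%:C by rewrite RRe_real // gtr0_real.
  have re0 : 0 < complex.Re e / 2 by rewrite divr_gt0 // -ltcR -eE.
  have [N uN] := uc _ re0.
  exists ([set u n | n in [set n | (N <= n)%N]], [set u n | n in [set n | (N <= n)%N]]).
    by split; exists N => // n Nn; exists n.
  move=> [_ _] /= [[m Nm <-] [n Nn <-]]; rewrite -ball_normE /= eE hnormE ltcR.
  by rewrite (le_lt_trans (uN _ _ Nm Nn)) //; move: re0; lra.
exists l => e e0; move/cvgrPdist_lt : ul => /(_ e%:C); rewrite ltcR e0 => /(_ isT).
case=> N _ uN; exists N => n /uN /=; rewrite hnormE ltcR => /ltW.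
by rewrite -hnormN opprB.
Qed.

Lemma hnorm_lim_le (u : nat -> H) l v (c : R) N :
  (forall e : R, 0 < e -> exists N, forall n, (N <= n)%N -> hnorm (u n - l) <= e) ->
  (forall n, (N <= n)%N -> hnorm (u n - v) <= c) -> hnorm (l - v) <= c.
Proof.
move=> ul uc; apply/ler_addgt0Pr => e /ul[M uM].
have -> : l - v = - (u (maxn M N) - l) + (u (maxn M N) - v).
  by rewrite opprB addrA subrK.
rewrite (le_trans (hnormD _ _)) // addrC lerD ?uc ?leq_maxr // hnormN.
by rewrite uM ?leq_maxl.
Qed.

Lemma hnorm_small (x : H) : (forall e : R, 0 < e -> hnorm x <= e) -> x = 0.
Proof.
move=> xe; apply: hnorm_eq0; apply/eqP; rewrite eq_le hnorm_ge0 andbT.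
by apply/ler_addgt0Pr => e e0; rewrite add0r xe.
Qed.

End Completeness.

Lemma conj_real (R : realType) (r : R) : Num.conj (r%:C : R[i]) = r%:C.
Proof. exact: conjc_real. Qed.

Lemma re_norm_ge0 (R : realType) (a : R[i]) : 0 <= complex.Re `|a|.
Proof. by rewrite -lecR RRe_real ?normr_ge0 // realE normr_ge0. Qed.

Lemma hnormZC (R : realType) (H : hilbertType R) (a : R[i]) (x : H) :
  hnorm (a *: x) = complex.Re `|a| * hnorm x.
Proof.
have aE : (complex.Re `|a|)%:C = `|a| by rewrite RRe_real // realE normr_ge0.
apply: complexI; rewrite -(hnormE (a *: x)) normrZ (hnormE x).
by rewrite -[in LHS]aE -rmorphM.
Qed.

Section Star.
Context (R : realType) (H : hilbertType R).
Implicit Types (S T : H -> H).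

(** The adjoint of [T], or [0] if [T] has none; adjoints are unique. *)
Definition star T : H -> H := xget T [set S | adjoint_of T S].

Lemma starE T S : adjoint_of T S -> star T = S.
Proof.
move=> h; rewrite /star; case: xgetP => [S' _ /= h'|/(_ S) //].
exact: adjoint_uniq h' h.
Qed.

End Star.

Section CstarAlgebra.
Context (R : realType) (H : hilbertType R) (E : set (H -> H)).
Hypothesis hE : unital_cstar_algebra E.
Implicit Types (S T : H -> H).

Lemma cstar_bounded T : E T -> bounded_op T.
Proof. by case: hE => -[h _ _ _] _ _; exact: h. Qed.

Lemma cstar_linear T : E T -> linear T.
Proof. by move=> /cstar_bounded[]. Qed.

Lemma cstar1 : E idfun.
Proof. by case: hE => -[]. Qed.

Lemma cstar_comb (a : R[i]) S T : E S -> E T -> E (a *: S + T).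
Proof. by case: hE => -[_ _ h _] _ _; exact: h. Qed.

Lemma cstarM S T : E S -> E T -> E (S \o T).
Proof. by case: hE => -[_ _ _ h] _ _; exact: h. Qed.

Lemma cstar0 : E 0.
Proof.
have := cstar_comb (-1) cstar1 cstar1.
by rewrite scaleN1r addNr.
Qed.

Lemma cstarD S T : E S -> E T -> E (S + T).
Proof. by rewrite -{2}[S]scale1r; exact: cstar_comb. Qed.

Lemma cstarZ (a : R[i]) T : E T -> E (a *: T).
Proof. by move=> ET; rewrite -[_ *: _]addr0; exact: cstar_comb cstar0. Qed.

Lemma cstarN T : E T -> E (- T).
Proof. by rewrite -scaleN1r; exact: cstarZ. Qed.

Lemma cstarB S T : E S -> E T -> E (S - T).
Proof. by move=> ES /cstarN; exact: cstarD. Qed.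

Lemma cstar_sum (I : Type) (r : seq I) (P : pred I) (F : I -> H -> H) :
  (forall i, P i -> E (F i)) -> E (\sum_(i <- r | P i) F i).
Proof. by move=> EF; elim/big_ind : _ => //; [exact: cstar0|exact: cstarD]. Qed.

Lemma starP T : E T -> adjoint_of T (star T).
Proof. by case: hE => _ h _ /h[S _ hS]; rewrite (starE hS). Qed.

Lemma cstar_star T : E T -> E (star T).
Proof. by case: hE => _ h _ /h[S ES hS]; rewrite (starE hS). Qed.

Lemma rip_star T x y : E T -> rip (T x) y = rip x (star T y).
Proof. by move=> /starP h; exact: adjoint_rip. Qed.

Lemma rip_starr T x y : E T -> rip (star T x) y = rip x (T y).
Proof. by move=> /starP/adjoint_sym h; exact: adjoint_rip. Qed.

Lemma starK T : E T -> star (star T) = T.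
Proof. by move=> /starP/adjoint_sym/starE. Qed.

Lemma star_mul S T : E S -> E T -> star (S \o T) = star T \o star S.
Proof.
by move=> ES ET; apply: starE => x y /=; rewrite (starP ES) (starP ET).
Qed.

Lemma starD S T : E S -> E T -> star (S + T) = star S + star T.
Proof.
move=> ES ET; apply: starE => x y.
by rewrite innerDl innerDr (starP ES) (starP ET).
Qed.

Lemma starZ (r : R) T : E T -> star (r%:C *: T) = r%:C *: star T.
Proof.
move=> ET; apply: starE => x y.
by rewrite innerZl innerZr (starP ET) conj_real.
Qed.

Lemma starN T : E T -> star (- T) = - star T.
Proof. by move=> ET; have := starZ (-1) ET; rewrite rmorphN1 !scaleN1r. Qed.

Lemma starB S T : E S -> E T -> star (S - T) = star S - star T.
Proof. by move=> ES ET; rewrite starD ?starN //; exact: cstarN. Qed.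

Lemma star1 : star (@idfun H) = idfun.
Proof. exact: starE. Qed.

Lemma mx_cstar_lin n (T : 'M[H -> H]_n) : mx_over E T -> lin_mx T.
Proof. by move=> ET i j; exact: cstar_linear. Qed.

Lemma mx_cstar_bnd n (T : 'M[H -> H]_n) : mx_over E T ->
  exists2 c : R, 0 < c & bnd c T.
Proof.
move=> ET; pose M := \sum_i \sum_j opnorm (T i j).
have op0 i j : 0 <= opnorm (T i j) by exact: opnorm_ge0.
have le i j : opnorm (T i j) <= M.
  rewrite /M (bigD1 i) //= (bigD1 j) //= -addrA lerDl addr_ge0 ?sumr_ge0 // => k _.
  exact: sumr_ge0.
have M0 : 0 <= M by rewrite sumr_ge0 // => i _; exact: sumr_ge0.
exists (n%:R * n%:R * M + 1); first by rewrite ltr_wpDl // !mulr_ge0.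
apply: (@bnd_ge _ _ _ (n%:R * n%:R * M)); first by rewrite lerDl.
apply: bnd_entries => // i j x.
rewrite (le_trans (opnorm_bound (cstar_bounded (ET i j)) _)) //.
by rewrite ler_wpM2r ?hnorm_ge0.
Qed.

Lemma mx_cstarD n (S T : 'M[H -> H]_n) : mx_over E S -> mx_over E T -> mx_over E (S + T).
Proof. by move=> ES ET i j; rewrite mxE; exact: cstarD. Qed.

Lemma mx_cstarN n (T : 'M[H -> H]_n) : mx_over E T -> mx_over E (- T).
Proof. by move=> ET i j; rewrite mxE; exact: cstarN. Qed.

Lemma mx_cstarB n (S T : 'M[H -> H]_n) : mx_over E S -> mx_over E T -> mx_over E (S - T).
Proof. by move=> ES /mx_cstarN; exact: mx_cstarD. Qed.

Lemma mx_cstarZ n a (T : 'M[H -> H]_n) : mx_over E T -> mx_over E (mxZ a T).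
Proof. by move=> ET i j; rewrite mxE; exact: cstarZ. Qed.

Lemma mx_cstarM n (S T : 'M[H -> H]_n) : mx_over E S -> mx_over E T -> mx_over E (mxc S T).
Proof. by move=> ES ET i j; rewrite mxE; apply: cstar_sum => k _; exact: cstarM. Qed.

Lemma mx_cstar0 n : mx_over E (0 : 'M[H -> H]_n).
Proof. by move=> i j; rewrite mxE; exact: cstar0. Qed.

Lemma mx_cstar1 n : mx_over E (mx1 H n).
Proof. by move=> i j; rewrite mxE; case: eqP => _; [exact: cstar1|exact: cstar0]. Qed.

Definition mxstar n (T : 'M[H -> H]_n) : 'M[H -> H]_n := \matrix_(i, j) star (T j i).

Lemma mx_cstar_star n (T : 'M[H -> H]_n) : mx_over E T -> mx_over E (mxstar T).
Proof. by move=> ET i j; rewrite mxE; exact: cstar_star. Qed.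

Lemma rip_suml (I : Type) (r : seq I) (P : pred I) (F : I -> H) y :
  rip (\sum_(i <- r | P i) F i) y = \sum_(i <- r | P i) rip (F i) y.
Proof. by elim/big_rec2 : _ => [|i a b _ <-]; rewrite ?rip0l ?ripDl. Qed.

Lemma rip_sumr (I : Type) (r : seq I) (P : pred I) (F : I -> H) y :
  rip y (\sum_(i <- r | P i) F i) = \sum_(i <- r | P i) rip y (F i).
Proof. by rewrite rip_sym rip_suml; apply: eq_bigr => i _; rewrite rip_sym. Qed.

Lemma vip_mxstar n (T : 'M[H -> H]_n) g h : mx_over E T ->
  vip (mx_apply T g) h = vip g (mx_apply (mxstar T) h).
Proof.
move=> ET; rewrite /vip /mx_apply.
under eq_bigr do rewrite rip_suml; under [RHS]eq_bigr do rewrite rip_sumr.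
rewrite exchange_big; apply: eq_bigr => i _; apply: eq_bigr => j _.
by rewrite mxE rip_star.
Qed.

(** Completeness of the matrix algebra.  The entries converge pointwise by
    completeness of [H]; the limits lie in [E] because [E] is norm closed. *)
Lemma mx_cstar_complete n (X : nat -> 'M[H -> H]_n) : (forall k, mx_over E (X k)) ->
  (forall e : R, 0 < e -> exists N, forall k l, (N <= k)%N -> (N <= l)%N ->
     bnd e (X k - X l)) ->
  exists2 Y, mx_over E Y & forall e : R, 0 < e -> exists N, forall k, (N <= k)%N ->
     bnd e (X k - Y).
Proof.
move=> EX Xc.
have Xe i j e : 0 < e -> exists N, forall k l, (N <= k)%N -> (N <= l)%N ->
    forall x, hnorm (X k i j x - X l i j x) <= e * hnorm x.
  move=> /Xc[N XN]; exists N => k l Nk Nl x.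
  have := bnd_entry i j x (mx_cstar_lin (mx_cstarB (EX k) (EX l))) (XN k l Nk Nl).
  by rewrite !mxE.
have lim i j x : exists l, forall e : R, 0 < e ->
    exists N, forall k, (N <= k)%N -> hnorm (X k i j x - l) <= e.
  apply: hilbert_complete => e e0.
  have d0 : 0 < e / (hnorm x + 1) by rewrite divr_gt0 // ltr_wpDl ?hnorm_ge0.
  have [N XN] := Xe i j _ d0; exists N => k l Nk Nl.
  rewrite (le_trans (XN k l Nk Nl x)) // -mulrA ler_piMr ?(ltW e0) //.
  by rewrite mulrC ler_pdivrMr ?mul1r ?lerDl // ltr_wpDl ?hnorm_ge0.
pose Y : 'M[H -> H]_n := \matrix_(i, j) fun x => projT1 (cid (lim i j x)).
have Ylim i j x := projT2 (cid (lim i j x)).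
have YX i j e : 0 < e -> exists N, forall k, (N <= k)%N ->
    forall x, hnorm (X k i j x - Y i j x) <= e * hnorm x.
  move=> e0; have [N XN] := Xe i j e e0; exists N => k Nk x.
  rewrite -hnormN opprB mxE; apply: (hnorm_lim_le (Ylim i j x) (N := N)) => l Nl.
  exact: XN.
have Ylin i j : linear (Y i j).
  move=> a x y; apply/eqP; rewrite -subr_eq0; apply/eqP/hnorm_small => e e0.
  have c0 : 0 < hnorm (a *: x + y) + hnorm (a *: x) + hnorm y + 1.
    by rewrite ltr_wpDl // !addr_ge0 // hnorm_ge0.
  have [N XN] := YX i j _ (divr_gt0 e0 c0).
  have XL := cstar_linear (EX N i j).
  set d := e / _ in XN.
  have d0 : 0 <= d by rewrite ltW // divr_gt0.
  pose D x := X N i j x - Y i j x.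
  have -> : Y i j (a *: x + y) - (a *: Y i j x + Y i j y) =
     - D (a *: x + y) + (a *: D x + D y).
    by rewrite /D XL scalerBr opprB [X in _ = _ + X]addrACA -opprD addrA subrK.
  have nD z : hnorm (D z) <= d * hnorm z by exact: XN.
  rewrite (le_trans (hnormD _ _)) // hnormN.
  have -> : e = d * (hnorm (a *: x + y) + hnorm (a *: x) + hnorm y + 1).
    by rewrite /d mulfVK // gt_eqF.
  have nDa : hnorm (a *: D x) <= d * hnorm (a *: x).
    by rewrite !hnormZC mulrCA ler_wpM2l // re_norm_ge0.
  have := hnormD (a *: D x) (D y); have := nD (a *: x + y); have := nD y.
  rewrite !mulrDr; lra.
have EY : mx_over E Y.
  move=> i j; case: hE => _ _; apply.
    have [N XN] := YX i j 1 ltr01; split => //.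
    exists (opnorm (X N i j) + 1) => x.
    have := XN N (leqnn N) x; have := opnorm_bound (cstar_bounded (EX N i j)) x.
    have : hnorm (Y i j x) <= hnorm (X N i j x) + hnorm (X N i j x - Y i j x).
      by rewrite -(hnormN (_ - _)) opprB -{1}(subrK (X N i j x) (Y i j x)) addrC hnormD.
    by rewrite mulrDl; lra.
  move=> e e0; have [N XN] := YX i j (e / 2) (divr_gt0 e0 (ltr0Sn _ _)).
  exists (X N i j); first exact: EX.
  apply: (@le_lt_trans _ _ (e / 2)); last by move: e0; lra.
  apply: opnorm_le; first by rewrite divr_ge0 // ltW.
  by move=> x; rewrite -hnormN opprB; exact: XN.
exists Y => // e e0.
have d0 : 0 < e / (n%:R * n%:R + 1) by rewrite divr_gt0 // ltr_wpDl // mulr_ge0.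
have [N XN] : exists N : nat, forall i j k, (N <= k)%N ->
    forall x, hnorm (X k i j x - Y i j x) <= e / (n%:R * n%:R + 1) * hnorm x.
  have N_ i j := cid (YX i j _ d0).
  exists (\max_i \max_j projT1 (N_ i j)) => i j k Nk.
  apply: (projT2 (N_ i j)); apply: leq_trans Nk.
  by rewrite (bigD1 i) //= (bigD1 j) //= -maxnA leq_maxl.
exists N => k Nk; apply: (bnd_ge _ (bnd_entries (ltW d0) _)).
  rewrite mulrA ler_pdivrMr ?ltr_wpDl // ?mulr_ge0 //.
  by rewrite mulrC ler_wpM2l ?lerDl // ltW.
by move=> i j x; rewrite !mxE; have := XN i j k Nk x; rewrite mxE.
Qed.

End CstarAlgebra.
(** * Positive square roots *)

Section SquareRoot.
Context (R : realType) (H : hilbertType R).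

Definition sa n (T : 'M[H -> H]_n) :=
  forall g h, vip (mx_apply T g) h = vip g (mx_apply T h).

Definition psd n (T : 'M[H -> H]_n) := forall h, 0 <= vip (mx_apply T h) h.

Definition mx_comm n (S T : 'M[H -> H]_n) :=
  forall h, mx_apply S (mx_apply T h) = mx_apply T (mx_apply S h).

Lemma psd_CS n (T : 'M[H -> H]_n) g h : lin_mx T -> sa T -> psd T ->
  vip (mx_apply T g) h ^+ 2 <= vip (mx_apply T g) g * vip (mx_apply T h) h.
Proof.
move=> lT saT pT; have lin := mx_apply_lin lT.
apply: quadratic_ge0_discr => [|t]; first exact: pT.
have := pT (g + t%:C *: h); rewrite (linD lin) (linZ lin).
rewrite !vipDl !vipDr !vipZl !vipZr.
have -> : vip (mx_apply T h) g = vip (mx_apply T g) h by rewrite saT vip_sym.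
by congr (_ <= _); ring.
Qed.

(** A positive operator below the identity is a contraction, by the
    Cauchy-Schwarz inequality for its quadratic form. *)
Lemma sa_bnd1 n (T : 'M[H -> H]_n) : lin_mx T -> sa T -> psd T ->
  (forall h, vip (mx_apply T h) h <= vip h h) -> bnd 1 T.
Proof.
move=> lT saT pT leT h; rewrite l2norm_le // expr1n mul1r.
set g := mx_apply T h.
have := psd_CS h g lT saT pT; rewrite -/g => CS.
have [g0|g0] := eqVneq (vip g g) 0; first by rewrite g0 vip_ge0.
have {}g0 : 0 < vip g g by rewrite lt_neqAle eq_sym g0 vip_ge0.
by rewrite -(ler_pM2r g0) -expr2 (le_trans CS) // ler_pM // ?pT // leT.
Qed.

(** The scalar iteration that dominates [sqrt_iter]: [sqrt_iter] is a polynomial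
    in [A] with nonnegative coefficients, and [sqrt_scal] is its value at [1]. *)
Fixpoint sqrt_scal (k : nat) : R :=
  if k is k'.+1 then (1 + sqrt_scal k' ^+ 2) / 2 else 0.

Lemma sqrt_scal_itv k : 0 <= sqrt_scal k <= 1.
Proof. elim: k => [|k /andP[a b]] /=; first by rewrite lexx ler01. by nra. Qed.

Lemma sqrt_scal_mono k : sqrt_scal k <= sqrt_scal k.+1.
Proof. by have /andP[] := sqrt_scal_itv k => /= a b; nra. Qed.

Lemma sqrt_scal_mono_le k l : (k <= l)%N -> sqrt_scal k <= sqrt_scal l.
Proof.
by move=> /subnK <-; elim: (l - k)%N => // m /le_trans; apply; exact: sqrt_scal_mono.
Qed.

Lemma sqrt_scal_cauchy e : 0 < e -> exists N, forall k l, (N <= k)%N -> (k <= l)%N ->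
  sqrt_scal l - sqrt_scal k <= e.
Proof.
move=> e0; have supS : has_sup (range sqrt_scal).
  split; first by exists (sqrt_scal 0), 0%N.
  by exists 1 => _ [k _ <-]; case/andP: (sqrt_scal_itv k).
have [_ [N _ <-] lN] := sup_adherent e0 supS.
exists N => k l Nk kl; have := sqrt_scal_mono_le Nk.
have : sqrt_scal l <= sup (range sqrt_scal) by apply: ub_le_sup; [case: supS|exists l].
lra.
Qed.

Variables (E : set (H -> H)) (hE : unital_cstar_algebra E) (n : nat).
Variable (A : 'M[H -> H]_n).
Hypotheses (EA : mx_over E A) (saA : sa A) (bA : bnd 1 A).

(** Visser's iteration for [1 - sqrt (1 - A)]. *)
Fixpoint sqrt_iter (k : nat) : 'M[H -> H]_n :=
  if k is k'.+1 then mxZ (2^-1)%:C (A + mxc (sqrt_iter k') (sqrt_iter k')) else 0.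

Lemma sqrt_iter_over k : mx_over E (sqrt_iter k).
Proof.
by elim: k => [|k IH] /=; [exact: mx_cstar0|];
  apply: (mx_cstarZ hE); apply: (mx_cstarD hE) => //; exact: (mx_cstarM hE).
Qed.
Hint Resolve sqrt_iter_over : core.

Let linY k : lin_mx (sqrt_iter k). Proof. exact: mx_cstar_lin (sqrt_iter_over k). Qed.
Let lA : lin_mx A. Proof. exact: mx_cstar_lin EA. Qed.

Lemma sqrt_iterS k h : mx_apply (sqrt_iter k.+1) h =
  (2^-1)%:C *: (mx_apply A h + mx_apply (sqrt_iter k) (mx_apply (sqrt_iter k) h)).
Proof. by rewrite /= mx_applyZ mx_applyD mx_apply_mxc. Qed.

Lemma sqrt_iter_sa k : sa (sqrt_iter k).
Proof.
elim: k => [|k IH] g h; first by rewrite !mx_apply0 /vip !big1 // => i _; rewrite ?rip0l ?rip0r.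
by rewrite !sqrt_iterS vipZl vipZr vipDl vipDr saA !IH.
Qed.

Lemma sqrt_iter_comm (C : 'M[H -> H]_n) k : lin_mx C -> mx_comm C A ->
  mx_comm C (sqrt_iter k).
Proof.
move=> lC CA; have lin := mx_apply_lin lC.
elim: k => [|k IH] h; first by rewrite !mx_apply0 (lin0 lin).
by rewrite !sqrt_iterS (linZ lin) (linD lin) CA !IH.
Qed.

Lemma sqrt_iter_commute k l : mx_comm (sqrt_iter k) (sqrt_iter l).
Proof. by apply: sqrt_iter_comm => // h; rewrite (sqrt_iter_comm _ lA). Qed.

Lemma sqrt_iter_bnd k : bnd (sqrt_scal k) (sqrt_iter k).
Proof.
elim: k => [|k IH] h; first by rewrite mx_apply0 l2norm0 mul0r.
rewrite sqrt_iterS l2normZ ger0_norm ?invr_ge0 //=.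
have := l2normD (mx_apply A h) (mx_apply (sqrt_iter k) (mx_apply (sqrt_iter k) h)).
have := bA h; have /andP[y0 _] := sqrt_scal_itv k.
have := IH (mx_apply (sqrt_iter k) h); have := ler_wpM2l y0 (IH h).
by rewrite expr2 mulrA -mulrA; lra.
Qed.

Lemma sqrt_iter_diff k :
  bnd (sqrt_scal k.+1 - sqrt_scal k) (sqrt_iter k.+1 - sqrt_iter k).
Proof.
elim: k => [|k IH] h.
  rewrite mx_applyB sqrt_iterS !mx_apply0 addr0 subr0 l2normZ ger0_norm ?invr_ge0 //=.
  by have := bA h; lra.
rewrite mx_applyB.
have lin l := mx_apply_lin (linY l).
(* [Y_(k+2) - Y_(k+1) = (Y_(k+1) - Y_k) (Y_(k+1) + Y_k) / 2], as the iterates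
   commute. *)
have -> : mx_apply (sqrt_iter k.+2) h - mx_apply (sqrt_iter k.+1) h =
    (2^-1)%:C *: mx_apply (sqrt_iter k.+1 - sqrt_iter k)
       (mx_apply (sqrt_iter k.+1 + sqrt_iter k) h).
  rewrite sqrt_iterS [in X in _ - X]sqrt_iterS -scalerBr; congr (_ *: _).
  rewrite mx_applyB mx_applyD !(linD (lin _)) (sqrt_iter_commute k k.+1 h).
  by rewrite [RHS]addrKA [X in X - _]addrC addrKA.
rewrite l2normZ ger0_norm ?invr_ge0 //.
have := IH (mx_apply (sqrt_iter k.+1 + sqrt_iter k) h).
have := bndD (sqrt_iter_bnd k.+1) (sqrt_iter_bnd k) h.
have d0 : 0 <= sqrt_scal k.+1 - sqrt_scal k by rewrite subr_ge0 sqrt_scal_mono.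
move=> /(ler_wpM2l d0); set N := l2norm (mx_apply _ _); set M := l2norm (mx_apply _ _).
set y := sqrt_scal k.+1; set x := sqrt_scal k.
have -> : sqrt_scal k.+2 = (1 + y ^+ 2) / 2 by [].
have yE : y = (1 + x ^+ 2) / 2 by [].
move=> h1 h2; have : M <= (y ^+ 2 - x ^+ 2) * l2norm h.
  rewrite (le_trans h2) // (le_trans h1) // le_eqVlt.
  by apply/orP; left; apply/eqP; ring.
have -> : (1 + y ^+ 2) / 2 - y = (y ^+ 2 - x ^+ 2) / 2 by rewrite [in X in _ - X]yE; field.
lra.
Qed.

Lemma sqrt_iter_diff_le k l : (k <= l)%N ->
  bnd (sqrt_scal l - sqrt_scal k) (sqrt_iter l - sqrt_iter k).
Proof.
move=> /subnK <-; elim: (l - k)%N => [|m IH].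
  by rewrite add0n !subrr => h; rewrite mx_apply0 l2norm0 mul0r.
have := bndD (sqrt_iter_diff (m + k)) IH.
by rewrite addSn !addrA !subrK.
Qed.

Lemma sqrt_iter_lim : exists2 W, mx_over E W &
  forall e : R, 0 < e -> exists N, forall k, (N <= k)%N -> bnd e (sqrt_iter k - W).
Proof.
apply: (mx_cstar_complete hE) => // e e0.
have [N yN] := sqrt_scal_cauchy e0; exists N => k l Nk Nl.
case/orP: (leq_total k l) => kl.
  rewrite -opprB; apply: bndN.
  exact: (bnd_ge (yN _ _ Nk kl) (sqrt_iter_diff_le kl)).
exact: (bnd_ge (yN _ _ Nl kl) (sqrt_iter_diff_le kl)).
Qed.

Lemma l2norm_small (h : 'I_n -> H) : (forall e : R, 0 < e -> l2norm h <= e) -> h = 0.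
Proof.
move=> xe; apply: l2norm_eq0; apply/eqP; rewrite eq_le l2norm_ge0 andbT.
by apply/ler_addgt0Pr => e e0; rewrite add0r xe.
Qed.

(** The limit [W] of the iteration satisfies [2 W = A + W^2], so that
    [1 - W] is a square root of [1 - A].  It is positive because [W] is a
    self-adjoint contraction. *)
Lemma mx_sqrt_complement : exists2 B, mx_over E B & [/\ sa B, psd B,
  forall h, mx_apply B (mx_apply B h) = h - mx_apply A h &
  forall C c, lin_mx C -> bnd c C -> mx_comm C A -> mx_comm C B].
Proof.
have [W EW limW] := sqrt_iter_lim.
have lW := mx_cstar_lin hE EW; have lin := mx_apply_lin lW.
have linYk k := mx_apply_lin (linY k).
have W1 : bnd 1 W.
  move=> h; apply/ler_addgt0Pr => e e0.
  have c0 : 0 < l2norm h + 1 by rewrite ltr_wpDl // l2norm_ge0.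
  have [N WN] := limW _ (divr_gt0 e0 c0).
  have {}WN := WN N (leqnn N) h; rewrite mx_applyB in WN.
  have /andP[_ y1] := sqrt_scal_itv N; have y1h := ler_wpM2r (l2norm_ge0 h) y1.
  have bN := sqrt_iter_bnd N h.
  have qe : e / (l2norm h + 1) * l2norm h <= e.
    by rewrite -mulrA ler_piMr ?(ltW e0) // mulrC ler_pdivrMr // mul1r lerDl.
  have := l2normD (mx_apply (sqrt_iter N) h) (- (mx_apply (sqrt_iter N) h - mx_apply W h)).
  rewrite l2normN opprB addrC subrK; lra.
have Wc C c : lin_mx C -> bnd c C -> mx_comm C A -> mx_comm C W.
  move=> lC bC CA h; have linC := mx_apply_lin lC.
  apply/eqP; rewrite -subr_eq0; apply/eqP/l2norm_small => e e0.
  pose d := l2norm h; pose d' := l2norm (mx_apply C h).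
  have c0 : 0 < `|c| * d + d' + 1.
    by rewrite ltr_wpDl // addr_ge0 ?mulr_ge0 ?l2norm_ge0.
  have [N WN] := limW _ (divr_gt0 e0 c0); have {}WN := WN N (leqnn N).
  have -> : mx_apply C (mx_apply W h) - mx_apply W (mx_apply C h) =
     - mx_apply C (mx_apply (sqrt_iter N - W) h) + mx_apply (sqrt_iter N - W) (mx_apply C h).
    rewrite !mx_applyB (linB linC) (sqrt_iter_comm N lC CA) opprB.
    by rewrite addrA subrK.
  rewrite (le_trans (l2normD _ _)) // l2normN.
  have bC' := bnd_ge (ler_norm c) bC.
  have := bC' (mx_apply (sqrt_iter N - W) h); have := WN (mx_apply C h).
  have := ler_wpM2l (normr_ge0 c) (WN h); rewrite -/d -/d'.
  set q := e / _.
  have -> : e = q * (`|c| * d + d' + 1) by rewrite /q mulfVK // gt_eqF.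
  have q0 : 0 < q by rewrite divr_gt0.
  lra.
have WY k : mx_comm W (sqrt_iter k).
  move=> h; rewrite -(Wc _ _ (linY k) (sqrt_iter_bnd k)) // => g.
  by rewrite (sqrt_iter_comm k lA).
have WE h : h - mx_apply A h =
   h - mx_apply W h - (mx_apply W h - mx_apply W (mx_apply W h)).
  suff WA : (2^-1)%:C *: (mx_apply A h + mx_apply W (mx_apply W h)) = mx_apply W h.
    have WA2 : mx_apply A h = mx_apply W h + mx_apply W h - mx_apply W (mx_apply W h).
      apply/(canRL (addrK _)); rewrite -{2 3}WA -scalerDl -rmorphD /=.
      have -> : 2^-1 + 2^-1 = 1 :> R by lra.
      by rewrite scale1r.
    by rewrite WA2 !opprD !opprK !addrA.
  apply/eqP; rewrite -subr_eq0; apply/eqP/l2norm_small => e e0.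
  have c0 : 0 < 2 * l2norm h + 1 by rewrite ltr_wpDl // mulr_ge0 ?l2norm_ge0.
  have [N WN] := limW _ (divr_gt0 e0 c0).
  have N0 := WN N (leqnn N); have N1 := WN N.+1 (leqnSn N).
  set D0 := sqrt_iter N - W in N0; set D1 := sqrt_iter N.+1 - W in N1.
  have -> : (2^-1)%:C *: (mx_apply A h + mx_apply W (mx_apply W h)) - mx_apply W h =
     mx_apply D1 h - (2^-1)%:C *: mx_apply D0 (mx_apply (sqrt_iter N + W) h).
    rewrite [mx_apply D1 h]mx_applyB sqrt_iterS [RHS]addrAC -scalerBr; congr (_ *: _ - _).
    rewrite mx_applyB mx_applyD !(linD (linYk _)) !(linD lin) (WY N h).
    by rewrite addrKA opprD opprK !addrA addrK.
  rewrite (le_trans (l2normD _ _)) // l2normN l2normZ ger0_norm ?invr_ge0 //.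
  have := N1 h; have := N0 (mx_apply (sqrt_iter N + W) h).
  have /andP[_ y1] := sqrt_scal_itv N.
  have /(_ h) := bndD (bnd_ge y1 (sqrt_iter_bnd N)) W1.
  set q := e / _ => s1.
  have q0 : 0 < q by rewrite divr_gt0.
  have -> : e = q * (2 * l2norm h + 1) by rewrite /q mulfVK // gt_eqF.
  have := ler_wpM2l (ltW q0) s1; have := mulr_ge0 (ltW q0) (l2norm_ge0 h); lra.
have saW : sa W.
  move=> g h; apply/eqP; rewrite -subr_eq0 -normr_eq0 eq_le normr_ge0 andbT.
  apply/ler_addgt0Pr => e e0; rewrite add0r.
  pose d := l2norm g * l2norm h.
  have d0 : 0 <= d by rewrite mulr_ge0 ?l2norm_ge0.
  have c0 : 0 < 2 * d + 1 by rewrite ltr_wpDl // mulr_ge0.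
  have [N WN] := limW _ (divr_gt0 e0 c0); have {}WN := WN N (leqnn N).
  set D := sqrt_iter N - W in WN.
  have -> : vip (mx_apply W g) h - vip g (mx_apply W h) =
     vip g (mx_apply D h) - vip (mx_apply D g) h.
    by rewrite !mx_applyB vipBl vipBr (sqrt_iter_sa N g h); ring.
  set q := e / _ in WN.
  have q0 : 0 < q by rewrite divr_gt0.
  have -> : e = q * (2 * d + 1) by rewrite /q mulfVK // gt_eqF.
  rewrite (le_trans (ler_normB _ _)) //.
  have := le_trans (vip_norm_le g _) (ler_wpM2l (l2norm_ge0 g) (WN h)).
  have := le_trans (vip_norm_le _ h) (ler_wpM2r (l2norm_ge0 h) (WN g)).
  rewrite /d; lra.
exists (mx1 H n - W); first exact: (mx_cstarB hE (@mx_cstar1 _ _ _ hE n) EW).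
have BE h : mx_apply (mx1 H n - W) h = h - mx_apply W h by rewrite mx_applyB mx_apply1.
split.
- by move=> g h; rewrite !BE vipBl vipBr saW.
- move=> h; rewrite BE vipBl subr_ge0 (le_trans (vip_le _ _)) //.
  by rewrite -l2norm_sq expr2 ler_wpM2r ?l2norm_ge0 // -[leRHS]mul1r W1.
- by move=> h; rewrite !BE (linB lin) WE.
- by move=> C c lC bC CA h; rewrite !BE (linB (mx_apply_lin lC)) (Wc C c).
Qed.

End SquareRoot.
(** * Positivity is detected by separating families *)

Section SquareRootScaled.
Context (R : realType) (H : hilbertType R) (E : set (H -> H)).
Hypothesis hE : unital_cstar_algebra E.

(** The scale of [X] is normalised by a bound [c], so that [mx_sqrt_complement]
    applies to [A = 1 - X / c]. *)
Lemma mx_sqrt n (X : 'M[H -> H]_n) : mx_over E X -> sa X -> psd X ->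
  exists2 B, mx_over E B & [/\ sa B, psd B, X = mxc B B &
    forall C c, lin_mx C -> bnd c C -> mx_comm C X -> mx_comm C B].
Proof.
move=> EX saX pX; have [c c0 bX] := mx_cstar_bnd hE EX.
have lX := mx_cstar_lin hE EX; have linX := mx_apply_lin lX.
pose A := mx1 H n - mxZ (c^-1)%:C X.
have EA : mx_over E A.
  exact: (mx_cstarB hE (@mx_cstar1 _ _ _ hE n) (mx_cstarZ hE _ EX)).
have AE h : mx_apply A h = h - (c^-1)%:C *: mx_apply X h.
  by rewrite mx_applyB mx_apply1 mx_applyZ.
have lA := mx_cstar_lin hE EA.
have saA : sa A by move=> g h; rewrite !AE vipBl vipBr vipZl vipZr saX.
have bA : bnd 1 A.
  apply: sa_bnd1 => // h; rewrite AE vipBl vipZl.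
    rewrite subr_ge0 mulrC ler_pdivrMr // (le_trans (vip_le _ _)) //.
    by rewrite -l2norm_sq expr2 mulrAC ler_wpM2r ?l2norm_ge0 // mulrC bX.
  by rewrite lerBlDr lerDl mulr_ge0 ?invr_ge0 ?(ltW c0).
have [B EB [saB pB BE Bc]] := mx_sqrt_complement hE EA saA bA.
have lB := mx_cstar_lin hE EB.
pose r := Num.sqrt c; have r0 : 0 < r by rewrite sqrtr_gt0.
have rr : r * r = c by rewrite -expr2 sqr_sqrtr // ltW.
have ErB := mx_cstarZ hE r%:C EB.
exists (mxZ r%:C B) => //; split.
- by move=> g h; rewrite !mx_applyZ vipZl vipZr saB.
- by move=> h; rewrite mx_applyZ vipZl mulr_ge0 ?(ltW r0).
- apply: mx_apply_inj => //; first exact: (mx_cstar_lin hE (mx_cstarM hE ErB ErB)).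
  move=> h; rewrite mx_apply_mxc ?mx_applyZ; last exact: mx_cstar_lin ErB.
  rewrite (linZ (mx_apply_lin lB)) scalerA -rmorphM rr BE AE opprB addrC subrK.
  by rewrite scalerA -rmorphM mulfV ?gt_eqF // scale1r.
move=> C d lC bC CX h; have linC := mx_apply_lin lC.
rewrite !mx_applyZ (linZ linC) (Bc _ _ lC bC) // => g.
by rewrite !AE (linB linC) (linZ linC) CX.
Qed.

End SquareRootScaled.

Lemma psd_null (R : realType) (H : hilbertType R) n (T : 'M[H -> H]_n) h :
  lin_mx T -> sa T -> psd T -> vip (mx_apply T h) h = 0 -> mx_apply T h = 0.
Proof.
move=> lT saT pT h0; apply: vip_eq0; apply/eqP; rewrite -sqrf_eq0 eq_le sqr_ge0 andbT.
by have := psd_CS h (mx_apply T h) lT saT pT; rewrite h0 mul0r.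
Qed.

(** With [g = S h - T h], the hypotheses give [(S + T) g = 0], so that [g] is null
    for both quadratic forms; hence [S g = T g = 0] and [|g|^2 = 0]. *)
Lemma psd_sqrt_uniq (R : realType) (H : hilbertType R) n (S T : 'M[H -> H]_n) :
  lin_mx S -> lin_mx T -> sa S -> sa T -> psd S -> psd T -> mx_comm S T ->
  (forall h, mx_apply S (mx_apply S h) = mx_apply T (mx_apply T h)) ->
  forall h, mx_apply S h = mx_apply T h.
Proof.
move=> lS lT saS saT pS pT cST sq h.
have linS := mx_apply_lin lS; have linT := mx_apply_lin lT.
set g := mx_apply S h - mx_apply T h.
have sum0 : mx_apply S g + mx_apply T g = 0.
  by rewrite (linB linS) (linB linT) sq cST addrC addrA subrK subrr.
have : vip (mx_apply S g) g + vip (mx_apply T g) g = 0.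
  by rewrite -vipDl sum0 /vip big1 // => i _; rewrite rip0l.
have := pS g; have := pT g => pTg pSg /eqP; rewrite paddr_eq0 // => /andP[/eqP S0 /eqP T0].
apply/eqP; rewrite -subr_eq0; apply/eqP/vip_eq0; rewrite -/g {1}/g vipBl saS saT.
rewrite -vipBr (psd_null lS) // (psd_null lT) // subrr vip_sym.
by rewrite /vip big1 // => i _; rewrite rip0l.
Qed.

Section StarHom.
Context (R : realType) (H L : hilbertType R) (E : set (H -> H)).
Hypothesis hE : unital_cstar_algebra E.
Variable (p : (H -> H) -> (L -> L)).
Hypothesis lp : linear_on E p.
Implicit Types (S T : H -> H).

Lemma linear_onD S T : E S -> E T -> p (S + T) = p S + p T.
Proof. by move=> ES ET; have := lp 1 ES ET; rewrite !scale1r. Qed.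

Lemma linear_on0 : p 0 = 0.
Proof.
have := linear_onD (cstar0 hE) (cstar0 hE); rewrite addr0 => /eqP.
by rewrite -subr_eq0 opprD addrA subrr sub0r oppr_eq0 => /eqP.
Qed.

Lemma linear_onZ a T : E T -> p (a *: T) = a *: p T.
Proof. by move=> ET; have := lp a ET (cstar0 hE); rewrite linear_on0 !addr0. Qed.

Lemma linear_onN T : E T -> p (- T) = - p T.
Proof. by move=> ET; rewrite -scaleN1r linear_onZ // scaleN1r. Qed.

Lemma linear_onB S T : E S -> E T -> p (S - T) = p S - p T.
Proof. by move=> ES ET; rewrite linear_onD ?linear_onN //; exact: (cstarN hE). Qed.

Lemma linear_on_sum (I : Type) (r : seq I) (F : I -> H -> H) :
  (forall i, E (F i)) -> p (\sum_(i <- r) F i) = \sum_(i <- r) p (F i).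
Proof.
move=> EF; elim: r => [|i r IH]; first by rewrite !big_nil linear_on0.
by rewrite !big_cons linear_onD ?IH //; exact: (cstar_sum hE).
Qed.

Hypothesis bp : p @` E `<=` @bounded_op R L.

Lemma rep_linear T : E T -> linear (p T).
Proof. by move=> ET; case: (bp (ex_intro2 _ _ T ET erefl)). Qed.

Lemma rep_lin_mx n (T : 'M[H -> H]_n) : mx_over E T -> lin_mx (map_mx p T).
Proof. by move=> ET i j; rewrite mxE; exact: rep_linear. Qed.

Lemma rep_mxZ n a (T : 'M[H -> H]_n) : mx_over E T ->
  map_mx p (mxZ a T) = mxZ a (map_mx p T).
Proof. by move=> ET; apply/matrixP => i j; rewrite !mxE linear_onZ. Qed.

Lemma rep_mxB n (S T : 'M[H -> H]_n) : mx_over E S -> mx_over E T ->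
  map_mx p (S - T) = map_mx p S - map_mx p T.
Proof.
by move=> ES ET; apply/matrixP => i j; rewrite !mxE linear_onB.
Qed.

Hypothesis hp : star_hom E p.

Lemma rep_mul S T : E S -> E T -> p (S \o T) = p S \o p T.
Proof. by case: hp => _ h _; exact: h. Qed.

Lemma rep_star T : E T -> p (star T) = star (p T).
Proof.
move=> ET; apply/esym/starE; case: hp => _ _ h.
by apply: h => //; [exact: (cstar_star hE)|exact: (starP hE)].
Qed.

Lemma rep_adj T x y : E T -> rip (p T x) y = rip x (p (star T) y).
Proof.
move=> ET; apply: adjoint_rip; case: hp => _ _ h.
by apply: h => //; [exact: (cstar_star hE)|exact: (starP hE)].
Qed.

Lemma rep_mxc n (S T : 'M[H -> H]_n) : mx_over E S -> mx_over E T ->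
  map_mx p (mxc S T) = mxc (map_mx p S) (map_mx p T).
Proof.
move=> ES ET; apply/matrixP => i j; rewrite !mxE linear_on_sum; last first.
  by move=> k; exact: (cstarM hE).
by apply: eq_bigr => k _; rewrite rep_mul // !mxE.
Qed.

Lemma vip_rep_star n (T : 'M[H -> H]_n) g h : mx_over E T ->
  vip (mx_apply (map_mx p T) g) h = vip g (mx_apply (map_mx p (mxstar T)) h).
Proof.
move=> ET; rewrite /vip /mx_apply.
under eq_bigr do rewrite rip_suml; under [RHS]eq_bigr do rewrite rip_sumr.
rewrite exchange_big; apply: eq_bigr => i _; apply: eq_bigr => j _.
by rewrite !mxE rep_adj.
Qed.

Lemma rep_sa n (T : 'M[H -> H]_n) : mx_over E T -> sa T -> sa (map_mx p T).
Proof.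
move=> ET saT g h; rewrite vip_rep_star //; congr (vip _ (mx_apply (map_mx p _) h)).
apply: (mx_apply_inj (mx_cstar_lin hE (mx_cstar_star hE ET)) (mx_cstar_lin hE ET)) => k.
by apply: vip_inj => g'; rewrite vip_sym -(vip_mxstar hE) // saT vip_sym.
Qed.

(** A positive element is a square [B^2] inside the algebra, and [p] maps it to
    the square of a self-adjoint operator. *)
Lemma rep_psd n (T : 'M[H -> H]_n) : mx_over E T -> sa T -> psd T ->
  psd (map_mx p T).
Proof.
move=> ET saT pT h; have [B EB [saB _ -> _]] := mx_sqrt hE ET saT pT.
rewrite rep_mxc // mx_apply_mxc; last exact: rep_lin_mx.
by rewrite (rep_sa EB saB) vip_ge0.
Qed.

End StarHom.

(** A family is a predicate on representations, so that all representations of an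
    algebra can be considered at once. *)
Definition separating (R : realType) (H : hilbertType R) (E : set (H -> H))
    (F : forall L : hilbertType R, ((H -> H) -> (L -> L)) -> Prop) :=
  (forall L s, F L s -> star_rep E s) /\
  forall T, E T -> (forall L s, F L s -> s T = 0) -> T = 0.

(** Let [B] be the positive square root of [X^2].  Each [s X] is positive, so it
    is the positive square root of its square, and this is [s B].  Hence
    [X = B]. *)
Lemma separating_psd (R : realType) (H : hilbertType R) (E : set (H -> H))
    (F : forall L : hilbertType R, ((H -> H) -> (L -> L)) -> Prop) n
    (X : 'M[H -> H]_n) :
  unital_cstar_algebra E -> separating E F -> mx_over E X -> sa X ->
  (forall L s, F L s -> psd (map_mx s X)) -> psd X.
Proof.
move=> hE [repF sepF] EX saX pX.
have lX := mx_cstar_lin hE EX; have [c _ bX] := mx_cstar_bnd hE EX.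
have EXX := mx_cstarM hE EX EX.
have saXX : sa (mxc X X) by move=> g h; rewrite !mx_apply_mxc // !saX.
have pXX : psd (mxc X X) by move=> h; rewrite mx_apply_mxc // saX vip_ge0.
have [B EB [saB pB XXE Bc]] := mx_sqrt hE EXX saXX pXX.
have XB : mx_comm X B by apply: (Bc _ c) => // h; rewrite !mx_apply_mxc.
have lB := mx_cstar_lin hE EB.
have XBE : mxc X B = mxc B X.
  apply: (mx_apply_inj (mx_cstar_lin hE (mx_cstarM hE EX EB))
            (mx_cstar_lin hE (mx_cstarM hE EB EX))) => h.
  by rewrite !mx_apply_mxc // XB.
suff -> : X = B by [].
apply/matrixP => i j; apply/eqP; rewrite -subr_eq0; apply/eqP.
apply: sepF => [|L s Fs]; first exact: (cstarB hE).
have [hs bs] := repF L s Fs; have ls : linear_on E s by case: hs.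
have lsX := rep_lin_mx bs EX; have lsB := rep_lin_mx bs EB.
have sXB : map_mx s X = map_mx s B.
  apply: (mx_apply_inj lsX lsB); apply: psd_sqrt_uniq => //.
  - exact: (rep_sa hE hs EX saX).
  - exact: (rep_sa hE hs EB saB).
  - exact: pX.
  - exact: (rep_psd hE ls bs hs EB saB pB).
  - by move=> h; rewrite -!mx_apply_mxc // -!(rep_mxc hE ls hs) // XBE.
  - by move=> h; rewrite -!mx_apply_mxc // -!(rep_mxc hE ls hs) // XXE.
by have /matrixP/(_ i j) := sXB; rewrite !mxE (linear_onB hE ls) // => ->; rewrite subrr.
Qed.
(** * Norms and representations *)

Section Contractions.
Context (R : realType) (H : hilbertType R) (E : set (H -> H)).
Hypothesis hE : unital_cstar_algebra E.

(** Its positivity turns norm bounds into positivity statements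
    ([defect_psd]). *)
Definition defect n (c : R) (T : 'M[H -> H]_n) :=
  mxZ (c ^+ 2)%:C (mx1 H n) - mxc (mxstar T) T.

Lemma defect_over n c (T : 'M[H -> H]_n) : mx_over E T -> mx_over E (defect c T).
Proof.
move=> ET; apply: (mx_cstarB hE); first exact: (mx_cstarZ hE _ (@mx_cstar1 _ _ _ hE n)).
exact: (mx_cstarM hE (mx_cstar_star hE ET) ET).
Qed.

Lemma defectE n c (T : 'M[H -> H]_n) g h : mx_over E T ->
  vip (mx_apply (defect c T) g) h = c ^+ 2 * vip g h - vip (mx_apply T g) (mx_apply T h).
Proof.
move=> ET; have lS := mx_cstar_lin hE (mx_cstar_star hE ET).
rewrite mx_applyB mx_applyZ mx_apply1 vipBl vipZl mx_apply_mxc //.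
by congr (_ - _); rewrite vip_sym -(vip_mxstar hE) // vip_sym.
Qed.

Lemma defect_sa n c (T : 'M[H -> H]_n) : mx_over E T -> sa (defect c T).
Proof.
move=> ET g h; rewrite defectE // [RHS]vip_sym defectE //.
by rewrite (vip_sym g h) (vip_sym (mx_apply T g) (mx_apply T h)).
Qed.

Lemma defect_psd n c (T : 'M[H -> H]_n) : 0 <= c -> mx_over E T ->
  psd (defect c T) <-> bnd c T.
Proof.
move=> c0 ET; split=> [pT h|bT h].
  by rewrite l2norm_le // -subr_ge0 -defectE.
by rewrite defectE // subr_ge0 -l2norm_le.
Qed.

Section Rep.
Context (L : hilbertType R) (p : (H -> H) -> (L -> L)).
Hypothesis rp : star_rep E p.

Let hp : star_hom E p. Proof. by case: rp. Qed.
Let lp : linear_on E p. Proof. by case: hp. Qed.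
Let bp : p @` E `<=` @bounded_op R L. Proof. by case: rp. Qed.

Lemma rep_unit_sq x : rip (p idfun x) (p idfun x) = rip (p idfun x) x.
Proof.
have E1 := cstar1 hE.
rewrite (rep_adj hE hp) // star1 -[p idfun (p idfun x)]/((p idfun \o p idfun) x).
by rewrite -(rep_mul hp) // rip_sym.
Qed.

Lemma rep_unit_le x : rip (p idfun x) x <= rip x x.
Proof.
have := rip_ge0 (x - p idfun x); rewrite ripBl !ripBr rep_unit_sq.
by rewrite (rip_sym (p idfun x) x) subrr subr0 subr_ge0.
Qed.

Lemma rep_mx1 n h : mx_apply (map_mx p (mx1 H n)) h = (fun i => p idfun (h i)).
Proof.
apply/funext => i; rewrite /mx_apply (bigD1 i) //= !mxE eqxx big1 ?addr0 // => j ji.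
by rewrite !mxE eq_sym (negPf ji) (linear_on0 hE lp).
Qed.

Lemma rep_defectE n c (T : 'M[H -> H]_n) h : mx_over E T ->
  vip (mx_apply (map_mx p (defect c T)) h) h =
  c ^+ 2 * vip (fun i => p idfun (h i)) h -
  vip (mx_apply (map_mx p T) h) (mx_apply (map_mx p T) h).
Proof.
move=> ET; have ES := mx_cstar_star hE ET; have E1 := @mx_cstar1 _ _ _ hE n.
rewrite (rep_mxB hE lp); [|exact: (mx_cstarZ hE)|exact: (mx_cstarM hE)].
rewrite mx_applyB vipBl (rep_mxZ hE lp) // mx_applyZ vipZl rep_mx1 (rep_mxc hE lp hp) //.
rewrite mx_apply_mxc; last exact: (rep_lin_mx bp).
by congr (_ - _); rewrite vip_sym -(vip_rep_star hE hp).
Qed.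

(** A representation may be degenerate: the image of the defect is
    [c^2 p(1) - p(T)^* p(T)], where [p(1)] is a projection. *)
Lemma rep_bnd n c (T : 'M[H -> H]_n) : 0 <= c -> mx_over E T -> bnd c T ->
  bnd c (map_mx p T).
Proof.
move=> c0 ET bT h; rewrite l2norm_le //.
have pD := (defect_psd c0 ET).2 bT.
have := rep_psd hE lp bp hp (defect_over c ET) (defect_sa c ET) pD h.
rewrite rep_defectE // subr_ge0 => /le_trans; apply.
by rewrite ler_wpM2l ?sqr_ge0 // ler_sum // => i _; exact: rep_unit_le.
Qed.

(** Converse use of the projection [p(1)]: [p(T) = p(T) p(1)]. *)
Lemma rep_defect_psd n c (T : 'M[H -> H]_n) : 0 <= c -> mx_over E T ->
  bnd c (map_mx p T) -> psd (map_mx p (defect c T)).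
Proof.
move=> c0 ET bT h; rewrite rep_defectE // subr_ge0.
pose g := mx_apply (map_mx p (mx1 H n)) h.
have -> : mx_apply (map_mx p T) h = mx_apply (map_mx p T) g.
  rewrite /g -mx_apply_mxc; last exact: (rep_lin_mx bp).
  rewrite -(rep_mxc hE lp hp) //; last exact: (@mx_cstar1 _ _ _ hE n).
  congr (mx_apply (map_mx p _) h).
  apply: (mx_apply_inj (mx_cstar_lin hE ET)).
    exact: (mx_cstar_lin hE (mx_cstarM hE ET (@mx_cstar1 _ _ _ hE n))).
  by move=> k; rewrite mx_apply_mxc ?mx_apply1 //; exact: (mx_cstar_lin hE ET).
have := bT g; rewrite l2norm_le // => /le_trans; apply.
rewrite ler_wpM2l ?sqr_ge0 // ler_sum // => i _.
by rewrite /g rep_mx1 rep_unit_sq.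
Qed.

End Rep.

(** The family detects the positivity of the defect, so it computes the norm. *)
Lemma separating_bnd n c (T : 'M[H -> H]_n)
    (F : forall L : hilbertType R, ((H -> H) -> (L -> L)) -> Prop) :
  0 <= c -> separating E F -> mx_over E T ->
  (forall L s, F L s -> bnd c (map_mx s T)) -> bnd c T.
Proof.
move=> c0 sF ET bT; apply/(defect_psd c0 ET).
apply: (separating_psd hE sF); [exact: defect_over|exact: defect_sa|].
by move=> L s Fs; apply: rep_defect_psd => //; [exact: sF.1|exact: bT].
Qed.

(** The one-by-one case, for single operators. *)
Definition pos (K : hilbertType R) (T : K -> K) := forall x, 0 <= rip (T x) x.

Lemma mx_apply_const (K : hilbertType R) (T : K -> K) (h : 'I_1 -> K) i :
  mx_apply (const_mx T) h i = T (h i).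
Proof. by rewrite /mx_apply big_ord1 mxE (ord1 i). Qed.

Lemma psd_const (K : hilbertType R) (T : K -> K) : psd (@const_mx _ 1 1 T) <-> pos T.
Proof.
split=> [pT x|pT h]; last by rewrite /vip big_ord1 mx_apply_const.
by have := pT (fun=> x); rewrite /vip big_ord1 mx_apply_const.
Qed.

Lemma sa_const T : E T -> star T = T -> sa (@const_mx _ 1 1 T).
Proof.
by move=> ET sT g h; rewrite /vip !big_ord1 !mx_apply_const (rip_star hE) // sT.
Qed.

Lemma map_const_mx1 (L : hilbertType R) (p : (H -> H) -> (L -> L)) T :
  map_mx p (@const_mx _ 1 1 T) = const_mx (p T).
Proof. by apply/matrixP => i j; rewrite !mxE. Qed.

Lemma over_const T : E T -> mx_over E (@const_mx _ 1 1 T).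
Proof. by move=> ET i j; rewrite mxE. Qed.

Lemma separating_pos (F : forall L : hilbertType R, ((H -> H) -> (L -> L)) -> Prop) T :
  separating E F -> E T -> star T = T -> (forall L s, F L s -> pos (s T)) -> pos T.
Proof.
move=> sF ET sT pT; apply/psd_const.
apply: (separating_psd hE sF (over_const ET) (sa_const ET sT)) => L s Fs.
by rewrite map_const_mx1; apply/psd_const; exact: pT.
Qed.

Lemma rep_pos (L : hilbertType R) (p : (H -> H) -> (L -> L)) T :
  star_rep E p -> E T -> star T = T -> pos T -> pos (p T).
Proof.
move=> [hp bp] ET sT /psd_const pT; have lp : linear_on E p by case: hp.
apply/psd_const; rewrite -map_const_mx1.
exact: (rep_psd hE lp bp hp (over_const ET) (sa_const ET sT) pT).
Qed.

Lemma bnd_const (K : hilbertType R) (T : K -> K) (c : R) :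
  bnd c (@const_mx _ 1 1 T) <-> forall x, hnorm (T x) <= c * hnorm x.
Proof.
split=> [b x|b h].
  have := b (fun=> x); rewrite l2norm_const.
  have -> : mx_apply (@const_mx _ 1 1 T) (fun=> x) = (fun=> T x).
    by apply/funext => i; rewrite mx_apply_const.
  by rewrite l2norm_const.
have -> : h = (fun=> h ord0) by apply/funext => i; rewrite (ord1 i).
have -> : mx_apply (@const_mx _ 1 1 T) (fun=> h ord0) = (fun=> T (h ord0)).
  by apply/funext => i; rewrite mx_apply_const.
by rewrite !l2norm_const.
Qed.

Lemma cstar_bnd T : E T -> exists2 c : R, 0 < c & forall x, hnorm (T x) <= c * hnorm x.
Proof. by move=> ET; have [c c0 /bnd_const bT] := mx_cstar_bnd hE (over_const ET); exists c. Qed.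

Lemma sq_defect_pos T (c : R) : E T -> 0 <= c -> (forall x, hnorm (T x) <= c * hnorm x) ->
  let X := (c ^+ 2)%:C *: idfun - (star T \o T) in [/\ E X, star X = X & pos X].
Proof.
move=> ET c0 bT X; have E1 := cstar1 hE; have Es := cstar_star hE ET.
have Ec := cstarZ hE (c ^+ 2)%:C E1; have ETT := cstarM hE Es ET.
split; first exact: (cstarB hE).
  by rewrite (starB hE Ec ETT) (starZ hE _ E1) star1 (star_mul hE Es ET) (starK hE).
move=> x; rewrite ripBl ripZl subr_ge0 /= (rip_starr hE) //.
by rewrite -!hnorm_sq -exprMn ler_pXn2r // nnegrE ?mulr_ge0 ?hnorm_ge0.
Qed.

Lemma rep_contractive (L : hilbertType R) (p : (H -> H) -> (L -> L)) T (c : R) :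
  star_rep E p -> E T -> 0 <= c -> (forall x, hnorm (T x) <= c * hnorm x) ->
  forall x, hnorm (p T x) <= c * hnorm x.
Proof.
move=> rp ET c0 /bnd_const b; apply/bnd_const; rewrite -map_const_mx1.
exact: (rep_bnd rp c0 (over_const ET) b).
Qed.

End Contractions.
(** * Finite-dimensional spaces and Burnside's theorem *)

Section Orthonormal.
Context (R : realType) (H : hilbertType R).
Implicit Types (M N : set H).

Definition lin_sub M := M 0 /\ forall (a : R[i]) x y, M x -> M y -> M (a *: x + y).

Lemma lin_subD M x y : lin_sub M -> M x -> M y -> M (x + y).
Proof. by case=> _ h Mx My; rewrite -[x]scale1r; exact: h. Qed.

Lemma lin_subZ M (a : R[i]) x : lin_sub M -> M x -> M (a *: x).
Proof. by case=> h0 h Mx; rewrite -[_ *: _]addr0; exact: h. Qed.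

Lemma lin_subB M x y : lin_sub M -> M x -> M y -> M (x - y).
Proof.
by move=> hM Mx My; rewrite -scaleN1r; apply: lin_subD => //; exact: lin_subZ.
Qed.

Lemma lin_sub_sum M (I : Type) (r : seq I) (F : I -> H) :
  lin_sub M -> (forall i, M (F i)) -> M (\sum_(i <- r) F i).
Proof.
by move=> hM MF; elim/big_rec : _ => [|i x _]; [case: hM|exact: lin_subD].
Qed.

Lemma inner0r (x : H) : inner x 0 = 0.
Proof. by rewrite inner_sym inner0l rmorph0. Qed.

Lemma innerNl (x y : H) : inner (- x) y = - inner x y.
Proof. by rewrite -scaleN1r innerZl mulN1r. Qed.

Lemma inner_suml (I : Type) (r : seq I) (F : I -> H) y :
  inner (\sum_(i <- r) F i) y = \sum_(i <- r) inner (F i) y.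
Proof. by elim/big_rec2 : _ => [|i a b _ <-]; rewrite ?inner0l ?innerDl. Qed.

Lemma inner_eq0 (x : H) : inner x x = 0 -> x = 0.
Proof. by rewrite inner_selfE => /complexI/rip_eq0. Qed.

Definition orthonormal k (e : 'I_k -> H) := forall i j, inner (e i) (e j) = (i == j)%:R.

Definition proj k (e : 'I_k -> H) (x : H) := \sum_i inner x (e i) *: e i.

Lemma inner_comb k (e : 'I_k -> H) (c : 'I_k -> R[i]) j : orthonormal e ->
  inner (\sum_i c i *: e i) (e j) = c j.
Proof.
move=> one; rewrite inner_suml (bigD1 j) //= innerZl one eqxx mulr1.
by rewrite big1 ?addr0 // => i ij; rewrite innerZl one (negPf ij) mulr0.
Qed.

Lemma inner_proj k (e : 'I_k -> H) x j : orthonormal e ->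
  inner (x - proj e x) (e j) = 0.
Proof. by move=> one; rewrite innerDl innerNl inner_comb // subrr. Qed.

Lemma orthonormal_le k n (e : 'I_k -> H) (f : 'I_n -> H) : orthonormal e ->
  (forall i, exists c : 'I_n -> R[i], e i = \sum_j c j *: f j) -> (k <= n)%N.
Proof.
move=> one ef; rewrite leqNgt; apply/negP => nk.
have [c cE] := choice ef.
pose A : 'M[R[i]]_(k, n) := \matrix_(i, j) c i j.
have : kermx A != 0.
  by rewrite -mxrank_eq0 mxrank_ker -lt0n subn_gt0 (leq_ltn_trans (rank_leq_col A)).
case/rowV0Pn => w /sub_kermxP wA w0.
suff : w = 0 by move/eqP: w0.
apply/rowP => j; rewrite mxE -(inner_comb (w 0) j one).
suff -> : \sum_i w 0 i *: e i = 0 by rewrite inner0l.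
under eq_bigr => i _ do rewrite cE scaler_sumr.
rewrite exchange_big big1 // => l _.
under eq_bigr => i _ do rewrite scalerA.
rewrite -scaler_suml; have /rowP/(_ l) := wA; rewrite !mxE => wl.
by rewrite (eq_bigr (fun i => w 0 i * A i l)) ?wl ?scale0r // => i _; rewrite mxE.
Qed.

(** This predicate plays the role of the dimension of a subspace. *)
Definition has_onb M k := exists e : 'I_k -> H,
  [/\ orthonormal e, forall i, M (e i) & forall x, M x -> x = proj e x].

Lemma proj_sub M k (e : 'I_k -> H) x : lin_sub M -> (forall i, M (e i)) -> M (proj e x).
Proof. by move=> hM Me; apply: lin_sub_sum => // i; exact: lin_subZ. Qed.

Lemma orthonormal_ext M k (e : 'I_k -> H) x : lin_sub M -> orthonormal e ->
  (forall i, M (e i)) -> M x -> x <> proj e x ->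
  exists2 e' : 'I_k.+1 -> H, orthonormal e' & forall i, M (e' i).
Proof.
move=> hM one Me Mx /eqP xe.
pose y := x - proj e x.
have My : M y by apply: lin_subB => //; exact: proj_sub.
have y0 : 0 < hnorm y.
  rewrite lt_neqAle eq_sym hnorm_ge0 andbT; apply/eqP => /hnorm_eq0 /eqP.
  by rewrite subr_eq0 (negPf xe).
pose z := (hnorm y)^-1%:C *: y.
have zz : inner z z = 1.
  rewrite inner_selfE ripZl ripZr -hnorm_sq.
  by rewrite (_ : _ * _ = 1) //; field; rewrite gt_eqF.
have ze j : inner z (e j) = 0 by rewrite innerZl inner_proj ?mulr0.
exists (fun i => if unlift ord0 i is Some j then e j else z); last first.
  by move=> i; case: unlift => // ; exact: lin_subZ.
move=> i j; case: (unliftP ord0 i) => [i'|] ->; case: (unliftP ord0 j) => [j'|] ->.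
- by rewrite one (inj_eq lift_inj).
- by rewrite inner_sym ze rmorph0.
- by rewrite ze.
- by rewrite zz eqxx.
Qed.

Lemma onb_exists M : finite_dim H -> lin_sub M -> exists k, has_onb M k.
Proof.
move=> [n [f spanf]] hM.
pose P k := `[< exists2 e : 'I_k -> H, orthonormal e & forall i, M (e i) >].
have P0 : P 0%N by apply/asboolP; exists (fun=> 0) => [[]|[]].
have Pn k : P k -> (k <= n)%N.
  by move=> /asboolP[e one _]; apply: (orthonormal_le (f := f) one) => i; exact: spanf.
have [k /asboolP[e one Me] kmax] := ex_maxnP (ex_intro P 0%N P0) Pn.
exists k, e; split=> // x Mx; apply: contrapT => xe.
have [e' one' Me'] := orthonormal_ext hM one Me Mx xe.
have /kmax : P k.+1 by apply/asboolP; exists e'.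
by rewrite ltnn.
Qed.

Lemma onb_lt M N k l : lin_sub M -> lin_sub N -> has_onb M k -> has_onb N l ->
  M `<=` N -> M <> N -> (k < l)%N.
Proof.
move=> hM hN [e [one Me eM]] [f [onf Nf fN]] MN neMN.
have [x Nx Mx] : exists2 x, N x & ~ M x.
  apply: contrapT => h; apply: neMN; apply/seteqP; split=> // x Nx.
  by apply: contrapT => Mx; apply: h; exists x.
have [|e' one' Ne'] := orthonormal_ext hN one (fun i => MN _ (Me i)) Nx.
  by move=> xE; apply: Mx; rewrite xE; exact: proj_sub.
by apply: (orthonormal_le (f := f) one') => i; exists (fun j => inner (e' i) (f j)); exact: fN.
Qed.

Lemma onb_le M k n : has_onb M k -> has_onb [set: H] n -> (k <= n)%N.
Proof.
move=> [e [one _ _]] [f [_ _ fN]].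
by apply: (orthonormal_le (f := f) one) => i; exists (fun j => inner (e i) (f j)); exact: fN.
Qed.

Lemma proj_linear k (e : 'I_k -> H) : linear (proj e).
Proof.
move=> a x y; rewrite /proj scaler_sumr -big_split /=; apply: eq_bigr => i _.
by rewrite inner_linear scalerDl scalerA.
Qed.

Lemma hnorm_proj_le k (e : 'I_k -> H) x : orthonormal e -> hnorm (proj e x) <= hnorm x.
Proof.
move=> one; rewrite -(@ler_pXn2r _ 2) ?nnegrE ?hnorm_ge0 // !hnorm_sq.
have o : inner (x - proj e x) (proj e x) = 0.
  rewrite inner_sym inner_suml big1 ?rmorph0 // => i _.
  by rewrite innerZl [X in _ * X]inner_sym inner_proj // rmorph0 mulr0.
have o' : rip x (proj e x) = rip (proj e x) (proj e x).
  by apply/eqP; rewrite -subr_eq0 -ripBl /rip o.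
have := rip_ge0 (x - proj e x); rewrite ripBl !ripBr o' (rip_sym x) o'.
by rewrite subrr subr0 subr_ge0.
Qed.

(** A subspace is the fixed set of the contraction [proj e]. *)
Lemma fd_closed M : finite_dim H -> lin_sub M -> closed_subspace M.
Proof.
move=> fd hM; have [k [e [one Me eM]]] := onb_exists fd hM.
have [M0 MD] := hM; split=> // x clx.
suff -> : x = proj e x by exact: proj_sub.
apply/eqP; rewrite -subr_eq0; apply/eqP/hnorm_small => d d0.
have d2 : 0 < d / 2 by rewrite divr_gt0.
have : nbhs x (ball x (d / 2)%:C) by apply: nbhsx_ballx; rewrite ltcR.
move=> /clx[y [My]]; rewrite -ball_normE /= hnormE ltcR => /ltW xy.
have -> : x - proj e x = (x - y) - proj e (x - y).
  rewrite (linB (proj_linear e)) -(eM y My) opprB addrA subrK.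
  by [].
rewrite (le_trans (hnormD _ _)) // hnormN.
by have := hnorm_proj_le (x - y) one; move: xy; lra.
Qed.

(** A left eigenvector of the matrix of [G] in an orthonormal basis gives the
    coordinates of the eigenvector. *)
Lemma eigenvector_exists M k (G : H -> H) : linear G -> lin_sub M -> has_onb M k ->
  (0 < k)%N -> (forall x, M x -> M (G x)) ->
  exists (a : R[i]) (v : H), [/\ M v, v <> 0 & G v = a *: v].
Proof.
move=> lG hM [e [one Me eM]] k0 GM.
pose g : 'M[R[i]]_k := \matrix_(i, j) inner (G (e i)) (e j).
have [a /eigenvalueP[c cg c0]] := eigenvalue_closed g k0.
exists a, (\sum_i c 0 i *: e i); split.
- by apply: lin_sub_sum => // i; exact: lin_subZ.
- move=> v0; move/eqP: c0; apply; apply/rowP => j.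
  by rewrite mxE -(inner_comb (c 0) j one) v0 inner0l.
rewrite (lin_sum lG) scaler_sumr.
under eq_bigr => i _ do rewrite (linZ lG) (eM _ (GM _ (Me i))) scaler_sumr.
rewrite exchange_big; apply: eq_bigr => j _ /=.
have /rowP/(_ j) := cg; rewrite !mxE => cgj.
rewrite scalerA -cgj scaler_suml; apply: eq_bigr => i _.
by rewrite mxE scalerA.
Qed.

End Orthonormal.

Section Burnside.
Context (R : realType) (L : hilbertType R).
Hypothesis fdL : finite_dim L.
Variable A : set (L -> L).
Hypotheses (A_linear : forall T, A T -> linear T)
  (A_comb : forall (a : R[i]) S T, A S -> A T -> A (a *: S + T))
  (A_mul : forall S T, A S -> A T -> A (S \o T))
  (A_star : forall T, A T -> exists2 S, A S & adjoint_of T S)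
  (A_trans : forall x y, x <> 0 -> exists2 T, A T & T x = y).

Lemma lin_sub_ker (T : L -> L) : linear T -> lin_sub [set x | T x = 0].
Proof.
by move=> lT; split=> /= [|a x y Tx Ty]; rewrite ?(lin0 lT) // lT Tx Ty scaler0 addr0.
Qed.

(** An element whose kernel is as large as possible satisfies [T B T = a T] for
    every [B]: otherwise subtracting an eigenvalue enlarges the kernel. *)
Lemma max_kernel_element : (exists x : L, x <> 0) ->
  exists T, [/\ A T, T <> 0 & forall B, A B -> exists a : R[i], forall x, T (B (T x)) = a *: T x].
Proof.
move=> [x0 x00]; have [n onbL] := onb_exists (M := [set: L]) fdL (conj I (fun _ _ _ _ _ => I)).
pose P k := `[< exists T, [/\ A T, T <> 0 & has_onb [set x | T x = 0] k] >].
have exP : exists k, P k.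
  have [T AT Tx0] := A_trans x0 x00.
  have [k hk] := onb_exists fdL (lin_sub_ker (A_linear AT)).
  by exists k; apply/asboolP; exists T; split=> // T0; move: Tx0; rewrite T0 => /esym.
have Pn k : P k -> (k <= n)%N by move=> /asboolP[T [_ _ hk]]; exact: onb_le hk onbL.
have [k /asboolP[T [AT T0 hk]] kmax] := ex_maxnP exP Pn.
exists T; split=> // B AB.
have lT := A_linear AT; have lB := A_linear AB.
pose N := [set y | exists x, y = T x].
have hN : lin_sub N.
  split=> [|a _ _ [x ->] [y ->]]; first by exists 0; rewrite (lin0 lT).
  by exists (a *: x + y); rewrite lT.
have [m onbN] := onb_exists fdL hN.
have m0 : (0 < m)%N.
  rewrite lt0n; apply/eqP => m0; move: onbN; rewrite m0 => -[e [_ _ eN]].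
  apply: T0; apply/funext => x; rewrite (eN (T x)); last by exists x.
  by rewrite /proj big_ord0.
have lTB : linear (T \o B) by move=> a x y /=; rewrite lB lT.
have [a [_ [[w ->] Tw0 TBw]]] := eigenvector_exists lTB hN onbN m0
  (fun x _ => ex_intro _ (B x) erefl).
(* [C] kills the kernel of [T] and also [w], which [T] does not kill. *)
exists a; pose C := (- a) *: T + (T \o (B \o T)).
have AC : A C by exact: (A_comb (- a) AT (A_mul AT (A_mul AB AT))).
have CE x : C x = T (B (T x)) - a *: T x by rewrite addrC -scaleNr.
suff C0 : C = 0 by move=> x; apply/eqP; rewrite -subr_eq0 -CE C0.
apply: contrapT => C0; have lC := A_linear AC.
have [l hl] := onb_exists fdL (lin_sub_ker lC).
have := kmax l; rewrite leqNgt (onb_lt _ _ hk hl) //.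
- by move=> /(_ _)/negP; apply => //; apply/asboolP; exists C.
- exact: lin_sub_ker.
- exact: lin_sub_ker.
- by move=> x /= Tx; rewrite CE Tx (lin0 lB) (lin0 lT) scaler0 subrr.
move=> /seteqP[_ /(_ w)] /=; rewrite CE -[T (B (T w))]/((T \o B) (T w)) TBw subrr.
by move=> /(_ erefl).
Qed.

Definition rank1 (xi eta : L) : L -> L := fun x => inner x eta *: xi.

(** If [T] is as in [max_kernel_element], [T w <> 0] and [B (T w) = x], then
    [T x = T (B (T w)) = a T w]: so [T] has rank one.  Transitivity moves its
    range and its kernel to any prescribed ones. *)
Lemma rank1_mem xi eta : (exists x : L, x <> 0) -> A (rank1 xi eta).
Proof.
move=> ex0.
have [T [AT T0 TBT]] := max_kernel_element ex0.
have lT := A_linear AT.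
have [w Tw] : exists w, T w <> 0.
  by apply: contrapT => /forallNP h; apply: T0; apply/funext => x; apply: contrapT; exact: h.
set t := T w in Tw.
have Tt x : exists a : R[i], T x = a *: t.
  by have [B AB <-] := A_trans x Tw; have [a aE] := TBT B AB; exists a; exact: aE.
have [S AS adjS] := A_star AT.
have tt0 : inner t t != 0 by apply/eqP => /inner_eq0.
have TE x : inner t t *: T x = inner x (S t) *: t.
  by rewrite -adjS; have [a ->] := Tt x; rewrite innerZl scalerA mulrC.
have St0 : S t <> 0.
  move=> St; apply: Tw; have := TE w; rewrite St inner0r scale0r => /eqP.
  by rewrite scaler_eq0 (negPf tt0) => /eqP.
have [C AC Ct] := A_trans (inner t t *: xi) Tw.
have [D AD DS] := A_trans eta St0.
have [D' AD' adjD] := A_star AD.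
suff -> : rank1 xi eta = C \o (T \o D') by exact: (A_mul AC (A_mul AT AD')).
apply/funext => x; apply: (scalerI tt0); rewrite /rank1 /= -(linZ (A_linear AC)) TE.
rewrite (linZ (A_linear AC)) Ct !scalerA (adjoint_sym adjD) DS.
by rewrite mulrC.
Qed.

Lemma burnside T : (exists x : L, x <> 0) -> linear T -> A T.
Proof.
have lsT : lin_sub [set: L] by [].
move=> ex0 lT; have [n [e [one _ eL]]] := onb_exists fdL lsT.
have -> : T = \sum_i rank1 (T (e i)) (e i).
  apply/funext => x; rewrite sum_funE {1}(eL x I) (lin_sum lT).
  by apply: eq_bigr => i _; rewrite (linZ lT).
have A0 : A 0.
  have -> : (0 : L -> L) = rank1 0 0; last exact: rank1_mem.
  by apply/funext => x; rewrite /rank1 scaler0.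
elim/big_rec : _ => // i S _ AS.
by rewrite -[rank1 _ _]scale1r; apply: A_comb => //; exact: rank1_mem.
Qed.

End Burnside.
(** * Subrepresentations and irreducibility *)

Section Subrepresentation.
Context (R : realType) (H K : hilbertType R) (E : set (H -> H)).
Variable (p : (H -> H) -> (K -> K)).

Lemma isometry_hnorm (S : hilbertType R) (v : S -> K) :
  (forall x y, inner (v x) (v y) = inner x y) -> forall x, hnorm (v x) = hnorm x.
Proof.
move=> iv x; apply/eqP; rewrite -(@eqrXn2 _ 2) ?hnorm_ge0 // !hnorm_sq.
by rewrite /rip iv.
Qed.

Lemma isometry_inj (S : hilbertType R) (v : S -> K) : linear v ->
  (forall x y, inner (v x) (v y) = inner x y) -> injective v.
Proof.
move=> lv iv x y xy; apply/eqP; rewrite -subr_eq0; apply/eqP/hnorm_eq0.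
by rewrite -(isometry_hnorm iv) (linB lv) xy subrr hnorm0.
Qed.

Definition is_subrep (M : set K) (S : hilbertType R) (v : S -> K)
    (s : (H -> H) -> (S -> S)) :=
  [/\ linear v, forall x y, inner (v x) (v y) = inner x y, range v = M &
      forall T, E T -> forall y, v (s T y) = p T (v y)].

Lemma subrep_exists (M : set K) : closed_subspace M ->
  (forall T x, E T -> M x -> M (p T x)) ->
  exists (S : hilbertType R) (v : S -> K) (s : (H -> H) -> (S -> S)), is_subrep M v s.
Proof.
move=> hM invM; have [S [v [lv iv rv]]] := closed_subspace_hilbert hM.
have ex T x : exists y, E T -> v y = p T (v x).
  have [ET|nE] := pselect (E T); last by exists 0.
  have : range v (p T (v x)) by rewrite rv; apply: invM => //; rewrite -rv; exists x.
  by case=> y _ <-; exists y.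
exists S, v, (fun T x => projT1 (cid (ex T x))); split=> // T ET y.
exact: (projT2 (cid (ex T y)) ET).
Qed.

Hypothesis hE : unital_cstar_algebra E.
Hypothesis rp : star_rep E p.

Let hp : star_hom E p. Proof. by case: rp. Qed.
Let lp : linear_on E p. Proof. by case: hp. Qed.
Let bp : p @` E `<=` @bounded_op R K. Proof. by case: rp. Qed.

Lemma subrep_star_rep M (S : hilbertType R) (v : S -> K) s : is_subrep M v s -> star_rep E s.
Proof.
move=> [lv iv rv vs]; have injv := isometry_inj lv iv.
split; first split.
- move=> a T T' ET ET'; apply/funext => y; apply: injv.
  rewrite vs; last exact: (cstar_comb hE).
  by rewrite lp //= lv !vs.
- move=> T T' ET ET'; apply/funext => y; apply: injv.
  rewrite (vs _ (cstarM hE ET ET')) (rep_mul hp ET ET') /=.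
  by rewrite (vs _ ET) (vs _ ET').
- move=> T T' ET ET' adj x y; rewrite -iv -[RHS]iv (vs _ ET) (vs _ ET').
  by case: hp => _ _ h; apply: h.
move=> _ [T ET <-]; have [lpT [C bC]] := bp (ex_intro2 _ _ T ET erefl).
split; first by move=> a x y; apply: injv; rewrite vs // !lv lpT !vs.
by exists C => x; rewrite -!(isometry_hnorm iv) vs.
Qed.

Lemma onb_finite_dim M k (S : hilbertType R) (v : S -> K) : has_onb M k -> linear v ->
  (forall x y, inner (v x) (v y) = inner x y) -> range v = M -> finite_dim S.
Proof.
move=> [e [one Me eM]] lv iv rv.
have /choice[f fE] i : exists y, v y = e i.
  by have := Me i; rewrite -rv => -[y _ <-]; exists y.
exists k, f => x; exists (fun i => inner (v x) (e i)).
apply: (isometry_inj lv iv); rewrite (lin_sum lv).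
rewrite {1}(eM (v x)); last by rewrite -rv; exists x.
by apply: eq_bigr => i _; rewrite (linZ lv) fE.
Qed.

Definition invariant (M : set K) := forall T x, E T -> M x -> M (p T x).

(** Among the invariant subspaces on which [p T0] is nonzero, one of least
    dimension is irreducible: for an invariant [N1] inside it, [p T0] is nonzero
    on [N1] or on the orthogonal complement [N2] of [N1], which is again
    invariant. *)
Lemma irreducible_subrep T0 : finite_dim K -> E T0 -> p T0 <> 0 ->
  exists (S : hilbertType R) (s : (H -> H) -> (S -> S)),
    [/\ irreducible_rep E s, finite_dim S & s T0 <> 0].
Proof.
move=> fd ET0 pT0.
pose good M := [/\ lin_sub M, invariant M & exists2 x, M x & p T0 x <> 0].
pose P k := `[< exists2 M, good M & has_onb M k >].
have exP : exists k, P k.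
  have hT : lin_sub [set: K] by [].
  have [k hk] := onb_exists fd hT; exists k; apply/asboolP; exists setT => //; split=> //.
  apply: contrapT => h; apply: pT0; apply/funext => x; apply: contrapT => hx.
  by apply: h; exists x.
have [k /asboolP[M gM hk] kmin] := ex_minnP exP.
have minM N : good N -> N `<=` M -> N = M.
  move=> gN NM; apply: contrapT => neNM; have [lN _ _] := gN; have [lM _ _] := gM.
  have [l hl] := onb_exists fd lN.
  have := kmin l; rewrite leqNgt (onb_lt lN lM hl hk NM neNM) => /(_ _)/negP; apply=> //.
  by apply/asboolP; exists N.
have [lM iM [x0 Mx0 px0]] := gM.
have [S [v [s vs]]] := subrep_exists (fd_closed fd lM) iM.
have [lv iv rv vsE] := vs; have injv := isometry_inj lv iv.
have sT0 : s T0 <> 0.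
  move: Mx0 px0; rewrite -rv => -[y _ <-]; rewrite -vsE // => h s0.
  by apply: h; rewrite s0 (lin0 lv).
exists S, s; split=> //; last exact: onb_finite_dim hk lv iv rv.
split; [exact: subrep_star_rep vs|by exists T0|].
move=> M1 [M10 M1D _] iM1.
pose N1 := [set x | exists2 y, M1 y & v y = x].
have lN1 : lin_sub N1.
  split; first by exists 0; rewrite ?(lin0 lv).
  move=> a _ _ [x Mx <-] [y My <-]; exists (a *: x + y); first exact: M1D.
  by rewrite lv.
have iN1 : invariant N1.
  by move=> T _ ET [x Mx <-]; exists (s T x); [exact: iM1|rewrite vsE].
have N1M : N1 `<=` M by move=> _ [x _ <-]; rewrite -rv; exists x.
have [[x N1x px]|h] := pselect (exists2 x, N1 x & p T0 x <> 0).
  right; have N1E : N1 = M by apply: minM => //; split=> //; exists x.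
  apply/seteqP; split=> // y _; have : N1 (v y) by rewrite N1E -rv; exists y.
  by case=> z Mz /injv <-.
left; pose N2 := [set x | M x /\ forall y, N1 y -> inner x y = 0].
have lN2 : lin_sub N2.
  split; first by split=> [|y _]; [case: lM|rewrite inner0l].
  move=> a x y [Mx ox] [My oy]; split; first by apply: (lM.2).
  by move=> z Nz; rewrite inner_linear ox // oy // mulr0 addr0.
have iN2 : invariant N2.
  move=> T x ET [Mx ox]; split; first exact: iM.
  move=> y Ny; case: hp => _ _ hadj.
  rewrite (hadj _ _ _ ET (starP hE ET)); last exact: (cstar_star hE).
  by apply: ox; apply: iN1 => //; exact: (cstar_star hE).
have [l [e [one N1e eN1]]] := onb_exists fd lN1.
have N2x : N2 (x0 - proj e x0).
  split; first by apply: (lin_subB lM) => //; apply/N1M; exact: proj_sub.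
  move=> y /eN1 ->; rewrite inner_sym inner_suml big1 ?rmorph0 // => i _.
  by rewrite innerZl [X in _ * X]inner_sym inner_proj // rmorph0 mulr0.
have N2E : N2 = M.
  apply: minM; last by move=> x [].
  split=> //; exists (x0 - proj e x0) => //.
  rewrite (linB (rep_linear bp ET0)) => px.
  have : N1 (proj e x0) by exact: proj_sub.
  move=> N1p; apply: h; exists (proj e x0) => // p0; apply: px0.
  by move: px; rewrite p0 subr0.
apply/seteqP; split=> [x M1x|_ ->] //=.
have N1x : N1 (v x) by exists x.
have : N2 (v x) by rewrite N2E; exact: N1M.
case=> _ /(_ _ N1x) /inner_eq0 vx0; apply: injv.
by rewrite vx0 (lin0 lv).
Qed.

End Subrepresentation.

Section Irreducible.
Context (R : realType) (H L : hilbertType R) (E : set (H -> H)).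
Variable (p : (H -> H) -> (L -> L)).
Hypothesis hE : unital_cstar_algebra E.
Hypotheses (ip : irreducible_rep E p) (fd : finite_dim L).

Let rp : star_rep E p. Proof. by case: ip. Qed.
Let hp : star_hom E p. Proof. by case: rp. Qed.
Let lp : linear_on E p. Proof. by case: hp. Qed.
Let bp : p @` E `<=` @bounded_op R L. Proof. by case: rp. Qed.

Lemma irreducible_sub M : lin_sub M -> invariant E p M -> M = [set 0] \/ M = setT.
Proof. by move=> lM iM; case: ip => _ _ h; apply: h => //; exact: fd_closed. Qed.

Lemma irreducible_nonzero : exists x : L, x <> 0.
Proof.
case: ip => _ [T ET pT] _; apply: contrapT => h; apply: pT.
apply/funext => x; apply: contrapT => h'; apply: h; by exists (p T x).
Qed.

(** The fixed space of the projection [p 1] is invariant and contains the range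
    of every [p T]. *)
Lemma irreducible_unit : p idfun = idfun.
Proof.
have E1 := cstar1 hE; have lp1 := rep_linear bp E1.
have pp T x : E T -> p idfun (p T x) = p T x.
  by move=> ET; rewrite -[LHS]/((p idfun \o p T) x) -(rep_mul hp).
pose M := [set x | p idfun x = x].
have [||M0|MT] := @irreducible_sub M.
- split=> [|a x y xE yE]; first exact: (lin0 lp1).
  by apply: etrans (lp1 a x y) _; congr (_ *: _ + _).
- by move=> T x ET _; exact: pp.
- case: ip => _ [T ET pT] _; exfalso; apply: pT; apply/funext => x.
  by have : M (p T x) by [exact: pp]; rewrite M0.
by apply/funext => x; have : M x by rewrite MT.
Qed.

(** Burnside's theorem for the image of an ideal [J].  The image acts
    transitively because the orbit of [x] under [J] and the common kernel of [J]
    are invariant under [E]. *)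
Lemma irreducible_ideal_onto (J : set (H -> H)) : J `<=` E ->
  (forall (a : R[i]) S T, J S -> J T -> J (a *: S + T)) ->
  (forall S T, J S -> E T -> J (S \o T)) ->
  (forall S T, E S -> J T -> J (S \o T)) ->
  (forall T, J T -> J (star T)) ->
  (exists2 T, J T & p T <> 0) ->
  forall T : L -> L, linear T -> exists2 S, J S & p S = T.
Proof.
move=> JE Jc JMr JMl Js [T0 JT0 pT0] T lT.
have J0 : J 0.
  by have -> : 0 = (-1) *: T0 + T0; [rewrite scaleN1r addNr|exact: Jc].
pose A := [set S | exists2 T, J T & p T = S].
have lpE S : J S -> linear (p S) by move=> /JE; exact: (rep_linear bp).
suff : A T by [].
apply: (burnside fd); last exact: lT.
- by move=> _ [S JS <-]; exact: lpE.
- move=> a _ _ [S JS <-] [S' JS' <-]; exists (a *: S + S'); first exact: Jc.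
  by apply: lp; exact: JE.
- move=> _ _ [S JS <-] [S' JS' <-]; exists (S \o S'); first by apply: JMr => //; exact: JE.
  by rewrite (rep_mul hp) //; exact: JE.
- move=> _ [S JS <-]; exists (p (star S)); first by exists (star S) => //; exact: Js.
  case: hp => _ _ h; apply: h; [exact: (JE _ (Js _ JS))|exact: JE|exact: (starP hE (JE _ JS))].
- move=> x y x0.
  pose M := [set z | exists2 S, J S & p S x = z].
  suff MT : M = setT by have [S JS Sx] : M y by [rewrite MT]; exists (p S) => //; exists S.
  have [||M0|//] := @irreducible_sub M.
  - split; first by exists 0; rewrite // (linear_on0 hE lp).
    move=> a _ _ [S JS <-] [S' JS' <-]; exists (a *: S + S'); first exact: Jc.
    by rewrite lp //; exact: JE.
  - move=> S _ ES [S' JS' <-]; exists (S \o S'); first exact: JMl.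
    by rewrite (rep_mul hp) //; exact: JE.
  exfalso; pose N := [set z | forall S, J S -> p S z = 0].
  have [||N0|NT] := @irreducible_sub N.
  - split=> [S JS|a u w uN wN S JS]; first by rewrite (lin0 (lpE _ JS)).
    by rewrite lpE // uN // wN // scaler0 addr0.
  - move=> S z ES zN S' JS'; rewrite -[LHS]/((p S' \o p S) z) -(rep_mul hp) //; last exact: JE.
    by apply: zN; exact: JMr.
  - apply: x0; have : N x by move=> S JS; have : M (p S x) by [exists S]; rewrite M0.
    by rewrite N0.
  apply: pT0; apply/funext => z; have : N z by rewrite NT.
  exact.
- exact: irreducible_nonzero.
Qed.

End Irreducible.
(** * Unital completely positive maps *)

Section UCP.
Context (R : realType) (H L : hilbertType R) (E : set (H -> H)).
Variable (f : (H -> H) -> (L -> L)).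
Hypothesis hE : unital_cstar_algebra E.
Hypothesis uf : ucp E f.

Let lf : linear_on E f. Proof. by case: uf. Qed.
Let bf : f @` E `<=` @bounded_op R L. Proof. by case: uf. Qed.
Let f1 : f idfun = idfun. Proof. by case: uf. Qed.

Lemma rip_i (K : hilbertType R) (x y : K) : rip x ('i *: y) = - rip ('i *: x) y.
Proof.
rewrite /rip innerZl innerZr; case: (inner x y) => a b /=.
by ring.
Qed.

Lemma Re_sum (n : nat) (F : 'I_n -> R[i]) :
  complex.Re (\sum_i F i) = \sum_i complex.Re (F i).
Proof. by elim/big_rec2 : _ => // i a b _ <-; case: (F i) => ? ?; case: b. Qed.

Lemma Im_sum (n : nat) (F : 'I_n -> R[i]) :
  complex.Im (\sum_i F i) = \sum_i complex.Im (F i).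
Proof. by elim/big_rec2 : _ => // i a b _ <-; case: (F i) => ? ?; case: b. Qed.

(** The quadratic form of a self-adjoint operator is real. *)
Lemma psd_mx_positive (K : hilbertType R) n (T : 'M[K -> K]_n) :
  lin_mx T -> sa T -> psd T -> mx_positive T.
Proof.
move=> lT saT pT h; rewrite lecE Re_sum Im_sum /=.
under eq_bigr do rewrite Im_inner.
apply/andP; split; last exact: pT h.
rewrite -/(vip (mx_apply T h) ('i *: h)).
have e : vip (mx_apply T h) ('i *: h) = - vip (mx_apply T h) ('i *: h).
  rewrite {1}saT (linZ (mx_apply_lin lT)) vip_sym /vip -sumrN.
  by apply: eq_bigr => i _; rewrite rip_i opprK.
by apply/eqP; move: e; lra.
Qed.

Lemma mx_positive_psd (K : hilbertType R) n (T : 'M[K -> K]_n) :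
  mx_positive T -> psd T.
Proof. by move=> pT h; have := pT h; rewrite lecE Re_sum => /andP[_]. Qed.

Lemma ucp_psd n (T : 'M[H -> H]_n) : mx_over E T -> sa T -> psd T -> psd (map_mx f T).
Proof.
move=> ET saT pT; apply: mx_positive_psd; case: uf => _ _ _; apply => //.
by apply: psd_mx_positive => //; exact: (mx_cstar_lin hE).
Qed.

Lemma ucp_pos T : E T -> star T = T -> pos T -> pos (f T).
Proof.
move=> ET sT /psd_const pT; apply/psd_const; rewrite -map_const_mx1.
exact: (ucp_psd (over_const ET) (sa_const hE ET sT) pT).
Qed.

(** The matrix [y_i^* y_j] is positive: this is complete positivity in the form
    of Stinespring's semi-inner product. *)
Lemma ucp_gram n (y : 'I_n -> H -> H) (h : 'I_n -> L) : (forall i, E (y i)) ->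
  0 <= \sum_i \sum_j inner (f (star (y i) \o y j) (h j)) (h i).
Proof.
move=> Ey; case: uf => _ _ _ cp.
have := cp n (\matrix_(i, j) (star (y i) \o y j)) _ _ h.
rewrite /mx_apply; under [X in _ -> _ -> is_true (_ <= X)]eq_bigr do rewrite inner_suml.
under [X in _ -> _ -> is_true (_ <= X)]eq_bigr do under eq_bigr do rewrite !mxE.
apply => [i j|g]; first by rewrite mxE; apply: (cstarM hE) => //; exact: (cstar_star hE).
rewrite /mx_apply; under eq_bigr do rewrite inner_suml.
have -> : \sum_i \sum_j inner ((\matrix_(i, j) (star (y i) \o y j)) i j (g j)) (g i) =
    inner (\sum_j y j (g j)) (\sum_i y i (g i)).
  rewrite inner_suml exchange_big /=; apply: eq_bigr => j _.
  rewrite inner_sym inner_suml rmorph_sum; apply: eq_bigr => i _ /=.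
  by rewrite mxE /= (adjoint_sym (starP hE (Ey i))) -inner_sym.
by rewrite inner_selfE ler0c rip_ge0.
Qed.

(** The Gram form at [(1, T)] is real for all vectors [g], [h]; replacing [h] by
    ['i h] gives the two components of the adjoint relation. *)
Lemma ucp_adj T : E T -> adjoint_of (f T) (f (star T)).
Proof.
move=> ET x y; have ES := cstar_star hE ET; have E1 := cstar1 hE.
have EST := cstarM hE ES ET.
have im (g h : L) : complex.Im (inner (f T h) g) + complex.Im (inner (f (star T) g) h) = 0.
  have := @ucp_gram 1 (fun=> T) (fun=> h) (fun=> ET).
  rewrite !big_ord1 lecE => /andP[/eqP/= r0 _].
  have := @ucp_gram 2 (fun i => if i == ord0 then idfun else T)
    (fun i => if i == ord0 then g else h) _.
  rewrite !big_ord_recl !big_ord0 !addr0 /= => /(_ _); rewrite star1.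
  have -> : idfun \o @idfun H = idfun by [].
  have -> : idfun \o T = T by [].
  have -> : star T \o idfun = star T by [].
  rewrite f1 lecE => /(_ _)/andP[|/eqP/= ri _]; first by move=> i; case: ifP.
  move: ri; rewrite inner_selfE; move: r0.
  case: (inner (f T h) g) => a b; case: (inner (f (star T) g) h) => a' b'.
  case: (inner (f (star T \o T) h) h) => a'' b'' /= -> <-.
  by rewrite !add0r addr0.
have := im y x; have := im y ('i *: x); rewrite (linZ (rep_linear bf ET)) innerZl innerZr.
have -> : inner x (f (star T) y) = (inner (f (star T) y) x)^* by rewrite inner_sym.
case: (inner (f T x) y) => a b; case: (inner (f (star T) y) x) => a' b' /=.
rewrite !mul0r !mul1r !add0r mulN1r => aa bb.
apply/eqP; rewrite eq_complex /=; apply/andP; split; apply/eqP.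
  by apply/eqP; rewrite -subr_eq0; apply/eqP.
by apply/eqP; rewrite -addr_eq0; apply/eqP.
Qed.

Lemma ucp_star T : E T -> star (f T) = f (star T).
Proof. by move=> ET; apply: starE; exact: ucp_adj. Qed.

Lemma ucp_rip T x y : E T -> rip (f T x) y = rip x (f (star T) y).
Proof. by move=> ET; apply: adjoint_rip; exact: ucp_adj. Qed.

(** The Kadison-Schwarz inequality for a row: the Gram form of [(1, y)] at the
    vectors [- sum f(y_j) h_j] and [h_j]. *)
Lemma ucp_schwarz n (y : 'I_n -> H -> H) (h : 'I_n -> L) : (forall i, E (y i)) ->
  rip (\sum_j f (y j) (h j)) (\sum_j f (y j) (h j)) <=
  \sum_i \sum_j rip (f (star (y i) \o y j) (h j)) (h i).
Proof.
move=> Ey; set v := \sum_j f (y j) (h j).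
pose y' (i : 'I_n.+1) := if unlift ord0 i is Some j then y j else idfun.
pose h' (i : 'I_n.+1) := if unlift ord0 i is Some j then h j else - v.
have Ey' i : E (y' i) by rewrite /y'; case: unlift => //; exact: (cstar1 hE).
have y0 : y' ord0 = idfun by rewrite /y' unlift_none.
have h0 : h' ord0 = - v by rewrite /h' unlift_none.
have yl j : y' (lift ord0 j) = y j by rewrite /y' liftK.
have hl j : h' (lift ord0 j) = h j by rewrite /h' liftK.
have := ucp_gram h' Ey'; rewrite lecE => /andP[_].
rewrite Re_sum big_ord_recl Re_sum big_ord_recl y0 h0 star1.
under [X in _ + X + _]eq_bigr do rewrite yl hl.
under [X in _ + X]eq_bigr do rewrite Re_sum big_ord_recl yl hl y0 h0.
rewrite big_split /=.
under [X in _ + (_ + X)]eq_bigr do under eq_bigr do rewrite yl hl.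
have -> : idfun \o @idfun H = idfun by [].
rewrite f1 -[complex.Re _]/(rip (- v) (- v)) ripNl ripNr opprK.
have -> : \sum_(i < n) complex.Re (inner (f (idfun \o y i) (h i)) (- v)) = - rip v v.
  by rewrite -ripNr {2}/v rip_suml.
have -> : \sum_(i < n) complex.Re (inner (f (star (y i) \o idfun) (- v)) (h i)) = - rip v v.
  rewrite -ripNl {3}/v rip_sumr; apply: eq_bigr => i _.
  rewrite -/(rip _ _) ucp_rip ?(starK hE) //; exact: (cstar_star hE).
rewrite subrr add0r addrC subr_ge0.
exact.
Qed.

Lemma ucp_mx_schwarz n (T : 'M[H -> H]_n) h : mx_over E T ->
  vip (mx_apply (map_mx f T) h) (mx_apply (map_mx f T) h) <=
  vip (mx_apply (map_mx f (mxc (mxstar T) T)) h) h.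
Proof.
move=> ET; apply: (@le_trans _ _
   (\sum_r \sum_i \sum_j rip (f (star (T r i) \o T r j) (h j)) (h i))).
  apply: ler_sum => r _; rewrite /mx_apply.
  under [X in rip X]eq_bigr do rewrite mxE.
  under [X in rip _ X]eq_bigr do rewrite mxE.
  by apply: ucp_schwarz => i; exact: ET.
rewrite le_eqVlt; apply/orP; left; apply/eqP.
rewrite exchange_big /=; apply: eq_bigr => i _.
rewrite exchange_big /= /mx_apply rip_suml; apply: eq_bigr => j _.
rewrite !mxE (linear_on_sum hE lf).
  rewrite sum_funE rip_suml; apply: eq_bigr => r _.
  by rewrite mxE.
by move=> r; rewrite mxE; apply: (cstarM hE) => //; exact: (cstar_star hE).
Qed.

(** Cauchy-Schwarz for the form [<f(b^* a) x, w> - <f(a) x, f(b) w>], with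
    [b = y^*]: it is positive by [ucp_schwarz], and its value at [(b, w)] is at
    most [c^2 |w|^2]. *)
Lemma ucp_mult_defect a y (c : R) x : E a -> E y -> 0 < c ->
  (forall v, hnorm (star y v) <= c * hnorm v) ->
  hnorm (f (y \o a) x - f y (f a x)) ^+ 2 <=
  c ^+ 2 * (rip (f (star a \o a) x) x - hnorm (f a x) ^+ 2).
Proof.
move=> Ea Ey c0 by_; set m := f (y \o a) x - f y (f a x).
have Eb := cstar_star hE Ey; set b := star y in Eb by_.
have bb : star b = y by rewrite /b (starK hE).
(* The minimiser of [2 <m, w> + c^2 |w|^2]. *)
pose w := (- (c ^- 2))%:C *: m.
have bw : rip (f (y \o b) w) w <= c ^+ 2 * rip w w.
  have [_ sX pX] := sq_defect_pos hE Eb (ltW c0) by_; rewrite bb in sX pX.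
  have Eyb := cstarM hE Ey Eb; have Ec1 := cstarZ hE (c ^+ 2)%:C (cstar1 hE).
  have := ucp_pos (cstarB hE Ec1 Eyb) sX pX w.
  rewrite (linear_onB hE lf Ec1 Eyb) (linear_onZ hE lf _ (cstar1 hE)).
  by rewrite f1 ripBl ripZl subr_ge0.
have := @ucp_schwarz 2 (fun i => if i == ord0 then a else b)
   (fun i => if i == ord0 then x else w) _.
rewrite !big_ord_recl !big_ord0 !addr0 /= bb.
have Eab (i : 'I_2) : E (if i == ord0 then a else b) by case: ifP.
move=> /(_ Eab); rewrite ripDl !ripDr (rip_sym (f a x) (f b w)) => KS.
have e1 : rip (f (star a \o b) w) x = rip (f (y \o a) x) w.
  rewrite ucp_rip; last exact: (cstarM hE (cstar_star hE Ea) Eb).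
  by rewrite (star_mul hE) ?(starK hE) ?bb //; [exact: rip_sym|exact: (cstar_star hE)].
have e2 : rip (f a x) (f b w) = rip (f y (f a x)) w by rewrite -ucp_rip.
have e3 : rip (f (y \o a) x) w = rip m w + rip (f y (f a x)) w by rewrite /m ripBl subrK.
have e4 : rip m w = - c ^- 2 * rip m m by rewrite ripZr.
have e5 : rip w w = (c ^- 2) ^+ 2 * rip m m by rewrite ripZl ripZr mulrA mulrNN expr2.
rewrite !hnorm_sq; move: KS bw; rewrite e1 e2 e3 e4 e5.
have bb0 := rip_ge0 (f b w).
set F := rip (f a x) (f a x); set G := rip (f (star a \o a) x) x.
set M := rip m m; set Q := rip (f y (f a x)) w; set B := rip (f (y \o b) w) w.
move=> KS bw.
have c20 : 0 < c ^+ 2 by rewrite exprn_gt0.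
have : c ^- 2 * M <= G - F.
  have -> : c ^- 2 * M = 2 * (c ^- 2 * M) - c ^+ 2 * ((c ^- 2) ^+ 2 * M).
    by field; rewrite gt_eqF.
  lra.
by rewrite -(ler_pM2l c20) mulrA mulfV ?mul1r // gt_eqF.
Qed.

End UCP.
(** * The summand isolated by a strongly peaking representation *)

Section Peaking.
Context (R : realType) (H L : hilbertType R) (E : set (H -> H)).
Variable (p : (H -> H) -> (L -> L)).
Hypothesis hE : unital_cstar_algebra E.
Hypothesis rfdE : rfd E.
Hypothesis pk : strongly_peaking E E p.

Let ip : irreducible_rep E p. Proof. by case: pk. Qed.
Let rp : star_rep E p. Proof. by case: ip. Qed.
Let hp : star_hom E p. Proof. by case: rp. Qed.
Let lp : linear_on E p. Proof. by case: hp. Qed.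
Let bp : p @` E `<=` @bounded_op R L. Proof. by case: rp. Qed.

Definition other_rep (K : hilbertType R) (s : (H -> H) -> (K -> K)) :=
  [/\ irreducible_rep E s, finite_dim K & ~ unitarily_equivalent E p s].

Lemma other_rep_star (K : hilbertType R) (s : (H -> H) -> (K -> K)) :
  other_rep s -> star_rep E s.
Proof. by case=> -[]. Qed.

Lemma rfd_irreducible x : E x -> x <> 0 ->
  exists (K : hilbertType R) (s : (H -> H) -> (K -> K)),
    [/\ irreducible_rep E s, finite_dim K & s x <> 0].
Proof.
move=> Ex x0; case: rfdE => I [K [q [hq sep]]].
have [i qx] : exists i, q i x <> 0.
  by apply: contrapT => /forallNP h; apply: x0; apply: sep => // i; apply: contrapT; exact: h.
have [rq fd] := hq i.
exact: (irreducible_subrep hE rq fd Ex qx).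
Qed.

(** If the other representations were separating, they would bound the norm of
    the peaking matrix [T], hence that of [p T], by the supremum [c] in the
    definition of strong peaking. *)
Lemma other_not_separating :
  exists x, [/\ E x, x <> 0 &
    forall (K : hilbertType R) (s : (H -> H) -> (K -> K)), other_rep s -> s x = 0].
Proof.
apply: contrapT => notex.
have sep : separating E other_rep.
  split=> [K s|x Ex h]; first exact: other_rep_star.
  by apply: contrapT => x0; apply: notex; exists x; split.
case: pk => _ [n [n0 [T ET]]]; set A := (X in ereal_sup X) => supA.
(* Without another representation the supremum would be [-oo]. *)
have [K0 [s0 Os0]] : exists (K : hilbertType R) (s : (H -> H) -> (K -> K)), other_rep s.
  apply: contrapT => h; case: ip => _ [T0 ET0 pT0] _; apply: pT0.
  suff -> : T0 = 0 by rewrite (linear_on0 hE lp).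
  by apply: sep.2 => // K s Os; exfalso; apply: h; exists K, s.
have AO (K : hilbertType R) (s : (H -> H) -> (K -> K)) :
    other_rep s -> A (mx_opnorm (map_mx s T))%:E.
  by case=> irs _ ns; exists K, s.
have lower := ereal_sup_ubound (AO _ _ Os0).
have [c cE] : exists c : R, ereal_sup A = c%:E.
  case: (ereal_sup A) lower supA => [r _ _|_|]; first by exists r.
  - by rewrite ltNge leey.
  - by rewrite leeNy_eq.
rewrite cE lee_fin in lower; rewrite cE lte_fin in supA.
have c0 : 0 <= c by rewrite (le_trans _ lower) // mx_opnorm_ge0.
have [d d0 bT] := mx_cstar_bnd hE ET.
have bc : bnd c T.
  apply: (separating_bnd hE c0 sep ET) => K s Os.
  have rs := other_rep_star Os.
  apply: (@bnd_ge _ _ _ (mx_opnorm (map_mx s T))).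
    by rewrite -lee_fin -cE; exact/ereal_sup_ubound/AO.
  apply: (@bnd_mx_opnorm _ _ _ d); first by apply: rep_lin_mx ET; case: rs.
  exact: (rep_bnd hE rs (ltW d0) ET bT).
have := mx_opnorm_le (rep_bnd hE rp c0 ET bc) c0.
by rewrite leNgt supA.
Qed.

Lemma equivalent_ker (K : hilbertType R) (s : (H -> H) -> (K -> K)) x :
  unitarily_equivalent E p s -> E x -> p x = 0 -> s x = 0.
Proof.
move=> [U [_ surjU UE]] Ex px; apply/funext => z.
by have [y <-] := surjU z; rewrite -UE // px; exact: raddf0.
Qed.

(** A finite-dimensional irreducible representation that does not kill the element
    of [other_not_separating] is equivalent to [p]. *)
Lemma peaking_finite_dim : finite_dim L.
Proof.
have [x [Ex x0 Ox]] := other_not_separating.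
have [K [s [irs [n [e eK]] sx]]] := rfd_irreducible Ex x0.
have [U [iU surjU _]] : unitarily_equivalent E p s.
  by apply: contrapT => ns; apply: sx; apply: Ox; split=> //; exists n, e.
have lU : linear U by move=> a y z; exact: linearP.
have injU := isometry_inj lU iU.
have [g gE] := choice (fun i => surjU (e i)).
exists n, g => y; have [c cE] := eK (U y).
exists c; apply: injU; rewrite cE (lin_sum lU).
by apply: eq_bigr => i _; rewrite (linZ lU) gE.
Qed.

Let fd := peaking_finite_dim.

(** The summand of [E] on which [p] is faithful. *)
Definition peak_ideal : set (H -> H) :=
  [set x | E x /\ forall (K : hilbertType R) (s : (H -> H) -> (K -> K)), other_rep s -> s x = 0].

(** If [x <> 0], some finite-dimensional irreducible representation does not kill
    [x]; it is another one or equivalent to [p]. *)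
Lemma peak_separating x : E x ->
  (forall (K : hilbertType R) (s : (H -> H) -> (K -> K)), other_rep s -> s x = 0) ->
  p x = 0 -> x = 0.
Proof.
move=> Ex Ox px; apply: contrapT => x0.
have [K [s [irs fdK sx]]] := rfd_irreducible Ex x0.
apply: sx; have [eqv|neqv] := pselect (unitarily_equivalent E p s).
  exact: equivalent_ker eqv Ex px.
exact: Ox.
Qed.

Lemma peak_lift (T : L -> L) : linear T ->
  exists x, [/\ E x, p x = T &
    forall (K : hilbertType R) (s : (H -> H) -> (K -> K)), other_rep s -> s x = 0].
Proof.
move=> lT; suff [x [Ex Ox] pxT] : exists2 x, peak_ideal x & p x = T by exists x.
have slin (K : hilbertType R) (s : (H -> H) -> (K -> K)) :
    other_rep s -> star_hom E s /\ linear_on E s.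
  by move=> /other_rep_star[hs _]; split=> //; case: hs.
apply: (irreducible_ideal_onto hE ip fd (J := peak_ideal)) lT.
- by move=> x [].
- move=> a x y [Ex Ox] [Ey Oy]; split=> [|K s Os]; first exact: (cstar_comb hE).
  by rewrite (slin _ _ Os).2 // Ox // Oy // scaler0 addr0.
- move=> x y [Ex Ox] Ey; split=> [|K s Os]; first exact: (cstarM hE).
  by rewrite (rep_mul (slin _ _ Os).1) // Ox.
- move=> x y Ex [Ey Oy]; split=> [|K s Os]; first exact: (cstarM hE).
  rewrite (rep_mul (slin _ _ Os).1) // Oy //; apply/funext => z /=.
  by have [_ bs] := other_rep_star Os; exact: (lin0 (rep_linear bs Ex)).
- move=> x [Ex Ox]; split=> [|K s Os]; first exact: (cstar_star hE).
  rewrite (rep_star hE (slin _ _ Os).1) // Ox //; apply: starE => y z.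
  by rewrite inner0l inner0r.
have [x [Ex x0 Ox]] := other_not_separating.
by exists x => // px; apply: x0; exact: peak_separating.
Qed.

Inductive peak_family : forall K : hilbertType R, ((H -> H) -> (K -> K)) -> Prop :=
| PeakOther (K : hilbertType R) (s : (H -> H) -> (K -> K)) of other_rep s : peak_family s
| PeakSelf : peak_family p.

Lemma peak_family_separating : separating E peak_family.
Proof.
split=> [K s [K' s'|]|x Ex h]; [exact: other_rep_star|exact: rp|].
apply: peak_separating => // [K s Os|]; first by apply: h; constructor.
by apply: h; constructor.
Qed.

End Peaking.
(** * Replacing [p] by a completely positive extension *)

Section UCPContractive.
Context (R : realType) (H L : hilbertType R) (E : set (H -> H)).
Variable (f : (H -> H) -> (L -> L)).
Hypothesis hE : unital_cstar_algebra E.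
Hypothesis uf : ucp E f.

Lemma ucp_contractive x (c : R) : E x -> 0 <= c ->
  (forall v, hnorm (x v) <= c * hnorm v) -> forall v, hnorm (f x v) <= c * hnorm v.
Proof.
move=> Ex c0 bx v; have lf : linear_on E f by case: uf.
have f1 : f idfun = idfun by case: uf.
have Ec := cstarZ hE (c ^+ 2)%:C (cstar1 hE); have Es := cstar_star hE Ex.
have Exx := cstarM hE Es Ex.
have [EX sX pX] := sq_defect_pos hE Ex c0 bx; have := ucp_pos hE uf EX sX pX v.
rewrite (linear_onB hE lf Ec Exx) (linear_onZ hE lf _ (cstar1 hE)) f1 ripBl ripZl subr_ge0 /=.
have := @ucp_schwarz _ _ _ _ _ hE uf 1 (fun=> x) (fun=> v) (fun=> Ex).
rewrite !big_ord1 => /le_trans h /h.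
by rewrite -!hnorm_sq -exprMn ler_pXn2r // nnegrE ?mulr_ge0 ?hnorm_ge0.
Qed.

End UCPContractive.

Section Phi.
Context (R : realType) (H L : hilbertType R) (E : set (H -> H)).
Variables (p f : (H -> H) -> (L -> L)).
Hypothesis hE : unital_cstar_algebra E.
Hypothesis rfdE : rfd E.
Hypothesis pk : strongly_peaking E E p.
Hypothesis uf : ucp E f.

Let ip : irreducible_rep E p. Proof. by case: pk. Qed.
Let rp : star_rep E p. Proof. by case: ip. Qed.
Let hp : star_hom E p. Proof. by case: rp. Qed.
Let lp : linear_on E p. Proof. by case: hp. Qed.
Let bp : p @` E `<=` @bounded_op R L. Proof. by case: rp. Qed.
Let p1 : p idfun = idfun.
Proof. exact: irreducible_unit hE ip (peaking_finite_dim hE rfdE pk). Qed.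
Let lf : linear_on E f. Proof. by case: uf. Qed.
Let bf : f @` E `<=` @bounded_op R L. Proof. by case: uf. Qed.
Let f1 : f idfun = idfun. Proof. by case: uf. Qed.

Lemma peak_eq x y : E x -> E y -> p x = p y ->
  (forall (K : hilbertType R) (s : (H -> H) -> (K -> K)), other_rep E p s -> s x = s y) ->
  x = y.
Proof.
move=> Ex Ey pxy Oxy; apply/eqP; rewrite -subr_eq0; apply/eqP.
apply: (peak_separating hE rfdE (cstarB hE Ex Ey) (p := p)) => [K s Os|].
  have ls : linear_on E s by have [[]] := other_rep_star Os.
  by rewrite (linear_onB hE ls) // Oxy // subrr.
by rewrite (linear_onB hE lp) // pxy subrr.
Qed.

(** The element of [E] whose component in the peak summand is [f x] and whose
    other component is that of [x].  It exists by [peak_lift] and is unique by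
    [peak_eq]; every property of [phi] follows by comparing components. *)
Definition phi_spec x y := [/\ E y, p y = f x &
  forall (K : hilbertType R) (s : (H -> H) -> (K -> K)), other_rep E p s -> s y = s x].

Definition phi x := xget 0 [set y | phi_spec x y].

Lemma phiP x : E x -> phi_spec x (phi x).
Proof.
move=> Ex; have lT : linear (f x - p x).
  move=> a v w; have lfx := rep_linear bf Ex; have lpx := rep_linear bp Ex.
  by rewrite -[LHS]/(f x _ - p x _) lfx lpx opprD addrACA -scalerBr.
have [l [El pl Ol]] := peak_lift hE rfdE pk lT.
have : phi_spec x (x + l).
  split=> [||K s Os]; first exact: (cstarD hE).
    by rewrite (linear_onD lp) // pl addrC subrK.
  have ls : linear_on E s by have [[]] := other_rep_star Os.
  by rewrite (linear_onD ls) // Ol // addr0.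
by rewrite /phi; case: xgetP => // h /h.
Qed.

Lemma phi_over x : E x -> E (phi x). Proof. by case/phiP. Qed.
Lemma p_phi x : E x -> p (phi x) = f x. Proof. by case/phiP. Qed.
Lemma other_phi x (K : hilbertType R) (s : (H -> H) -> (K -> K)) :
  E x -> other_rep E p s -> s (phi x) = s x.
Proof. by case/phiP => _ _ h; exact: h. Qed.

Lemma phi_uniq x y : E x -> phi_spec x y -> phi x = y.
Proof.
move=> Ex [Ey py Oy]; apply: peak_eq; rewrite ?p_phi //; first exact: phi_over.
by move=> K s Os; rewrite other_phi // Oy.
Qed.

Lemma phi_linear : linear_on E phi.
Proof.
move=> a x y Ex Ey; have [Ex' Ey'] := (phi_over Ex, phi_over Ey).
apply: phi_uniq; first exact: (cstar_comb hE).
split=> [||K s Os]; first exact: (cstar_comb hE).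
  by rewrite lp // !p_phi // lf.
have ls : linear_on E s by have [[]] := other_rep_star Os.
by rewrite !ls // !other_phi.
Qed.

Lemma phi_fix a : E a -> f a = p a -> phi a = a.
Proof. by move=> Ea fa; apply: phi_uniq. Qed.

Lemma phi1 : phi idfun = idfun.
Proof. by apply: phi_fix; [exact: (cstar1 hE)|rewrite f1 p1]. Qed.

Lemma phi_star x : E x -> phi (star x) = star (phi x).
Proof.
move=> Ex; have Ex' := phi_over Ex; apply: phi_uniq; first exact: (cstar_star hE).
split=> [||K s Os]; first exact: (cstar_star hE).
  by rewrite (rep_star hE hp) // p_phi // (ucp_star hE uf).
have [hs _] := other_rep_star Os.
by rewrite !(rep_star hE hs) // other_phi.
Qed.

Lemma peak_pos x : E x -> star x = x -> pos (p x) ->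
  (forall (K : hilbertType R) (s : (H -> H) -> (K -> K)), other_rep E p s -> pos (s x)) ->
  pos x.
Proof.
move=> Ex sx px Ox; apply: (separating_pos hE (peak_family_separating hE rfdE pk)) => //.
by move=> K s [K' s' /Ox|].
Qed.

Lemma phi_pos x : E x -> star x = x -> pos x -> pos (phi x).
Proof.
move=> Ex sx px; apply: peak_pos; first exact: phi_over.
- by rewrite -phi_star // sx.
- by rewrite p_phi //; exact: (ucp_pos hE uf).
- move=> K s Os; rewrite other_phi //.
  exact: (rep_pos hE (other_rep_star Os)).
Qed.

Lemma phi_contractive x (c : R) : E x -> 0 <= c ->
  (forall v, hnorm (x v) <= c * hnorm v) -> forall v, hnorm (phi x v) <= c * hnorm v.
Proof.
move=> Ex c0 bx; apply/bnd_const.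
apply: (separating_bnd hE c0 (peak_family_separating hE rfdE pk)).
  exact: over_const (phi_over Ex).
move=> K s [{}K {}s Os|]; rewrite map_const_mx1; apply/bnd_const.
  by rewrite other_phi //; exact: (rep_contractive hE (other_rep_star Os)).
by rewrite p_phi //; exact: (ucp_contractive hE uf).
Qed.

Lemma peak_unit_exists : exists x, [/\ E x, p x = idfun &
  forall (K : hilbertType R) (s : (H -> H) -> (K -> K)), other_rep E p s -> s x = 0].
Proof. by apply: (peak_lift hE rfdE pk) => a x y. Qed.

(** The unit of the peak summand, a central projection. *)
Definition peak_unit := projT1 (cid peak_unit_exists).
Local Notation z := peak_unit.

Lemma peak_unit_over : E z.
Proof. by case: (projT2 (cid peak_unit_exists)). Qed.
Lemma p_peak_unit : p z = idfun.
Proof. by case: (projT2 (cid peak_unit_exists)). Qed.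
Lemma other_peak_unit (K : hilbertType R) (s : (H -> H) -> (K -> K)) :
  other_rep E p s -> s z = 0.
Proof. by case: (projT2 (cid peak_unit_exists)) => _ _; apply. Qed.

Lemma star0 (K : hilbertType R) : star (0 : K -> K) = 0.
Proof. by apply: starE => x y; rewrite inner0l inner0r. Qed.

Lemma peak_unit_star : star z = z.
Proof.
have Ez := peak_unit_over; apply: peak_eq => //; first exact: (cstar_star hE).
  by rewrite (rep_star hE hp) // p_peak_unit star1.
move=> K s Os; have [hs _] := other_rep_star Os.
by rewrite (rep_star hE hs) // other_peak_unit // star0.
Qed.

Lemma peak_unit_idem : z \o z = z.
Proof.
have Ez := peak_unit_over; apply: (peak_eq (cstarM hE Ez Ez) Ez).
  by rewrite (rep_mul hp Ez Ez) p_peak_unit.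
move=> K s Os; have [hs _] := other_rep_star Os.
by rewrite (rep_mul hs Ez Ez) other_peak_unit.
Qed.

Lemma peak_unit_central x : E x -> z \o x = x \o z.
Proof.
move=> Ex; have Ez := peak_unit_over.
apply: (peak_eq (cstarM hE Ez Ex) (cstarM hE Ex Ez)).
  by rewrite (rep_mul hp Ez Ex) (rep_mul hp Ex Ez) p_peak_unit.
move=> K s Os; have [hs bs] := other_rep_star Os.
rewrite (rep_mul hs Ez Ex) (rep_mul hs Ex Ez) other_peak_unit //; apply/funext => v /=.
by rewrite (lin0 (rep_linear bs Ex)).
Qed.

Definition phi_unit k := iter k phi z.

Lemma phi_unit_over k : E (phi_unit k).
Proof. by elim: k => [|k IH]; [exact: peak_unit_over|exact: phi_over]. Qed.

Lemma other_phi_unit k (K : hilbertType R) (s : (H -> H) -> (K -> K)) :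
  other_rep E p s -> s (phi_unit k) = 0.
Proof.
move=> Os; elim: k => [|k IH]; first exact: other_peak_unit.
by rewrite /= other_phi //; exact: phi_unit_over.
Qed.

Lemma phi_unit_star k : star (phi_unit k) = phi_unit k.
Proof.
elim: k => [|k IH]; first exact: peak_unit_star.
by rewrite /= -phi_star ?IH //; exact: phi_unit_over.
Qed.

(** [z - phi z] has the component [f (1 - z)], which is positive; the other
    steps follow by positivity of [phi]. *)
Lemma phi_unit_decr k : pos (phi_unit k - phi_unit k.+1).
Proof.
have E1 := cstar1 hE; have Ez := peak_unit_over.
elim: k => [|k IH].
  have E1z := cstarB hE E1 Ez; have Epz := phi_over Ez.
  have pz : pos (idfun - z).
    apply: peak_pos => //.
    - by rewrite (starB hE) // star1 peak_unit_star.
    - by rewrite (linear_onB hE lp) // p1 p_peak_unit subrr => v; rewrite rip0l.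
    - move=> K s Os; have rs := other_rep_star Os; have ls : linear_on E s by case: rs => -[].
      rewrite (linear_onB hE ls) // other_peak_unit // subr0.
      by apply: (rep_pos hE rs) => //; [exact: star1|move=> v; exact: rip_ge0].
  apply: peak_pos; first exact: (cstarB hE).
  - by rewrite (starB hE) // -phi_star // peak_unit_star.
  - rewrite (linear_onB hE lp) // p_phi // p_peak_unit -f1 -(linear_onB hE lf) //.
    by apply: (ucp_pos hE uf) => //; rewrite (starB hE) // star1 peak_unit_star.
  - move=> K s Os; have ls : linear_on E s by have [[]] := other_rep_star Os.
    by rewrite (linear_onB hE ls) // other_phi // subrr => v; rewrite rip0l.
have [Ek Ek1] := (phi_unit_over k, phi_unit_over k.+1).
have -> : phi_unit k.+1 - phi_unit k.+2 = phi (phi_unit k - phi_unit k.+1).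
  by rewrite (linear_onB hE phi_linear).
apply: phi_pos => //; first exact: (cstarB hE).
by rewrite (starB hE) // !phi_unit_star.
Qed.

End Phi.
(** * The norm away from the peak *)

Section NormBound.
Context (R : realType) (H L : hilbertType R) (E : set (H -> H)).
Variables (p f : (H -> H) -> (L -> L)).
Hypothesis hE : unital_cstar_algebra E.
Hypothesis rfdE : rfd E.
Hypothesis pk : strongly_peaking E E p.
Hypothesis uf : ucp E f.

Let ip : irreducible_rep E p. Proof. by case: pk. Qed.
Let rp : star_rep E p. Proof. by case: ip. Qed.
Let hp : star_hom E p. Proof. by case: rp. Qed.
Let lp : linear_on E p. Proof. by case: hp. Qed.
Let p1 : p idfun = idfun.
Proof. exact: irreducible_unit hE ip (peaking_finite_dim hE rfdE pk). Qed.
Let lf : linear_on E f. Proof. by case: uf. Qed.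
Let f1 : f idfun = idfun. Proof. by case: uf. Qed.
Let z := phi_unit f hE rfdE pk.

Definition diagm (K : hilbertType R) n (x : K -> K) : 'M[K -> K]_n :=
  \matrix_(i, j) if i == j then x else 0.

Lemma diagm_apply (K : hilbertType R) n (x : K -> K) (h : 'I_n -> K) :
  mx_apply (diagm n x) h = (fun i => x (h i)).
Proof.
apply/funext => i; rewrite /mx_apply (bigD1 i) //= mxE eqxx big1 ?addr0 // => j ji.
by rewrite mxE eq_sym (negPf ji).
Qed.

Lemma map_diagm (K : hilbertType R) n x (s : (H -> H) -> (K -> K)) : s 0 = 0 ->
  map_mx s (diagm n x) = diagm n (s x).
Proof. by move=> s0; apply/matrixP => i j; rewrite !mxE; case: eqP. Qed.

Lemma diagm_over n x : E x -> mx_over E (diagm n x).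
Proof. by move=> Ex i j; rewrite mxE; case: eqP => // _; exact: (cstar0 hE). Qed.

Variables (n : nat) (a : 'M[H -> H]_n) (c C : R).
Hypotheses (Ea : mx_over E a) (fa : map_mx f a = map_mx p a).
Hypotheses (c0 : 0 <= c) (C0 : 0 <= C) (bC : bnd C a).
Hypothesis (bc : forall (K : hilbertType R) (s : (H -> H) -> (K -> K)),
  other_rep E p s -> bnd c (map_mx s a)).

(** [C^2 phi^k(z) + c^2 - a^* a]. *)
Definition excess k := mxZ (C ^+ 2)%:C (diagm n (z k)) + defect c a.

Let Ez k : E (z k). Proof. exact: phi_unit_over. Qed.
Let EZ k : mx_over E (mxZ (C ^+ 2)%:C (diagm n (z k))).
Proof. exact: (mx_cstarZ hE _ (diagm_over (Ez k))). Qed.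
Let ED : mx_over E (defect c a). Proof. exact: defect_over. Qed.

Lemma map_excess (K : hilbertType R) (s : (H -> H) -> (K -> K)) k h : linear_on E s ->
  vip (mx_apply (map_mx s (excess k)) h) h =
  C ^+ 2 * vip (fun i => s (z k) (h i)) h + vip (mx_apply (map_mx s (defect c a)) h) h.
Proof.
move=> ls; have -> : map_mx s (excess k) =
    mxZ (C ^+ 2)%:C (diagm n (s (z k))) + map_mx s (defect c a).
  rewrite -(map_diagm _ _ (linear_on0 hE ls)) -(rep_mxZ hE ls); last exact: diagm_over.
  apply/matrixP => i j; have := EZ k i j; have := ED i j.
  by rewrite !mxE => e1 e2; rewrite (linear_onD ls).
by rewrite mx_applyD mx_applyZ diagm_apply vipDl vipZl.
Qed.

Lemma map_defect h :
  vip (mx_apply (map_mx f (defect c a)) h) h =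
  c ^+ 2 * vip h h - vip (mx_apply (map_mx f (mxc (mxstar a) a)) h) h.
Proof.
have E1 := @mx_cstar1 _ _ _ hE n.
rewrite (rep_mxB hE lf); [|exact: (mx_cstarZ hE)|exact: (mx_cstarM hE (mx_cstar_star hE Ea) Ea)].
rewrite mx_applyB vipBl (rep_mxZ hE lf) // mx_applyZ vipZl; congr (_ * vip _ _ - _).
have -> : mx1 H n = diagm n idfun by [].
by rewrite (map_diagm _ _ (linear_on0 hE lf)) f1 diagm_apply.
Qed.

Lemma excess_apply k h : mx_apply (excess k) h =
  (C ^+ 2)%:C *: (fun i => z k (h i)) + mx_apply (defect c a) h.
Proof. by rewrite mx_applyD mx_applyZ diagm_apply. Qed.

(** Only the component at [p] needs an argument: applying [f] to the inequality
    for [k] gives the one for [k + 1], as [f(a)^* f(a) <= f(a^* a)] and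
    [f(a) = p(a)]. *)
Lemma excess_psd k : psd (excess k).
Proof.
have saX l : sa (excess l).
  move=> g h; rewrite !excess_apply vipDl vipDr (defect_sa hE) // vipZl vipZr.
  congr (_ * _ + _); apply: eq_bigr => i _.
  by rewrite (rip_star hE _ _ (Ez l)) /z phi_unit_star.
have EX l : mx_over E (excess l) by exact: (mx_cstarD hE).
have step l : (forall h, 0 <= C ^+ 2 * vip (fun i => p (z l) (h i)) h +
    c ^+ 2 * vip h h - vip (mx_apply (map_mx p a) h) (mx_apply (map_mx p a) h)) ->
    psd (excess l).
  move=> pX; apply: (separating_psd hE (peak_family_separating hE rfdE pk)) => //.
  move=> K s [{}K {}s Os|] h; rewrite map_excess.
  - have rs := other_rep_star Os; rewrite (other_phi_unit hE rfdE pk uf l Os).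
    rewrite [X in C ^+ 2 * X]big1 ?mulr0 ?add0r; last by move=> i _; rewrite rip0l.
    exact: (rep_defect_psd hE rs c0 Ea (bc Os)).
  - by have [[]] := other_rep_star Os.
  - rewrite (rep_defectE hE rp) // p1 addrA.
    exact: pX.
  - exact: lp.
elim: k => [|k IH]; apply: step => h.
  have -> : p (z 0%N) = idfun by exact: p_peak_unit.
  have := rep_bnd hE rp C0 Ea bC h; rewrite l2norm_le //.
  by have := mulr_ge0 (sqr_ge0 c) (vip_ge0 h); lra.
have := ucp_psd hE uf (EX k) (saX k) IH h.
rewrite map_excess // map_defect.
have -> : p (z k.+1) = f (z k) by exact: (p_phi hE rfdE pk uf (Ez k)).
have := ucp_mx_schwarz hE uf h Ea; rewrite fa; lra.
Qed.

(** If the iterates of the peak unit tend to [0], the norm of [a] is already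
    attained by the other representations. *)
Lemma peak_norm_bound :
  (forall e : R, 0 < e -> exists k, forall v, rip (z k v) v <= e * rip v v) -> bnd c a.
Proof.
move=> small h; rewrite l2norm_le //.
apply/ler_addgt0Pr => e e0.
have d0 : 0 < C ^+ 2 * vip h h + 1 by rewrite ltr_wpDl // mulr_ge0 ?sqr_ge0 ?vip_ge0.
have [k zk] := small _ (divr_gt0 e0 d0).
have := excess_psd k h; rewrite excess_apply vipDl vipZl (defectE hE) //.
have : vip (fun i => z k (h i)) h <= e / (C ^+ 2 * vip h h + 1) * vip h h.
  by rewrite /vip mulr_sumr; apply: ler_sum => i _; exact: zk.
move=> /(ler_wpM2l (sqr_ge0 C)).
have : C ^+ 2 * (e / (C ^+ 2 * vip h h + 1) * vip h h) <= e.
  rewrite [leLHS](_ : _ = e * (C ^+ 2 * vip h h / (C ^+ 2 * vip h h + 1))); last by ring.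
  by rewrite ler_piMr ?(ltW e0) // ler_pdivrMr // mul1r lerDl.
lra.
Qed.

End NormBound.
(** * Invariant states *)

Section StarComplex.
Context (R : realType) (H : hilbertType R) (E : set (H -> H)).
Hypothesis hE : unital_cstar_algebra E.

Lemma starZc (a : R[i]) T : E T -> star (a *: T) = (Num.conj a) *: star T.
Proof.
move=> ET; apply: starE => x y.
by rewrite innerZl innerZr (starP hE ET) conjCK.
Qed.

Lemma star_bound T (c : R) : E T -> 0 <= c -> (forall v, hnorm (T v) <= c * hnorm v) ->
  forall v, hnorm (star T v) <= c * hnorm v.
Proof.
move=> ET c0 bT v; set w := star T v.
have [w0|w0] := eqVneq (hnorm w) 0; first by rewrite w0 mulr_ge0 // hnorm_ge0.
have {}w0 : 0 < hnorm w by rewrite lt_neqAle eq_sym w0 hnorm_ge0.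
rewrite -(ler_pM2l w0) -expr2 hnorm_sq {1}/w (rip_starr hE) // rip_sym.
rewrite (le_trans (ler_norm _)) // (le_trans (rip_norm_le _ _)) //.
by rewrite mulrCA mulrA ler_wpM2r ?hnorm_ge0.
Qed.

End StarComplex.

Section InvariantState.
Context (R : realType) (H L : hilbertType R) (E : set (H -> H)).
Variables (p f : (H -> H) -> (L -> L)).
Hypothesis hE : unital_cstar_algebra E.
Hypothesis rfdE : rfd E.
Hypothesis pk : strongly_peaking E E p.
Hypothesis uf : ucp E f.

Let ip : irreducible_rep E p. Proof. by case: pk. Qed.
Let rp : star_rep E p. Proof. by case: ip. Qed.
Let hp : star_hom E p. Proof. by case: rp. Qed.
Let lp : linear_on E p. Proof. by case: hp. Qed.
Let fd : finite_dim L. Proof. exact: peaking_finite_dim hE rfdE pk. Qed.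

Local Notation phi := (phi E p f).
Let phiE x : E x -> E (phi x). Proof. exact: phi_over. Qed.

(** The real part of a [phi]-invariant positive functional. *)
Definition inv_state (psi : (H -> H) -> R) :=
  [/\ forall x y, E x -> E y -> psi (x + y) = psi x + psi y,
      forall (r : R) x, E x -> psi (r%:C *: x) = r * psi x,
      forall x, E x -> psi (star x) = psi x,
      forall x, E x -> star x = x -> pos x -> 0 <= psi x &
      forall x, E x -> psi (phi x) = psi x].

Section OneState.
Variable psi : (H -> H) -> R.
Hypothesis ipsi : inv_state psi.

Lemma psiD x y : E x -> E y -> psi (x + y) = psi x + psi y.
Proof. by case: ipsi => h _ _ _ _; exact: h. Qed.

Lemma psiZ (r : R) x : E x -> psi (r%:C *: x) = r * psi x.
Proof. by case: ipsi => _ h _ _ _; exact: h. Qed.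

Lemma psi_star x : E x -> psi (star x) = psi x.
Proof. by case: ipsi => _ _ h _ _; exact: h. Qed.

Lemma psi_pos x : E x -> star x = x -> pos x -> 0 <= psi x.
Proof. by case: ipsi => _ _ _ h _; exact: h. Qed.

Lemma psi_phi x : E x -> psi (phi x) = psi x.
Proof. by case: ipsi => _ _ _ _ h; exact: h. Qed.

Lemma psi0 : psi 0 = 0.
Proof. by have := psiZ 0 (cstar0 hE); rewrite scaler0 mul0r. Qed.

Lemma psiB x y : E x -> E y -> psi (x - y) = psi x - psi y.
Proof.
move=> Ex Ey; rewrite psiD //; last exact: (cstarN hE).
by have := psiZ (-1) Ey; rewrite rmorphN1 scaleN1r mulN1r => ->.
Qed.

Lemma psi_sq x : E x -> 0 <= psi (star x \o x).
Proof.
move=> Ex; have Es := cstar_star hE Ex; apply: psi_pos; first exact: (cstarM hE).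
  by rewrite (star_mul hE Es Ex) (starK hE).
by move=> v; rewrite /= (rip_starr hE) // rip_ge0.
Qed.

(** The left kernel of [psi]. *)
Definition null m := psi (star m \o m) = 0.

Lemma comp_addr (x y w : H -> H) : E x -> x \o (y + w) = (x \o y) + (x \o w).
Proof. by move=> Ex; apply/funext => v; exact: (linD (cstar_linear hE Ex)). Qed.

Lemma comp_subr (x y w : H -> H) : E x -> x \o (y - w) = (x \o y) - (x \o w).
Proof. by move=> Ex; apply/funext => v; exact: (linB (cstar_linear hE Ex)). Qed.

Lemma comp_scaler (a : R[i]) (x y : H -> H) : E x -> x \o (a *: y) = a *: (x \o y).
Proof. by move=> Ex; apply/funext => v; exact: (linZ (cstar_linear hE Ex)). Qed.

(** Cauchy-Schwarz for the semi-inner product [psi (x^* y)], at [x = b^*]. *)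
Lemma null_mull m b : E m -> E b -> null m -> psi (b \o m) = 0.
Proof.
move=> Em Eb nm; apply/eqP; rewrite -sqrf_eq0 eq_le sqr_ge0 andbT.
have Es := cstar_star hE Eb; have Em' := cstar_star hE Em.
suff : psi (b \o m) ^+ 2 <= psi (b \o star b) * psi (star m \o m) by rewrite nm mulr0.
apply: quadratic_ge0_discr => [|t]; first exact: psi_sq.
(* [psi (x^* x)] is the quadratic polynomial in [t]. *)
pose x := star b + t%:C *: m.
have Etm := cstarZ hE t%:C Em.
have Ex : E x by exact: (cstarD hE).
have := psi_sq Ex; congr (_ <= _).
have sx : star x = b + t%:C *: star m.
  by rewrite (starD hE Es Etm) (starK hE Eb) (starZ hE _ Em).
have -> : star x \o x = (b \o star b) +
    (t%:C *: (b \o m) + (t%:C *: star (b \o m) + (t * t)%:C *: (star m \o m))).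
  rewrite sx (star_mul hE Eb Em).
  rewrite -[LHS]/((b \o x) + (t%:C *: (star m \o x))) /x !comp_addr // !comp_scaler //.
  by rewrite scalerDr scalerA -rmorphM /= -!addrA.
have EM := cstarM hE.
have E2 := EM _ _ Eb Em; have E3 := cstar_star hE E2; have E4 := EM _ _ Em' Em.
rewrite psiD ?psiD ?psiZ ?psi_star //; first by ring.
- exact: (cstarZ hE).
- exact: (cstarZ hE).
- exact: (cstarZ hE).
- by apply: (cstarD hE); exact: (cstarZ hE).
- exact: EM.
- by apply: (cstarD hE); [exact: (cstarZ hE)|apply: (cstarD hE); exact: (cstarZ hE)].
Qed.

Lemma null_mul m b : E m -> E b -> null m -> null (b \o m).
Proof.
move=> Em Eb nm; rewrite /null (star_mul hE Eb Em).
rewrite -[_ \o _]/((star m \o star b \o b) \o m); apply: null_mull => //.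
by apply: (cstarM hE) => //; apply: (cstarM hE); exact: (cstar_star hE).
Qed.

Lemma null_star m b : E m -> E b -> null m -> psi (star m \o b) = 0.
Proof.
move=> Em Eb nm; have Es := cstar_star hE Eb.
rewrite -(starK hE Eb) -(star_mul hE Es Em) psi_star; last exact: (cstarM hE).
exact: null_mull.
Qed.

Lemma null_add m d : E m -> E d -> null m -> psi (star (d + m) \o (d + m)) = psi (star d \o d).
Proof.
move=> Em Ed nm; have Em' := cstar_star hE Em; have Ed' := cstar_star hE Ed.
have EM := cstarM hE; have ED := cstarD hE.
rewrite (starD hE Ed Em) -[_ \o _]/((star d \o (d + m)) + (star m \o (d + m))).
rewrite psiD; [|exact: EM (ED _ _ Ed Em)|exact: EM (ED _ _ Ed Em)].
rewrite (null_star Em (ED _ _ Ed Em) nm) addr0 comp_addr //.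
by rewrite psiD ?(null_mull Em Ed' nm) ?addr0 //; exact: EM.
Qed.

Lemma nullD m d : E m -> E d -> null m -> null d -> null (d + m).
Proof. by move=> Em Ed nm nd; rewrite /null null_add. Qed.

Lemma nullZ (a : R[i]) m : E m -> null m -> null (a *: m).
Proof.
move=> Em nm; have -> : a *: m = (a *: idfun) \o m by [].
by apply: null_mul => //; exact: (cstarZ hE _ (cstar1 hE)).
Qed.

(** [phi] is multiplicative at [x] modulo the left kernel of [psi]. *)
Definition good x := forall y, E y -> null (phi (y \o x) - (phi y \o x)).

Lemma defect_in x y : E x -> E y -> E (phi (y \o x) - (phi y \o x)).
Proof.
move=> Ex Ey; apply: (cstarB hE); first by apply: phiE; exact: (cstarM hE).
by apply: (cstarM hE) => //; exact: phiE.
Qed.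

(** Goodness and its adjoint form let [x] and [x^*] pass through [phi]:
    [psi (x^* phi(y) x) = psi (phi(x^* y x)) = psi (x^* y x)]. *)
Lemma inv_state_move x : E x -> good x -> inv_state (fun y => psi (star x \o y \o x)).
Proof.
move=> Ex gx; have Es := cstar_star hE Ex; have EM := cstarM hE.
have Exy y : E y -> E (star x \o y \o x) by move=> Ey; apply: (EM) => //; exact: (EM).
split=> [y w Ey Ew|r y Ey|y Ey|y Ey sy py|y Ey]; cbv beta.
- rewrite -(psiD (Exy _ Ey) (Exy _ Ew)); congr (psi _); apply/funext => v /=.
  exact: (linD (cstar_linear hE Es)).
- rewrite -(psiZ _ (Exy _ Ey)); congr (psi _); apply/funext => v /=.
  exact: (linZ (cstar_linear hE Es)).
- have Ey' := cstar_star hE Ey; rewrite -[RHS](psi_star (Exy _ Ey)); congr psi.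
  by rewrite (star_mul hE (EM _ _ Es Ey) Ex) (star_mul hE Es Ey) (starK hE).
- apply: psi_pos; first exact: Exy.
    by rewrite (star_mul hE (EM _ _ Es Ey) Ex) (star_mul hE Es Ey) (starK hE) // sy.
  by move=> v /=; rewrite (rip_starr hE).
have Epy := phiE Ey; have Eyx := EM _ _ Ey Ex; have Epyx := phiE Eyx.
have e1 : psi (star x \o phi y \o x) = psi (star x \o phi (y \o x)).
  have := null_mull (defect_in Ex Ey) Es (gx y Ey).
  rewrite comp_subr // psiB; [|exact: EM|exact: Exy].
  by move/eqP; rewrite subr_eq0 => /eqP ->.
have Eyx' := cstar_star hE Eyx.
have e2 : psi (star x \o phi (y \o x)) = psi (phi (star (y \o x) \o x)).
  rewrite -psi_star; last exact: EM.
  rewrite (star_mul hE Es Epyx) (starK hE Ex) -(phi_star hE rfdE pk uf Eyx).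
  have := null_mull (defect_in Ex Eyx') (cstar1 hE) (gx _ Eyx').
  rewrite -[idfun \o _]/(phi (star (y \o x) \o x) - (phi (star (y \o x)) \o x)).
  rewrite psiB; [|by apply: phiE; exact: EM|by apply: EM => //; exact: phiE].
  by move/eqP; rewrite subr_eq0 => /eqP ->.
rewrite e1 e2 psi_phi; last exact: EM.
rewrite -psi_star; last exact: EM.
by rewrite (star_mul hE Eyx' Ex) (starK hE Eyx).
Qed.

(** [m^* m <= C^2 (phi(a^* a) - a^* a)] by [ucp_mult_defect], and invariance
    makes [psi] vanish on the right-hand side. *)
Lemma fixed_good a : E a -> f a = p a -> good a.
Proof.
move=> Ea fa y Ey; set m := _ - _.
have Em : E m by exact: defect_in.
have EM := cstarM hE; have Ea' := cstar_star hE Ea; have Em' := cstar_star hE Em.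
have Eaa := EM _ _ Ea' Ea; have Epaa := phiE Eaa; have Emm := EM _ _ Em' Em.
have [C C0 bC] := cstar_bnd hE (cstar_star hE Ey).
have ED := cstarB hE Epaa Eaa; have ECD := cstarZ hE (C ^+ 2)%:C ED.
pose X := (C ^+ 2)%:C *: (phi (star a \o a) - (star a \o a)) - (star m \o m).
have EX : E X by exact: (cstarB hE).
have saa : star (star a \o a) = star a \o a by rewrite (star_mul hE Ea' Ea) (starK hE).
have sX : star X = X.
  rewrite (starB hE ECD Emm) (starZ hE _ ED) (starB hE Epaa Eaa).
  rewrite -(phi_star hE rfdE pk uf Eaa) saa.
  by rewrite (star_mul hE Em' Em) (starK hE).
have mapX (K : hilbertType R) (s : (H -> H) -> (K -> K)) : star_rep E s -> s X =
   (C ^+ 2)%:C *: (s (phi (star a \o a)) - (s (star a) \o s a)) - (s (star m) \o s m).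
  move=> [hs _]; have ls : linear_on E s by case: hs.
  rewrite (linear_onB hE ls ECD Emm) (linear_onZ hE ls _ ED) (linear_onB hE ls Epaa Eaa).
  by rewrite (rep_mul hs Ea' Ea) (rep_mul hs Em' Em).
have Eya := EM _ _ Ey Ea; have Epya := phiE Eya; have Epy := phiE Ey.
have pX : pos X.
  apply: (peak_pos hE rfdE pk) => // [v|K s Os v].
    rewrite (mapX _ _ rp) ripBl ripZl ripBl subr_ge0.
    rewrite /= (rep_adj hE hp _ _ Em') (rep_adj hE hp _ _ Ea') (starK hE Em) (starK hE Ea).
    rewrite -!hnorm_sq (p_phi hE rfdE pk uf Eaa).
    have -> : p m v = f (y \o a) v - f y (f a v).
      rewrite /m (linear_onB hE lp Epya (EM _ _ Epy Ea)) (rep_mul hp Epy Ea).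
      by rewrite !(p_phi hE rfdE pk uf) // fa.
    by rewrite -fa; exact: (ucp_mult_defect hE uf).
  have rs := other_rep_star Os; have [hs bs] := rs; have ls : linear_on E s by case: hs.
  rewrite (mapX _ _ rs) (other_phi hE rfdE pk uf Eaa Os) (rep_mul hs Ea' Ea) subrr scaler0.
  have -> : s m = 0.
    rewrite /m (linear_onB hE ls Epya (EM _ _ Epy Ea)) (rep_mul hs Epy Ea).
    by rewrite !(other_phi hE rfdE pk uf) // (rep_mul hs Ey Ea) subrr.
  rewrite ripBl rip0l sub0r oppr_ge0 /= (lin0 (rep_linear bs Em')).
  by rewrite rip0l.
have := psi_pos EX sX pX.
rewrite psiB // psiZ // psiB // psi_phi // subrr mulr0 sub0r oppr_ge0 => le0.
by apply/eqP; rewrite eq_le le0 psi_sq.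
Qed.

End OneState.
End InvariantState.
(** * Rigidity in the presence of an invariant state *)

Section InvariantStateRigidity.
Context (R : realType) (H L : hilbertType R) (E : set (H -> H)).
Variables (p f : (H -> H) -> (L -> L)).
Hypothesis hE : unital_cstar_algebra E.
Hypothesis rfdE : rfd E.
Hypothesis pk : strongly_peaking E E p.
Hypothesis uf : ucp E f.

Let ip : irreducible_rep E p. Proof. by case: pk. Qed.
Let rp : star_rep E p. Proof. by case: ip. Qed.
Let hp : star_hom E p. Proof. by case: rp. Qed.
Let lp : linear_on E p. Proof. by case: hp. Qed.
Let bp : p @` E `<=` @bounded_op R L. Proof. by case: rp. Qed.
Let fd : finite_dim L. Proof. exact: peaking_finite_dim hE rfdE pk. Qed.

Local Notation phi := (phi E p f).
Local Notation z := (peak_unit hE rfdE pk).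
Let phiE x : E x -> E (phi x). Proof. exact: phi_over. Qed.
Let lphi : linear_on E phi. Proof. exact: phi_linear. Qed.

(** All invariant states are considered at once, because the product rule uses
    goodness of [x] for the state moved by [y]. *)
Definition good_all x := forall psi, inv_state E p f psi -> good E p f psi x.

Lemma good_comb (a : R[i]) x y : E x -> E y -> good_all x -> good_all y ->
  good_all (a *: x + y).
Proof.
move=> Ex Ey gx gy psi ipsi w Ew; have EM := cstarM hE; have Epw := phiE Ew.
have EZx := cstarZ hE a Ex.
have -> : phi (w \o (a *: x + y)) - (phi w \o (a *: x + y)) =
    a *: (phi (w \o x) - (phi w \o x)) + (phi (w \o y) - (phi w \o y)).
  rewrite !(comp_addr hE) // !(comp_scaler hE) // lphi; [|exact: EM|exact: EM].
  by rewrite opprD addrACA -scalerBr.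
have Dx := defect_in hE rfdE pk uf Ex Ew; have Dy := defect_in hE rfdE pk uf Ey Ew.
apply: (nullD hE ipsi Dy (cstarZ hE _ Dx)); first exact: gy.
by apply: (nullZ hE ipsi) => //; exact: gx.
Qed.

(** [phi(w x y) - phi(w) x y] is [(phi(w x) - phi(w) x) y], which is null for
    [psi] since its left factor is null for the state moved by [y], plus the
    defect of [y] at [w x]. *)
Lemma good_mul x y : E x -> E y -> good_all x -> good_all y -> good_all (x \o y).
Proof.
move=> Ex Ey gx gy psi ipsi w Ew; have EM := cstarM hE.
have Ewx := EM _ _ Ew Ex; have Dx := defect_in hE rfdE pk uf Ex Ew.
have -> : phi (w \o (x \o y)) - (phi w \o (x \o y)) =
    ((phi (w \o x) - (phi w \o x)) \o y) + (phi ((w \o x) \o y) - (phi (w \o x) \o y)).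
  by rewrite [RHS]addrC -[X in _ = _ + X]/((phi (w \o x) \o y) - ((phi w \o x) \o y)) addrA subrK.
apply: (nullD hE ipsi (defect_in hE rfdE pk uf Ey Ewx) (EM _ _ Dx Ey)).
  exact: gy.
have := gx _ (inv_state_move hE rfdE pk uf ipsi Ey (gy _ ipsi)) w Ew.
by rewrite /null (star_mul hE Dx Ey).
Qed.

(** The defect of [T] differs from the null defect of [S] by an operator of norm
    at most [2 C e], and null elements do not contribute to [psi (m^* m)]. *)
Lemma good_limit T : E T ->
  (forall e : R, 0 < e -> exists S, [/\ E S, good_all S &
     forall v, hnorm ((T - S) v) <= e * hnorm v]) -> good_all T.
Proof.
move=> ET lim psi ipsi y Ey; set m := _ - _.
have Em : E m by exact: defect_in.
have EM := cstarM hE; have EB := cstarB hE.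
have [C C0 bC] := cstar_bnd hE Ey.
have E1 := cstar1 hE.
have psi1 : 0 <= psi idfun.
  by apply: (psi_pos ipsi) => //; [exact: star1|move=> v; exact: rip_ge0].
have bound (e : R) : 0 < e -> psi (star m \o m) <= (2 * C * e) ^+ 2 * psi idfun.
  move=> e0; have [S [ES gS bS]] := lim e e0.
  have Dm := defect_in hE rfdE pk uf ES Ey; set m' := phi (y \o S) - (phi y \o S) in Dm.
  have ETS := EB _ _ ET ES; have EyTS := EM _ _ Ey ETS.
  pose d := phi (y \o (T - S)) - (phi y \o (T - S)).
  have Ed : E d by exact: defect_in.
  have mE : m = d + m'.
    rewrite /m /d /m' (comp_subr hE) // (comp_subr hE); last exact: phiE.
    rewrite (linear_onB hE lphi); [|exact: EM|exact: EM].
    by rewrite opprB addrACA subrK [X in _ = _ + X]addrAC subrr sub0r.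
  rewrite mE (null_add hE ipsi) //; last exact: gS.
  have bd v : hnorm (d v) <= 2 * C * e * hnorm v.
    rewrite (le_trans (hnormD _ _)) // hnormN.
    have b1 : forall v, hnorm ((y \o (T - S)) v) <= C * e * hnorm v.
      by move=> u; rewrite (le_trans (bC _)) // -mulrA ler_wpM2l ?(ltW C0).
    have Ce : 0 <= C * e by rewrite mulr_ge0 // ltW.
    have := phi_contractive hE rfdE pk uf EyTS Ce b1 v.
    have := phi_contractive hE rfdE pk uf Ey (ltW C0) bC ((T - S) v).
    have := ler_wpM2l (ltW C0) (bS v) => h1 h2 h3.
    rewrite -[hnorm ((phi y \o (T - S)) v)]/(hnorm (phi y ((T - S) v))).
    lra.
  have Ed' := cstar_star hE Ed; have Edd := EM _ _ Ed' Ed.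
  have Ec := cstarZ hE ((2 * C * e) ^+ 2)%:C E1.
  have dc0 : 0 <= 2 * C * e by rewrite !mulr_ge0 // ltW.
  have [EX sX pX] := sq_defect_pos hE Ed dc0 bd.
  have := psi_pos ipsi EX sX pX.
  by rewrite (psiB hE ipsi Ec Edd) (psiZ ipsi _ E1) subr_ge0.
apply/eqP; rewrite eq_le (psi_sq hE ipsi) // andbT.
apply/ler_addgt0Pr => e e0; rewrite add0r.
pose d := Num.sqrt (e / (psi idfun + 1)) / (2 * C).
have p0 : 0 < psi idfun + 1 by rewrite ltr_wpDl.
have d0 : 0 < d by rewrite divr_gt0 ?sqrtr_gt0 ?divr_gt0 ?mulr_gt0.
rewrite (le_trans (bound d d0)) //.
have -> : 2 * C * d = Num.sqrt (e / (psi idfun + 1)).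
  by rewrite /d mulrC divfK // gt_eqF // mulr_gt0.
rewrite sqr_sqrtr; last by rewrite divr_ge0 // ltW.
by rewrite -mulrA ler_piMr ?(ltW e0) // mulrC ler_pdivrMr // mul1r lerDl.
Qed.

Definition good_algebra : set (H -> H) :=
  [set x | [/\ E x, good_all x & good_all (star x)]].

Lemma good_algebra_cstar : unital_cstar_algebra good_algebra.
Proof.
have E1 := cstar1 hE.
have g1 : good_all idfun.
  move=> psi ipsi y Ey.
  have -> : phi (y \o idfun) - (phi y \o idfun) = 0.
    by rewrite -[y \o idfun]/y -[phi y \o idfun]/(phi y) subrr.
  by rewrite /null -[_ \o _]/(fun=> star (0 : H -> H) 0) star0; exact: (psi0 hE ipsi).
split; first split.
- by move=> x [Ex _ _]; exact: (cstar_bounded hE).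
- by split=> //; rewrite star1.
- move=> a x y [Ex gx gx'] [Ey gy gy']; split; first exact: (cstar_comb hE).
    exact: good_comb.
  have Ex' := cstar_star hE Ex; have Ey' := cstar_star hE Ey.
  rewrite (starD hE (cstarZ hE a Ex) Ey) (starZc hE) //.
  exact: good_comb.
- move=> x y [Ex gx gx'] [Ey gy gy']; split; first exact: (cstarM hE).
    exact: good_mul.
  rewrite (star_mul hE Ex Ey).
  by apply: good_mul => //; exact: (cstar_star hE).
- move=> x [Ex gx gx']; exists (star x); last exact: (starP hE).
  by split; [exact: (cstar_star hE)|exact: gx'|rewrite (starK hE Ex)].
move=> T bT lim.
have ET : E T.
  case: hE => _ _; apply => // e /lim[S [ES _ _] TS]; by exists S.
have lim' (e : R) : 0 < e -> exists S, good_algebra S /\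
    forall v, hnorm ((T - S) v) <= e * hnorm v.
  move=> /lim[S gS /ltW TS]; exists S; split=> // v; have [ES _ _] := gS.
  rewrite (le_trans (opnorm_bound (cstar_bounded hE (cstarB hE ET ES)) v)) //.
  by rewrite ler_wpM2r ?hnorm_ge0.
split=> //; apply: good_limit => //; first by move=> e /lim'[S [[ES gS _] bS]]; exists S.
  exact: (cstar_star hE).
move=> e e0; have [S [[ES _ gS] bS]] := lim' e e0; exists (star S).
split=> //; first exact: (cstar_star hE).
rewrite -(starB hE ET ES); apply: (star_bound hE _ (ltW e0)) => //.
exact: (cstarB hE).
Qed.

Variable A : set (H -> H).
Hypothesis AE : A `<=` E.
Hypothesis genA : forall G, unital_cstar_algebra G -> A `<=` G -> E `<=` G.
Hypothesis fA : forall a, A a -> f a = p a.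

Lemma all_good x : E x -> good_all x.
Proof.
move=> Ex; have : good_algebra x; last by case.
apply: (genA good_algebra_cstar) Ex => a Aa; have Ea := AE Aa.
split=> // psi ipsi; first exact: (fixed_good hE rfdE pk uf ipsi Ea (fA Aa)).
apply: (fixed_good hE rfdE pk uf ipsi (cstar_star hE Ea)).
by rewrite -(ucp_star hE uf) // fA // (rep_star hE hp).
Qed.

(** If [D = phi x - x] were nonzero, products [b_i D w_i] of it would be matrix
    units adding up to [z], since the peak summand is a full matrix algebra.  But
    [D w] lies in the left kernel for all [w], so [psi z] would be [0]. *)
Lemma inv_state_rigid psi : inv_state E p f psi -> 0 < psi z ->
  forall x, E x -> f x = p x.
Proof.
move=> ipsi z0 x Ex; have EM := cstarM hE.
pose D := phi x - x; have ED : E D by apply: (cstarB hE) => //; exact: phiE.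
have nD w : E w -> null psi (D \o w).
  move=> Ew; have Ew' := cstar_star hE Ew.
  have im := inv_state_move hE rfdE pk uf ipsi Ew (all_good Ew ipsi).
  have := all_good Ex im (cstar1 hE).
  rewrite (phi1 hE rfdE pk uf) -[idfun \o x]/x -/D /null => h.
  by rewrite (star_mul hE ED Ew).
have pD : p D = f x - p x.
  by rewrite /D (linear_onB hE lp (phiE Ex) Ex) (p_phi hE rfdE pk uf).
apply: contrapT => /eqP; rewrite -subr_eq0 -pD => /eqP pD0.
have [xi Dxi] : exists xi, p D xi <> 0.
  by apply: contrapT => /forallNP h; apply: pD0; apply/funext => v; apply: contrapT; exact: h.
set eta := p D xi in Dxi.
have ee0 : inner eta eta != 0 by apply/eqP => /inner_eq0.
have [n [e [one _ eL]]] := onb_exists (M := [set: L]) fd (conj I (fun _ _ _ _ _ => I)).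
have rank1_lin u v : linear (rank1 u v : L -> L).
  by move=> a s t; rewrite /rank1 inner_linear scalerDl scalerA.
have lift u v := peak_lift hE rfdE pk (rank1_lin u v).
have [w wP] := choice (fun i => lift xi (e i)).
have [b bP] := choice (fun i => lift ((inner eta eta)^-1 *: e i) eta).
have Ew i : E (w i) by case: (wP i).
have Eb i : E (b i) by case: (bP i).
have EDw i : E (D \o w i) by exact: EM.
have EbDw i : E (b i \o (D \o w i)) by exact: EM.
have zE : z = \sum_i (b i \o (D \o w i)).
  have Es : E (\sum_i (b i \o (D \o w i))) by exact: (cstar_sum hE).
  apply: (peak_eq hE rfdE pk (peak_unit_over hE rfdE pk) Es).
    rewrite p_peak_unit (linear_on_sum hE lp) //; apply/funext => v.
    rewrite sum_funE {1}(eL v I); apply: eq_bigr => i _.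
    have [_ pb _] := bP i; have [_ pw _] := wP i.
    rewrite (rep_mul hp (Eb i) (EDw i)) (rep_mul hp ED (Ew i)) pb pw /= /rank1.
    rewrite (linZ (rep_linear bp ED)) -/eta innerZl scalerA -mulrA mulfV //.
    by rewrite mulr1.
  move=> K s Os; have [hs bs] := other_rep_star Os; have ls : linear_on E s by case: hs.
  rewrite other_peak_unit // (linear_on_sum hE ls) // big1 // => i _.
  have [_ _ Ob] := bP i.
  by rewrite (rep_mul hs (Eb i) (EDw i)) Ob.
suff : psi z = 0 by move=> z00; move: z0; rewrite z00 ltxx.
rewrite zE; have : forall r : seq 'I_n, psi (\sum_(i <- r) (b i \o (D \o w i))) = 0.
  elim=> [|i r IH]; first by rewrite big_nil (psi0 hE ipsi).
  rewrite big_cons (psiD ipsi) ?IH ?addr0 //; last exact: (cstar_sum hE).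
  exact: (null_mull hE ipsi (EDw i) (Eb i) (nD _ (Ew i))).
exact.
Qed.

End InvariantStateRigidity.
(** * Existence of an invariant state *)

Section Ultralimit.
Context (R : realType).

Lemma ultra_bounded_cvg (U : set_system nat) (u : nat -> R) (C : R) :
  UltraFilter U -> (forall n, `|u n| <= C) -> exists l : R, u @ U --> l.
Proof.
move=> UU uC; have PU : ProperFilter U by exact: ultra_proper.
have [|l [_ ul]] := @segment_compact R (- C) C (u @ U) (fmap_proper_filter u PU).
  have : U [set n | - C <= u n <= C] by apply: filterE => n /=; rewrite -ler_norml uC.
  by rewrite /fmap /=; apply: filterS => n; rewrite /= in_itv.
exists l => B Bl; case: (in_ultra_setVsetC (u @^-1` B) UU) => // UB.
have [x [nBx Bx]] : (~` B) `&` B !=set0 by exact: ul.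
by case: nBx.
Qed.

End Ultralimit.

Section InvariantStateExists.
Context (R : realType) (H L : hilbertType R) (E : set (H -> H)).
Variables (p f : (H -> H) -> (L -> L)).
Hypothesis hE : unital_cstar_algebra E.
Hypothesis rfdE : rfd E.
Hypothesis pk : strongly_peaking E E p.
Hypothesis uf : ucp E f.

Local Notation phi := (phi E p f).
Local Notation z := (peak_unit hE rfdE pk).
Let phiE x : E x -> E (phi x). Proof. exact: phi_over. Qed.
Let lphi : linear_on E phi. Proof. exact: phi_linear. Qed.

Let itE k x : E x -> E (iter k phi x).
Proof. by move=> Ex; elim: k => // k; exact: phiE. Qed.

Let itD k x y : E x -> E y -> iter k phi (x + y) = iter k phi x + iter k phi y.
Proof.
move=> Ex Ey; elim: k => //= k ->.
exact: (linear_onD lphi (itE k Ex) (itE k Ey)).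
Qed.

Let itZ k (a : R[i]) x : E x -> iter k phi (a *: x) = a *: iter k phi x.
Proof. by move=> Ex; elim: k => //= k ->; exact: (linear_onZ hE lphi _ (itE k Ex)). Qed.

Let it_star k x : E x -> iter k phi (star x) = star (iter k phi x).
Proof. by move=> Ex; elim: k => //= k ->; exact: (phi_star hE rfdE pk uf (itE k Ex)). Qed.

Let it_pos k x : E x -> star x = x -> pos x -> pos (iter k phi x).
Proof.
move=> Ex sx px; elim: k => //= k IH; apply: (phi_pos hE rfdE pk uf) => //; first exact: itE.
by rewrite -it_star // sx.
Qed.

Let it_bnd k x (C : R) : E x -> 0 <= C -> (forall v, hnorm (x v) <= C * hnorm v) ->
  forall v, hnorm (iter k phi x v) <= C * hnorm v.
Proof.
move=> Ex C0 bx; elim: k => //= k IH.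
exact: (phi_contractive hE rfdE pk uf (itE k Ex) C0 IH).
Qed.

(** Cesaro means of [x |-> <phi^k x v_N, v_N>], [k <= N], are invariant up to
    [O(1/N)].  As [phi^k z] decreases, [v_N] witnesses all [k <= N] at once,
    whence [psi z >= e]. *)
Lemma inv_state_exists (e : R) (v : nat -> H) : 0 < e ->
  (forall k, hnorm (v k) = 1) ->
  (forall k, e <= rip (phi_unit f hE rfdE pk k (v k)) (v k)) ->
  exists2 psi, inv_state E p f psi & 0 < psi z.
Proof.
move=> e0 v1 ve.
pose psiN x N : R := N.+1%:R^-1 * \sum_(k < N.+1) rip (iter k phi x (v N)) (v N).
have [U [UU subU]] := @ultraFilterLemma nat \oo _.
have PU : ProperFilter U by exact: ultra_proper.
have bound x : E x -> exists2 C : R, 0 <= C & forall k w, `|rip (iter k phi x (v w)) (v w)| <= C.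
  move=> Ex; have [C C0 bC] := cstar_bnd hE Ex.
  exists C => [|k w]; first exact: ltW.
  rewrite (le_trans (rip_norm_le _ _)) // v1 mulr1.
  by have := it_bnd k Ex (ltW C0) bC (v w); rewrite v1 mulr1.
have psiN_bnd x : E x -> exists C : R, forall N, `|psiN x N| <= C.
  move=> /bound[C C0 bC]; exists C => N; rewrite normrM ger0_norm ?invr_ge0 //.
  rewrite mulrC ler_pdivrMr // mulrC (le_trans (ler_norm_sum _ _ _)) //.
  by apply: sum_le_const => k; exact: bC.
pose psi x := xget 0 [set l | psiN x @ U --> l].
have psiP x : E x -> psiN x @ U --> psi x.
  move=> /psiN_bnd[C bC]; have [l xl] := ultra_bounded_cvg UU bC.
  by rewrite /psi; case: xgetP => [l' _ //|/(_ l)].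
have uniq (u : nat -> R) (l l' : R) : u @ U --> l -> u @ U --> l' -> l = l'.
  by move=> h h'; exact: (cvg_unique (@Rhausdorff R) (FF := fmap_proper_filter u PU) h h').
have lb x (c : R) : E x -> (forall N, c <= psiN x N) -> c <= psi x.
  move=> Ex cx; apply: (closed_cvg _ (@closed_ge _ c) _ _ (psiP x Ex)).
  exact: filterE.
exists psi; first split.
- move=> x y Ex Ey; apply: (uniq (psiN (x + y))); first by apply: psiP; exact: (cstarD hE).
  have -> : psiN (x + y) = psiN x \+ psiN y.
    apply/funext => N; rewrite /psiN /= -mulrDr -big_split /=; congr (_ * _).
    by apply: eq_bigr => k _; rewrite itD // ripDl.
  by apply: cvgD; exact: psiP.
- move=> r x Ex; apply: (uniq (psiN (r%:C *: x))); first by apply: psiP; exact: (cstarZ hE).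
  have -> : psiN (r%:C *: x) = (fun N => r * psiN x N).
    apply/funext => N; rewrite /psiN /= [RHS]mulrCA; congr (_ * _); rewrite mulr_sumr.
    by apply: eq_bigr => k _; rewrite itZ // ripZl.
  by apply: cvgMr; exact: psiP.
- move=> x Ex; apply: (uniq (psiN (star x))); first by apply: psiP; exact: (cstar_star hE).
  have -> : psiN (star x) = psiN x; last exact: psiP.
  apply/funext => N; rewrite /psiN; congr (_ * _); apply: eq_bigr => k _.
  by rewrite (it_star k Ex) (rip_starr hE _ _ (itE k Ex)) rip_sym.
- move=> x Ex sx px; apply: lb => // N; rewrite mulr_ge0 ?invr_ge0 // sumr_ge0 // => k _.
  exact: it_pos.
- move=> x Ex; have Ex' := phiE Ex.
  have [C C0 bC] := bound x Ex.
  apply/eqP; rewrite -subr_eq0; apply/eqP.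
  apply: (uniq (psiN (phi x) \- psiN x)); first by apply: cvgB; exact: psiP.
  have diff N : (psiN (phi x) \- psiN x) N =
      N.+1%:R^-1 * (rip (iter N.+1 phi x (v N)) (v N) - rip (x (v N)) (v N)).
    rewrite /psiN /= -mulrBr; congr (_ * _).
    rewrite -sumrB -(telescope_sumr (fun k => rip (iter k phi x (v N)) (v N)) (leq0n N.+1)).
    by rewrite big_mkord; apply: eq_bigr => k _; rewrite -iterSr.
  have lim0 : (fun N => N.+1%:R^-1 * (2 * C)) @ U --> (0 : R).
    have : (fun N => N.+1%:R^-1 * (2 * C)) @ \oo --> (0 * (2 * C) : R).
      by apply: cvgMl; exact: cvg_harmonic.
    by rewrite mul0r => h B /h; exact: subU.
  have limN : (fun N => - (N.+1%:R^-1 * (2 * C))) @ U --> (0 : R).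
    by rewrite -oppr0; exact: cvgN.
  apply: (squeeze_cvgr _ limN lim0); apply: filterE => N.
  rewrite diff -ler_norml normrM ger0_norm ?invr_ge0 //.
  rewrite ler_wpM2l ?invr_ge0 // (le_trans (ler_normB _ _)) //.
  by have := bC N.+1 N; have := bC 0%N N; rewrite /=; lra.
apply: lt_le_trans e0 _; apply: lb => [|N]; first exact: peak_unit_over.
have decr k l : (k <= l)%N -> forall w,
    rip (phi_unit f hE rfdE pk l w) w <= rip (phi_unit f hE rfdE pk k w) w.
  move=> /subnK <- w; elim: (l - k)%N => // m; apply: le_trans.
  by have := phi_unit_decr hE rfdE pk uf (m + k) w; rewrite ripBl subr_ge0.
rewrite /psiN mulrC ler_pdivlMr // mulrC.
have := @sum_le_const R N.+1 (fun k => - rip (iter k phi z (v N)) (v N)) (- e).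
rewrite sumrN mulrN lerN2; apply => k; rewrite lerN2 (le_trans (ve N)) //.
by apply: decr; rewrite -ltnS.
Qed.

End InvariantStateExists.
(** * The complementary representation and the universal property *)

Section GeneratedAlgebra.
Context (R : realType) (H : hilbertType R).

Lemma cstar_generated_cstar (X G : set (H -> H)) : unital_cstar_algebra G ->
  X `<=` G -> unital_cstar_algebra (cstar_generated X).
Proof.
move=> hG XG; have inG T : cstar_generated X T -> G T by apply; split.
split; first split.
- by move=> T /inG; exact: (cstar_bounded hG).
- by move=> M [hM _]; exact: (cstar1 hM).
- by move=> a S T XS XT M hM; apply: (cstar_comb hM.1); [exact: XS|exact: XT].
- by move=> S T XS XT M hM; apply: (cstarM hM.1); [exact: XS|exact: XT].
- move=> T XT; exists (star T); last exact: (starP hG (inG T XT)).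
  by move=> M hM; apply: (cstar_star hM.1); exact: XT.
move=> T bT lim M hM; case: hM.1 => _ _; apply=> // e /lim[S XS TS].
by exists S => //; exact: XS.
Qed.

Lemma star_rep_id (E : set (H -> H)) : unital_cstar_algebra E -> star_rep E (@idfun (H -> H)).
Proof.
move=> hE; split; first by split=> // S T ES ET /adjoint_sym.
by move=> _ [T ET <-]; exact: (cstar_bounded hE).
Qed.

Lemma opnorm_rep (K : hilbertType R) (E : set (H -> H)) (p : (H -> H) -> (K -> K)) T (c : R) :
  unital_cstar_algebra E -> star_rep E p -> E T -> opnorm T <= c ->
  forall v, hnorm (p T v) <= c * hnorm v.
Proof.
move=> hE rp ET Tc v; have c0 : 0 <= c := le_trans (opnorm_ge0 T) Tc.
apply: (rep_contractive hE rp ET c0) => w.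
rewrite (le_trans (opnorm_bound (cstar_bounded hE ET) w)) //.
by rewrite ler_wpM2r ?hnorm_ge0.
Qed.

End GeneratedAlgebra.

Section ComplementaryRepresentation.
Context (R : realType) (H L : hilbertType R) (E : set (H -> H)).
Variable (p : (H -> H) -> (L -> L)).
Hypothesis hE : unital_cstar_algebra E.
Hypothesis rfdE : rfd E.
Hypothesis pk : strongly_peaking E E p.

Local Notation z := (peak_unit hE rfdE pk).
Let Ez : E z. Proof. exact: peak_unit_over. Qed.
Let lz : linear z. Proof. exact: (cstar_linear hE Ez). Qed.
Let zz x : z (z x) = z x.
Proof. by have := peak_unit_idem hE rfdE pk => /(congr1 (fun g => g x)). Qed.

Definition peak_ker : set H := [set x | z x = 0].

Lemma peak_ker_closed : closed_subspace peak_ker.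
Proof.
split; first exact: (lin0 lz).
  by move=> a x y zx zy; rewrite /peak_ker /= lz zx zy scaler0 addr0.
move=> x clx; apply: hnorm_small => e e0.
have [C C0 bC] := cstar_bnd hE Ez.
have d0 : 0 < e / C by rewrite divr_gt0.
have : nbhs x (ball x (e / C)%:C) by apply: nbhsx_ballx; rewrite ltcR.
move=> /clx[y [zy]]; rewrite -ball_normE /= hnormE ltcR => /ltW xy.
have -> : z x = z (x - y) by rewrite (linB lz) zy subr0.
by rewrite (le_trans (bC _)) // -ler_pdivlMl // mulrC.
Qed.

Lemma peak_ker_invariant T x : E T -> peak_ker x -> peak_ker (T x).
Proof.
move=> ET zx; have := peak_unit_central hE rfdE pk ET => /(congr1 (fun g => g x)) /= zT.
by rewrite /peak_ker /= zT zx (lin0 (cstar_linear hE ET)).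
Qed.

(** [1 - z] is an orthogonal projection. *)
Lemma peak_compl_le x : hnorm (x - z x) <= hnorm x.
Proof.
rewrite -(@ler_pXn2r _ 2) ?nnegrE ?hnorm_ge0 // !hnorm_sq ripBl !ripBr.
have e : rip (z x) (z x) = rip (z x) x.
  by have := rip_star hE (z x) x Ez; rewrite zz peak_unit_star => ->.
by rewrite e (rip_sym (z x) x) subrr subr0 gerDl oppr_le0 -e rip_ge0.
Qed.

Variables (S : hilbertType R) (v : S -> H) (q : (H -> H) -> (S -> S)).
Hypothesis sq : is_subrep E (@idfun (H -> H)) peak_ker v q.

Let lv : linear v. Proof. by case: sq. Qed.
Let iv x y : inner (v x) (v y) = inner x y. Proof. by case: sq. Qed.
Let rv : range v = peak_ker. Proof. by case: sq. Qed.
Let vq T y : E T -> v (q T y) = T (v y). Proof. by case: sq => _ _ _ h ET; exact: h. Qed.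
Let injv : injective v. Proof. exact: isometry_inj. Qed.
Let rq : star_rep E q. Proof. exact: (subrep_star_rep hE (star_rep_id hE) sq). Qed.
Let hq : star_hom E q. Proof. by case: rq. Qed.
Let lq : linear_on E q. Proof. by case: hq. Qed.
Let zv y : z (v y) = 0.
Proof. by have : range v (v y) by [exists y]; rewrite rv. Qed.

Lemma compl_rep_unit : q idfun = idfun.
Proof. by apply/funext => y; apply: injv; rewrite vq //; exact: (cstar1 hE). Qed.

Lemma compl_rep_peak_unit : q z = 0.
Proof. by apply/funext => y; apply: injv; rewrite vq // zv (lin0 lv). Qed.

Lemma compl_proj_exists : exists w : H -> S, forall x, v (w x) = x - z x.
Proof.
suff /choice[w vw] : forall x, exists y, v y = x - z x by exists w.
move=> x; have : range v (x - z x) by rewrite rv /peak_ker /= (linB lz) zz subrr.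
by case=> y _ <-; exists y.
Qed.

(** For norm closedness, an operator [T] on the kernel of [z] that is a limit of
    restrictions is extended by [0] to [T' = v T w]; this is a limit of the
    elements [X (1 - z)], so it lies in [E] and restricts to [T]. *)
Lemma compl_image_cstar : unital_cstar_algebra (q @` E).
Proof.
have [w vw] := compl_proj_exists.
split; first split.
- by case: rq.
- by exists idfun; [exact: (cstar1 hE)|exact: compl_rep_unit].
- move=> a _ _ [T ET <-] [T' ET' <-]; exists (a *: T + T'); first exact: (cstar_comb hE).
  exact: lq.
- move=> _ _ [T ET <-] [T' ET' <-]; exists (T \o T'); first exact: (cstarM hE).
  exact: (rep_mul hq).
- move=> _ [T ET <-]; exists (q (star T)); first by exists (star T) => //; exact: (cstar_star hE).
  by case: hq => _ _; apply => //; [exact: (cstar_star hE)|exact: (starP hE)].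
move=> T bT lim; have [lT [M bM]] := bT.
have wle x : hnorm (w x) <= hnorm x.
  by rewrite -(isometry_hnorm iv) vw peak_compl_le.
have lw : linear w.
  move=> a x y; apply: injv; rewrite lv !vw lz scalerBr opprD.
  by rewrite addrACA.
pose T' := v \o (T \o w).
have ET' : E T'.
  case: hE => _ _; apply.
    split; first by move=> a x y; rewrite /T' /= lw lT lv.
    exists `|M| => x; rewrite /T' /= (isometry_hnorm iv) (le_trans (bM _)) //.
    by rewrite (@le_trans _ _ (`|M| * hnorm (w x))) ?ler_wpM2r ?hnorm_ge0 ?ler_norm // ler_wpM2l.
  move=> e e0; have [_ [X EX <-] TX] := lim (e / 2) (divr_gt0 e0 (ltr0Sn _ _)).
  have bTX : bounded_op (T - q X).
    have [lqX [N bN]] : bounded_op (q X) by case: rq => _; apply; exists X.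
    split.
      by move=> a x y; rewrite -[LHS]/(T _ - q X _) lT lqX opprD addrACA -scalerBr.
    exists (M + N) => x; rewrite mulrDl (le_trans (hnormD _ _)) // hnormN.
    by rewrite lerD.
  exists (X \o (idfun - z)).
    by apply: (cstarM hE) => //; apply: (cstarB hE) => //; exact: (cstar1 hE).
  apply: (@le_lt_trans _ _ (e / 2)); last by move: e0; lra.
  apply: opnorm_le => [|x]; first by rewrite divr_ge0 // ltW.
  have -> : (T' - (X \o (idfun - z))) x = v ((T - q X) (w x)).
    by rewrite (linB lv) vq // vw.
  rewrite (isometry_hnorm iv) (le_trans (opnorm_bound bTX _)) //.
  apply: (@le_trans _ _ (e / 2 * hnorm (w x))); first by rewrite ler_wpM2r ?hnorm_ge0 // ltW.
  by rewrite ler_wpM2l // divr_ge0 // ltW.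
exists T' => //; apply/funext => y; apply: injv; rewrite vq // /T' /=.
by congr (v (T _)); apply: injv; rewrite vw zv subr0.
Qed.

(** The representations other than [p] kill [z], so they do not distinguish [a]
    from [a (1 - z)], whose norm is that of [a] on the kernel of [z]. *)
Lemma compl_bnd_other n (a : 'M[H -> H]_n) (c : R) (K : hilbertType R)
    (s : (H -> H) -> (K -> K)) : 0 <= c -> mx_over E a -> bnd c (map_mx q a) ->
  other_rep E p s -> bnd c (map_mx s a).
Proof.
move=> c0 Ea bq Os; have rs := other_rep_star Os; have [hs bs] := rs.
have ls : linear_on E s by case: hs.
pose a' : 'M[H -> H]_n := \matrix_(i, j) (a i j - (a i j \o z)).
have Ea' : mx_over E a'.
  by move=> i j; rewrite mxE; apply: (cstarB hE) => //; exact: (cstarM hE).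
have -> : map_mx s a = map_mx s a'.
  apply/matrixP => i j; rewrite !mxE (linear_onB hE ls (Ea i j) (cstarM hE (Ea i j) Ez)).
  rewrite (rep_mul hs (Ea i j) Ez) (other_peak_unit hE rfdE pk Os).
  rewrite (_ : s (a i j) \o 0 = 0) ?subr0 //; apply/funext => y.
  exact: (lin0 (rep_linear bs (Ea i j))).
apply: (rep_bnd hE rs c0 Ea') => h.
have [w vw] := compl_proj_exists.
pose g i := w (h i).
have -> : mx_apply a' h = (fun i => v (mx_apply (map_mx q a) g i)).
  apply/funext => i; rewrite /mx_apply (lin_sum lv); apply: eq_bigr => j _.
  by rewrite !mxE vq // vw (linB (cstar_linear hE (Ea i j))).
have -> : l2norm (fun i => v (mx_apply (map_mx q a) g i)) = l2norm (mx_apply (map_mx q a) g).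
  by rewrite /l2norm; congr Num.sqrt; apply: eq_bigr => i _; rewrite (isometry_hnorm iv).
rewrite (le_trans (bq g)) // ler_wpM2l // -(@ler_pXn2r _ 2) ?nnegrE ?l2norm_ge0 // !l2norm_sq.
apply: ler_sum => i _; rewrite -!hnorm_sq ler_pXn2r ?nnegrE ?hnorm_ge0 //.
by rewrite -(isometry_hnorm iv) vw peak_compl_le.
Qed.

End ComplementaryRepresentation.

Section Dichotomy.
Context (R : realType) (H L : hilbertType R) (E A : set (H -> H)).
Variables (p f : (H -> H) -> (L -> L)).
Hypothesis hE : unital_cstar_algebra E.
Hypothesis rfdE : rfd E.
Hypothesis pk : strongly_peaking E E p.
Hypothesis uf : ucp E f.
Hypothesis AE : A `<=` E.
Hypothesis genA : forall G, unital_cstar_algebra G -> A `<=` G -> E `<=` G.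
Hypothesis fA : forall a, A a -> f a = p a.

(** If the iterates of [z] do not tend to [0], unit vectors [v_k] with
    [<phi^k z v_k, v_k> >= e] produce an invariant state, and [f = p]. *)
Lemma ucp_dichotomy : (forall x, E x -> f x = p x) \/
  forall e : R, 0 < e -> exists k, forall v,
    rip (phi_unit f hE rfdE pk k v) v <= e * rip v v.
Proof.
apply: contrapT => /not_orP[fp /existsNP[e /not_implyP[e0 /forallNP big]]]; apply: fp.
have bigv k : exists v : H, hnorm v = 1 /\ e <= rip (phi_unit f hE rfdE pk k v) v.
  have /existsNP[w /negP] := big k; rewrite -ltNge => lw.
  have lz : linear (phi_unit f hE rfdE pk k).
    by apply: (cstar_linear hE); exact: phi_unit_over.
  have w0 : 0 < hnorm w.
    rewrite lt_neqAle eq_sym hnorm_ge0 andbT; apply/eqP => /hnorm_eq0 w0.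
    by move: lw; rewrite w0 rip0r rip0r mulr0 ltxx.
  exists ((hnorm w)^-1%:C *: w); split.
    by rewrite hnormZ ger0_norm ?invr_ge0 ?hnorm_ge0 // mulVf // gt_eqF.
  rewrite (linZ lz) ripZl ripZr mulrA -expr2 exprVn.
  by rewrite mulrC ler_pdivlMr ?exprn_gt0 // hnorm_sq ltW.
have [v vP] := choice bigv.
have [psi ipsi z0] := inv_state_exists uf e0 (fun k => (vP k).1) (fun k => (vP k).2).
exact: (inv_state_rigid uf AE genA fA ipsi z0).
Qed.

End Dichotomy.

Theorem theorem1p2 (R : realType) (H K L : hilbertType R)
    (A : set (H -> H)) (E : set (K -> K)) (u : (H -> H) -> (K -> K))
    (p : (K -> K) -> (L -> L))
    (hA : unital_operator_algebra A)
    (hE : cstar_envelope A E u)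
    (hrfd : rfd E)
    (hp : strongly_peaking E E p) :
  finite_dim L /\ boundary_rep E (u @` A) p.
Proof.
have [cE [bu lu u1 isou] genE univ] := hE.
have fd := peaking_finite_dim cE hrfd hp.
split=> //; have ip : irreducible_rep E p by case: hp.
split=> // f uf fu.
have uE : u @` A `<=` E by rewrite genE => x ux M [_]; exact.
have genA G : unital_cstar_algebra G -> u @` A `<=` G -> E `<=` G.
  by move=> hG uG x; rewrite genE; apply; split.
have [//|small] := ucp_dichotomy cE hrfd hp uf uE genA fu; exfalso.
have kinv T x : E T -> peak_ker cE hrfd hp x -> peak_ker cE hrfd hp (idfun T x).
  exact: peak_ker_invariant.
have [S [v [q sq]]] := subrep_exists (peak_ker_closed cE hrfd hp) kinv.
have rq := subrep_star_rep cE (star_rep_id cE) sq.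
have [hq bq] := rq; have lq : linear_on E q by case: hq.
have Eu T : A T -> E (u T) by move=> AT; apply: uE; exists T.
pose iota T := q (u T).
have cq := compl_image_cstar sq.
have iotaE : iota @` A `<=` q @` E by move=> _ [T AT <-]; exists (u T) => //; exact: Eu.
have iota_iso : unital_complete_isometry A iota.
  split.
  - by move=> x /iotaE; exact: bq.
  - by move=> a T T' AT AT'; rewrite /iota lu // lq //; exact: Eu.
  - by rewrite /iota u1 (compl_rep_unit sq).
  move=> n T AT; rewrite -isou //.
  pose a := map_mx u T.
  have Ea : mx_over E a by move=> i j; rewrite mxE; exact: Eu.
  have -> : map_mx iota T = map_mx q a by apply/matrixP => i j; rewrite !mxE.
  rewrite -/a; have [C C0 bC] := mx_cstar_bnd cE Ea.
  have la := mx_cstar_lin cE Ea.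
  have ba := bnd_mx_opnorm la bC.
  have bqa := rep_bnd cE rq (mx_opnorm_ge0 a) Ea ba.
  apply/eqP; rewrite eq_le mx_opnorm_le ?mx_opnorm_ge0 //=.
  have c0 := mx_opnorm_ge0 (map_mx q a).
  have bc := bnd_mx_opnorm (rep_lin_mx bq Ea) bqa.
  apply: mx_opnorm_le => //.
  apply: (peak_norm_bound uf Ea _ c0 (ltW C0) bC _ small).
    by apply/matrixP => i j; rewrite !mxE fu //; exists (T i j).
  by move=> K' s Os; exact: (compl_bnd_other sq c0 Ea bc Os).
pose B := cstar_generated (iota @` A).
have cB : unital_cstar_algebra B := cstar_generated_cstar cq iotaE.
have [r [hr rB ru]] := univ S B iota cB iota_iso erefl.
have rr : star_rep B r by split=> // x; rewrite rB; exact: (cstar_bounded cE).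
have lr : linear_on B r by case: hr.
(* The elements that [r] recovers from their restriction form a C*-algebra, so
   they are all of [E], including [z], whose restriction is [0]. *)
pose G := [set x | [/\ E x, B (q x) & r (q x) = x]].
have A1 : A idfun by case: hA.
have cG : unital_cstar_algebra G.
  have q1 := compl_rep_unit sq.
  split; first split.
  - by move=> x [Ex _ _]; exact: (cstar_bounded cE).
  - split; [exact: (cstar1 cE)|by rewrite q1; exact: (cstar1 cB)|].
    by rewrite -u1 -[q (u idfun)]/(iota idfun) ru.
  - move=> a x y [Ex Bx rx] [Ey By ry]; split; first exact: (cstar_comb cE).
      by rewrite lq //; exact: (cstar_comb cB).
    by rewrite lq // lr // rx ry.
  - move=> x y [Ex Bx rx] [Ey By ry]; split; first exact: (cstarM cE).
      by rewrite (rep_mul hq Ex Ey); exact: (cstarM cB).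
    by rewrite (rep_mul hq Ex Ey) (rep_mul hr Bx By) rx ry.
  - move=> x [Ex Bx rx]; exists (star x); last exact: (starP cE).
    split; first exact: (cstar_star cE).
      by rewrite (rep_star cE hq Ex); exact: (cstar_star cB).
    by rewrite (rep_star cE hq Ex) (rep_star cB hr Bx) rx.
  move=> T bT lim.
  have ET : E T by have [_ _ cl] := cE; apply: cl => // e /lim[X [EX _ _] TX]; exists X.
  have BT : B (q T).
    have [_ _ cl] := cB; apply: cl; first by apply: bq; exists T.
    move=> e e0; have [X [EX BX _] /ltW TX] := lim (e / 2) (divr_gt0 e0 (ltr0Sn _ _)).
    exists (q X) => //; apply: (@le_lt_trans _ _ (e / 2)); last by move: e0; lra.
    rewrite -(linear_onB cE lq ET EX).
    apply: opnorm_le; first by rewrite divr_ge0 // ltW.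
    exact: (opnorm_rep cE rq (cstarB cE ET EX) TX).
  split=> //; apply/funext => w; apply/eqP; rewrite -subr_eq0; apply/eqP/hnorm_small => e e0.
  have d0 : 0 < 2 * hnorm w + 1 by rewrite ltr_wpDl // mulr_ge0 ?hnorm_ge0.
  have [X [EX BX rX] /ltW TX] := lim _ (divr_gt0 e0 d0).
  have ETX := cstarB cE ET EX; have BTX := cstarB cB BT BX.
  have qTX : forall y, hnorm (q (T - X) y) <= e / (2 * hnorm w + 1) * hnorm y.
    exact: (opnorm_rep cE rq ETX TX).
  rewrite (linear_onB cE lq ET EX) in qTX.
  have h1 := rep_contractive cB rr BTX (ltW (divr_gt0 e0 d0)) qTX w.
  have h2 := opnorm_rep cE (star_rep_id cE) ETX TX w.
  rewrite (linear_onB cB lr BT BX) rX in h1.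
  have -> : r (q T) w - T w = (r (q T) - X) w - (T - X) w.
    by rewrite -[RHS]/(r (q T) w - X w - (T w - X w)) opprB addrA subrK.
  rewrite (le_trans (hnormD _ _)) // hnormN.
  rewrite (le_trans (lerD h1 h2)) //.
  rewrite [leLHS](_ : _ = e * (2 * hnorm w / (2 * hnorm w + 1))); last by ring.
  by rewrite ler_piMr ?(ltW e0) // ler_pdivrMr // mul1r lerDl.
have uG : u @` A `<=` G.
  move=> _ [T AT <-]; have Biota : B (iota T) by move=> M [_]; apply; exists T.
  by split=> //; [exact: Eu|rewrite -[q (u T)]/(iota T) ru].
have [_ _] := genA G cG uG _ (peak_unit_over cE hrfd hp).
rewrite (compl_rep_peak_unit sq) (linear_on0 cB lr) => z0.
have [x x0] := irreducible_nonzero ip; apply: x0.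
have lp : linear_on E p by case: ip => -[[]].
have := p_peak_unit cE hrfd hp; rewrite -z0 (linear_on0 cE lp).
by move=> /(congr1 (fun g => g x)) /= <-.
Qed.
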